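(* Let $p$ be a prime and let $A$ be a $p$-adically complete $\mathbf{Z}_p$-algebra. Let $M$ be a rank one étale $(\varphi,\Gamma)$-module with $A$-coefficients, i.e. a rank one projective étale $(\varphi,\Gamma)$-module over $\mathbf{A}'_{\mathbf{Q}_p,A}$. Then there exist a continuous character $\delta:\mathbf{Q}_p^\times\to A^\times$ and an invertible $A$-module $L$ such that $M\cong \mathbf{A}'_{\mathbf{Q}_p,A}(\delta)\otimes_A L$ as $(\varphi,\Gamma)$-modules. Here $\mathbf{A}'_{\mathbf{Q}_p,A}(\delta)$ denotes the free $(\varphi,\Gamma)$-module of rank $1$ over $\mathbf{A}'_{\mathbf{Q}_p,A}$ with a basis $v$ for which $\varphi(v)=\delta(p)v$ and $\gamma(v)=\delta(\gamma)v$ for all $\gamma\in\mathbf{Z}_p^\times$.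
   Context: For a $p$-adically complete $\mathbf{Z}_p$-algebra $A$, $\mathbf{A}'_{\mathbf{Q}_p,A}$ is the $p$-adic completion of $A[[T]][1/T]$ (this is $\mathbf{A}'_{\mathbf{Q}_p}\widehat{\otimes}_{\mathbf{Z}_p}A$, where $\mathbf{A}'_{\mathbf{Q}_p}$ is the $p$-adic completion of $\mathbf{Z}_p((T))$). It carries the commuting continuous $A$-linear actions of $\varphi$ and $\Gamma=\mathbf{Z}_p^\times$ given by $\varphi(T)=(1+T)^p-1$ and $\gamma(T)=(1+T)^\gamma-1$ for $\gamma\in\mathbf{Z}_p^\times$. A rank one projective étale $(\varphi,\Gamma)$-module with $A$-coefficients is a finite projective $\mathbf{A}'_{\mathbf{Q}_p,A}$-module $M$ of constant rank $1$ with a $\varphi$-semilinear map $\varphi:M\to M$ whose linearization $\varphi^*M\to M$ is an isomorphism, and a continuous semilinear action of $\Gamma$ commuting with $\varphi$. (Continuity is for the natural topology on finite projective modules, where $\mathbf{A}'_{\mathbf{Q}_p,A}=\varprojlim_a (A/p^a)((T))$ has the inverse limit of the $T$-adic topologies.) A character $\delta:\mathbf{Q}_p^\times\to A^\times$ is continuous if, for each $a\ge 1$, the induced homomorphism to $(A/p^aA)^\times$ is continuous for the discrete topology on the target. On $\mathbf{A}'_{\mathbf{Q}_p,A}(\delta)\otimes_A L$, $\varphi$ and $\Gamma$ act through the first factor. *)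

(* Defs.v *)
From HB Require Import structures.
From mathcomp Require Import all_boot all_order all_algebra.
From mathcomp Require Import generic_quotient.
From mathcomp Require Import boolp classical_sets functions fsbigop.
From mathcomp Require Import zify ring.

Set Implicit Arguments.
Unset Strict Implicit.
Unset Printing Implicit Defensive.

Import Order.TTheory GRing.Theory Num.Theory.

Local Open Scope ring_scope.
Local Open Scope quotient_scope.

Section PDvd.
Variables (R : comPzRingType) (p : nat).

Definition pdvd (n : nat) (x : R) : Prop := exists y, x = p%:R ^+ n * y.

Lemma pdvd0 n : pdvd n 0. Proof. by exists 0; rewrite mulr0. Qed.

Lemma pdvdD n x y : pdvd n x -> pdvd n y -> pdvd n (x + y).
Proof. by move=> [a ->] [b ->]; exists (a + b); rewrite mulrDr. Qed.

Lemma pdvdN n x : pdvd n x -> pdvd n (- x).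
Proof. by move=> [a ->]; exists (- a); rewrite mulrN. Qed.

Lemma pdvdB n x y : pdvd n x -> pdvd n y -> pdvd n (x - y).
Proof. by move=> hx hy; apply: pdvdD => //; apply: pdvdN. Qed.

Lemma pdvdMl n x y : pdvd n y -> pdvd n (x * y).
Proof. by move=> [b ->]; exists (x * b); rewrite mulrCA. Qed.

Lemma pdvdMr n x y : pdvd n x -> pdvd n (x * y).
Proof. by rewrite mulrC; apply: pdvdMl. Qed.

Lemma pdvd_le m n x : (m <= n)%N -> pdvd n x -> pdvd m x.
Proof.
by move=> /subnKC <- [y ->]; exists (p%:R ^+ (n - m) * y); rewrite exprD mulrA.
Qed.

Lemma pdvd_mulB n x x' y y' :
  pdvd n (x - x') -> pdvd n (y - y') -> pdvd n (x * y - x' * y').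
Proof.
move=> hx hy; have -> : x * y - x' * y' = (x - x') * y + x' * (y - y').
  by rewrite mulrBl mulrBr addrA subrK.
by apply: pdvdD; [apply: pdvdMr | apply: pdvdMl].
Qed.

End PDvd.

Section Completion.
Variables (p : nat) (R : comPzRingType).

Definition coherent : {pred nat -> R} :=
  fun x => `[< forall n, pdvd p n (x n.+1 - x n) >].

Lemma coherentP (x : nat -> R) :
  reflect (forall n, pdvd p n (x n.+1 - x n)) (x \in coherent).
Proof. exact: asboolP. Qed.

Lemma coherent_subring : subring_closed coherent.
Proof.
split.
- by apply/coherentP => n; rewrite subrr; apply: pdvd0.
- move=> x y /coherentP hx /coherentP hy; apply/coherentP => n.
  have -> : (x - y) n.+1 - (x - y) n = (x n.+1 - x n) - (y n.+1 - y n).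
    by rewrite /= !opprB addrACA [RHS]addrACA; congr (_ + _); rewrite addrC.
  exact: pdvdB.
- move=> x y /coherentP hx /coherentP hy; apply/coherentP => n.
  exact: pdvd_mulB.
Qed.

HB.instance Definition _ :=
  GRing.isSubringClosed.Build (nat -> R) coherent coherent_subring.

Record coherent_seq := CoherentSeq {
  cseq :> nat -> R;
  cseqP : cseq \in coherent
}.

HB.instance Definition _ := [isSub for cseq].
HB.instance Definition _ := [Choice of coherent_seq by <:].
HB.instance Definition _ :=
  GRing.SubChoice_isSubComPzRing.Build (nat -> R) coherent coherent_seq
    coherent_subring.

(* A sequence (x_n) stands for the element (x_n mod p^n)_n of lim_n R/p^n R. *)
Definition cseq_eq (x y : coherent_seq) : bool :=
  `[< forall n, pdvd p n (x n - y n) >].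

Lemma cseq_eqP (x y : coherent_seq) : reflect (forall n, pdvd p n (x n - y n)) (cseq_eq x y).
Proof. exact: asboolP. Qed.

Lemma cseq_eq_refl : reflexive cseq_eq.
Proof. by move=> x; apply/cseq_eqP => n; rewrite subrr; apply: pdvd0. Qed.

Lemma cseq_eq_sym : symmetric cseq_eq.
Proof.
by move=> x y; apply/cseq_eqP/cseq_eqP => h n; rewrite -opprB; apply: pdvdN.
Qed.

Lemma cseq_eq_trans : transitive cseq_eq.
Proof.
move=> y x z /cseq_eqP hx /cseq_eqP hy; apply/cseq_eqP => n.
by rewrite -(subrK (y n) (x n)) -addrA; apply: pdvdD.
Qed.

Canonical cseq_eq_equiv :=
  EquivRel cseq_eq cseq_eq_refl cseq_eq_sym cseq_eq_trans.

Definition completion := {eq_quot cseq_eq}.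

HB.instance Definition _ : EqQuotient _ cseq_eq completion :=
  EqQuotient.on completion.
HB.instance Definition _ := Choice.on completion.

Definition compl_zero : completion := lift_cst completion 0.
Definition compl_one : completion := lift_cst completion 1.
Definition compl_opp := lift_op1 completion -%R.
Definition compl_add := lift_op2 completion +%R.
Definition compl_mul := lift_op2 completion *%R.
Canonical pi_compl_zero := PiConst compl_zero.
Canonical pi_compl_one := PiConst compl_one.

Lemma cseq_reprP (x : coherent_seq) n : pdvd p n (x n - repr (\pi_completion x) n).
Proof.
suff: cseq_eq x (repr (\pi_completion x)) by move/cseq_eqP.
by apply/eqmodP; rewrite /= reprK.
Qed.

Lemma pi_compl_opp : {morph \pi : x / - x >-> compl_opp x}.
Proof.
move=> x; unlock compl_opp; apply/eqmodP/cseq_eqP => n /=.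
by rewrite -opprD; apply: pdvdN; apply: cseq_reprP.
Qed.
Canonical pi_compl_opp_morph := PiMorph1 pi_compl_opp.

Lemma pi_compl_add : {morph \pi : x y / x + y >-> compl_add x y}.
Proof.
move=> x y; unlock compl_add; apply/eqmodP/cseq_eqP => n /=.
by rewrite opprD addrACA; apply: pdvdD; apply: cseq_reprP.
Qed.
Canonical pi_compl_add_morph := PiMorph2 pi_compl_add.

Lemma pi_compl_mul : {morph \pi : x y / x * y >-> compl_mul x y}.
Proof.
move=> x y; unlock compl_mul; apply/eqmodP/cseq_eqP => n /=.
by apply: pdvd_mulB; apply: cseq_reprP.
Qed.
Canonical pi_compl_mul_morph := PiMorph2 pi_compl_mul.

Lemma compl_addA : associative compl_add.
Proof.
by elim/quotW=> x; elim/quotW=> y; elim/quotW=> z; rewrite !piE addrA.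
Qed.

Lemma compl_addC : commutative compl_add.
Proof. by elim/quotW=> x; elim/quotW=> y; rewrite !piE addrC. Qed.

Lemma compl_add0 : left_id compl_zero compl_add.
Proof. by elim/quotW=> x; rewrite !piE add0r. Qed.

Lemma compl_addN : left_inverse compl_zero compl_opp compl_add.
Proof. by elim/quotW=> x; rewrite !piE addNr. Qed.

HB.instance Definition _ := GRing.isZmodule.Build completion
  compl_addA compl_addC compl_add0 compl_addN.

Lemma compl_mulA : associative compl_mul.
Proof.
by elim/quotW=> x; elim/quotW=> y; elim/quotW=> z; rewrite !piE mulrA.
Qed.

Lemma compl_mulC : commutative compl_mul.
Proof. by elim/quotW=> x; elim/quotW=> y; rewrite !piE mulrC. Qed.

Lemma compl_mul1 : left_id compl_one compl_mul.
Proof. by elim/quotW=> x; rewrite !piE mul1r. Qed.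

Lemma compl_mulDl : left_distributive compl_mul compl_add.
Proof.
by elim/quotW=> x; elim/quotW=> y; elim/quotW=> z; rewrite !piE mulrDl.
Qed.

HB.instance Definition _ := GRing.Zmodule_isComPzRing.Build completion
  compl_mulA compl_mulC compl_mul1 compl_mulDl.

Lemma pi_cseq_is_zmod_morphism : zmod_morphism \pi_completion.
Proof. by move=> x y; rewrite !piE. Qed.

Lemma pi_cseq_is_monoid_morphism : monoid_morphism \pi_completion.
Proof. by split=> [|x y]; rewrite !piE. Qed.

HB.instance Definition _ := GRing.isZmodMorphism.Build coherent_seq completion
  \pi_completion pi_cseq_is_zmod_morphism.
HB.instance Definition _ := GRing.isMonoidMorphism.Build coherent_seq completion
  \pi_completion pi_cseq_is_monoid_morphism.

Lemma const_coherent (r : R) : (fun=> r) \in coherent.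
Proof. by apply/coherentP => n; rewrite subrr; apply: pdvd0. Qed.

Definition to_completion (r : R) : completion :=
  \pi_completion (CoherentSeq (const_coherent r)).

Lemma to_completion_is_zmod_morphism : zmod_morphism to_completion.
Proof.
move=> x y; rewrite /to_completion -[RHS]pi_cseq_is_zmod_morphism.
by congr (\pi _); apply/val_inj.
Qed.

Lemma to_completion_is_monoid_morphism : monoid_morphism to_completion.
Proof.
have [pi1 piM] := pi_cseq_is_monoid_morphism.
split=> [|x y]; rewrite /to_completion -?pi1 -?piM;
  by congr (\pi _); apply/val_inj.
Qed.

HB.instance Definition _ := GRing.isZmodMorphism.Build R completion
  to_completion to_completion_is_zmod_morphism.
HB.instance Definition _ := GRing.isMonoidMorphism.Build R completion
  to_completion to_completion_is_monoid_morphism.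

(* The images of x and r in R / p^n R coincide. *)
Definition compl_eqmod (n : nat) (x : completion) (r : R) : Prop :=
  pdvd p n (repr x n - r).

End Completion.

(* Bijectivity: complete includes separated. *)
Definition padically_complete (p : nat) (R : comPzRingType) : Prop :=
  bijective (@to_completion p R).
Section Laurent.
Variable A : comPzRingType.

Definition bounded_below : {pred int -> A} :=
  fun f => `[< exists N : int, forall i, i < N -> f i = 0 >].

Lemma bounded_belowP (f : int -> A) :
  reflect (exists N : int, forall i, i < N -> f i = 0) (f \in bounded_below).
Proof. exact: asboolP. Qed.

Lemma bounded_below_zmod : zmod_closed bounded_below.
Proof.
split=> [|f g /bounded_belowP[N hf] /bounded_belowP[M hg]].
  by apply/bounded_belowP; exists 0.
apply/bounded_belowP; exists (Num.min N M) => i.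
rewrite lt_min => /andP[iN iM]; have -> : (f - g) i = f i - g i by [].
by rewrite hf// hg// subrr.
Qed.

HB.instance Definition _ :=
  GRing.isZmodClosed.Build (int -> A) bounded_below bounded_below_zmod.

(* A((T)) = A[[T]][1/T]; f i is the coefficient of T^i. *)
Record laurent := Laurent {
  lcoef :> int -> A;
  lcoefP : lcoef \in bounded_below
}.

HB.instance Definition _ := [isSub for lcoef].
HB.instance Definition _ := [Choice of laurent by <:].
HB.instance Definition _ := [SubChoice_isSubZmodule of laurent by <:].

Lemma laurentP (f g : laurent) : (forall i, f i = g i) -> f = g.
Proof. by move=> h; apply/val_inj/funext. Qed.

(* All but finitely many terms of the sum vanish. *)
Definition lconv (f g : int -> A) (n : int) : A :=
  \sum_(i \in [set: int]) f i * g (n - i).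

Lemma lconvE (f g : int -> A) (N M n : int) (K : nat) :
    (forall i, i < N -> f i = 0) -> (forall i, i < M -> g i = 0) ->
    n - N - M < K%:Z ->
  lconv f g n = \sum_(k < K) f (N + k%:Z) * g (n - N - k%:Z).
Proof.
move=> hf hg hK; pose r := [seq N + k%:Z | k <- iota 0 K].
have ur : uniq r by rewrite map_inj_uniq ?iota_uniq// => i j /addrI[].
rewrite /lconv (@fsbigE _ _ _ _ _ r)//; last first.
  move=> i _ hi; case: (ltP i N) => iN; first by rewrite hf// mul0r.
  rewrite (hg (n - i)) ?mulr0//.
  suff : N + K%:Z <= i by lia.
  rewrite leNgt; apply/negP => hi2; move/negP: hi; apply.
  apply/mapP; exists (absz (i - N)%R); last by lia.
  by rewrite mem_iota; lia.
rewrite [LHS](_ : _ = \sum_(i <- r) f i * g (n - i)); last first.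
  by apply: eq_bigl => i; rewrite in_setT.
rewrite big_map -(big_mkord xpredT (fun k => f (N + k%:Z) * g (n - N - k%:Z))).
by rewrite /index_iota subn0; apply: eq_bigr => k _; rewrite opprD addrA.
Qed.

Lemma lconv_small (f g : int -> A) (N M n : int) :
    (forall i, i < N -> f i = 0) -> (forall i, i < M -> g i = 0) ->
  n < N + M -> lconv f g n = 0.
Proof.
by move=> hf hg hn; rewrite (lconvE (K := 0) hf hg) ?big_ord0//; lia.
Qed.

Lemma lmul_subproof (f g : laurent) : lconv f g \in bounded_below.
Proof.
have /bounded_belowP[N hf] := lcoefP f; have /bounded_belowP[M hg] := lcoefP g.
by apply/bounded_belowP; exists (N + M) => i; apply: lconv_small.
Qed.

Definition lmul (f g : laurent) : laurent := Laurent (lmul_subproof f g).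

Lemma lmono_subproof (a : A) (n : int) :
  (fun i => if i == n then a else 0) \in bounded_below.
Proof.
by apply/bounded_belowP; exists n => i; case: eqP => // ->; rewrite ltxx.
Qed.

(* a T^n *)
Definition lmono (a : A) (n : int) : laurent := Laurent (lmono_subproof a n).

Lemma lmulC : commutative lmul.
Proof.
move=> f g; apply: laurentP => n /=.
have /bounded_belowP[N hf] := lcoefP f; have /bounded_belowP[M hg] := lcoefP g.
case: (ltP n (N + M)) => hn.
  by rewrite (lconv_small hf hg)// (lconv_small hg hf)// addrC.
have [K hK] : exists K : nat, n = N + M + K%:Z.
  by exists (absz (n - N - M)%R); lia.
rewrite (lconvE (K := K.+1) hf hg); last by lia.
rewrite (lconvE (K := K.+1) hg hf); last by lia.
rewrite (reindex_inj rev_ord_inj)/=; apply: eq_bigr => k _.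
by rewrite mulrC; congr (g _ * f _); have := ltn_ord k; lia.
Qed.

Lemma lmulA : associative lmul.
Proof.
move=> f g h; apply: laurentP => n /=.
have /bounded_belowP[N hf] := lcoefP f; have /bounded_belowP[M hg] := lcoefP g.
have /bounded_belowP[L hh] := lcoefP h.
have hfg i : i < N + M -> lconv f g i = 0 by apply: lconv_small.
have hgh i : i < M + L -> lconv g h i = 0 by apply: lconv_small.
pose K := (absz (n - N - M - L)%R).+1.
rewrite (lconvE (K := K) hf hgh); last by lia.
rewrite (lconvE (K := K) hfg hh); last by lia.
transitivity (\sum_(j < K) \sum_(k < K)
    f (N + j%:Z) * (g (M + k%:Z - j%:Z) * h (n - N - M - k%:Z))).
  apply: eq_bigr => j _; rewrite -mulr_sumr; congr (_ * _).
  have hg' i : i < M - j%:Z -> g i = 0 by move=> ?; apply: hg; lia.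
  rewrite (lconvE (K := K) hg' hh); last by lia.
  by apply: eq_bigr => k _; congr (g _ * h _); lia.
rewrite exchange_big; apply: eq_bigr => k _ /=.
rewrite (lconvE (K := K) hf hg); last by have := ltn_ord k; lia.
rewrite mulr_suml; apply: eq_bigr => j _.
by rewrite mulrA; congr (f _ * g _ * h _); lia.
Qed.

Lemma lmono_mul (a : A) (m : int) (f : laurent) (n : int) :
  lmul (lmono a m) f n = a * f (n - m).
Proof.
have /bounded_belowP[M hf] := lcoefP f.
have hm i : i < m -> lmono a m i = 0.
  by move=> /=; case: eqP => // ->; rewrite ltxx.
rewrite /= (lconvE (K := (absz (n - m - M)%R).+1) hm hf); last by lia.
rewrite big_ord_recl big1 ?addr0; last first.
  move=> i _; rewrite [lmono _ _ _]/= ifF ?mul0r//.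
  by apply/eqP => /=; rewrite /bump /=; lia.
rewrite /= ifT; last by apply/eqP; lia.
by congr (_ * f _); lia.
Qed.

Lemma lmul1 : left_id (lmono 1 0) lmul.
Proof. by move=> f; apply: laurentP => n; rewrite lmono_mul mul1r subr0. Qed.

Lemma lmulDl : left_distributive lmul +%R.
Proof.
move=> f g h; apply: laurentP => n.
have /bounded_belowP[N hf] := lcoefP f; have /bounded_belowP[M hg] := lcoefP g.
have /bounded_belowP[L hh] := lcoefP h.
pose B := Num.min N M.
have hB : B <= N /\ B <= M by rewrite /B; lia.
have hf' i : i < B -> f i = 0 by move=> ?; apply: hf; lia.
have hg' i : i < B -> g i = 0 by move=> ?; apply: hg; lia.
have hfg i : i < B -> (f + g) i = 0.
  move=> iB; have -> : (f + g) i = f i + g i by [].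
  by rewrite hf'// hg'// addr0.
pose K := (absz (n - B - L)%R).+1.
have hK : n - B - L < K%:Z by lia.
transitivity (lconv f h n + lconv g h n); last by [].
rewrite /= (lconvE hfg hh hK) (lconvE hf' hh hK) (lconvE hg' hh hK).
by rewrite -big_split; apply: eq_bigr => k _ /=; rewrite mulrDl.
Qed.

HB.instance Definition _ := GRing.Zmodule_isComPzRing.Build laurent
  lmulA lmulC lmul1 lmulDl.

Definition lconst (a : A) : laurent := lmono a 0.

Lemma lconst_is_zmod_morphism : zmod_morphism lconst.
Proof.
move=> a b; apply: laurentP => i.
have -> : (lconst a - lconst b) i = lconst a i - lconst b i by [].
by rewrite /=; case: eqP => // _; rewrite subrr.
Qed.

Lemma lconst_is_monoid_morphism : monoid_morphism lconst.
Proof.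
split=> // a b; apply: laurentP => i; rewrite [RHS](lmono_mul _ 0) subr0 /=.
by case: eqP => // _; rewrite mulr0.
Qed.

HB.instance Definition _ := GRing.isZmodMorphism.Build A laurent
  lconst lconst_is_zmod_morphism.
HB.instance Definition _ := GRing.isMonoidMorphism.Build A laurent
  lconst lconst_is_monoid_morphism.

Lemma lseries_subproof (c : nat -> A) :
  (fun i : int => if i is Posz n then c n else 0) \in bounded_below.
Proof. by apply/bounded_belowP; exists 0 => -[]. Qed.

(* The power series \sum_n c_n T^n *)
Definition lseries (c : nat -> A) : laurent := Laurent (lseries_subproof c).

End Laurent.
Lemma coherent_le (p : nat) (R : comPzRingType) (x : coherent_seq p R) m n :
  (m <= n)%N -> pdvd p m (x n - x m).
Proof.
have /coherentP hx := cseqP x.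
elim: n => [|n IH]; first by rewrite leqn0 => /eqP->; rewrite subrr; apply: pdvd0.
rewrite leq_eqVlt => /predU1P[->|]; first by rewrite subrr; apply: pdvd0.
rewrite ltnS => mn; rewrite -(subrK (x n) (x n.+1)) -addrA.
by apply: pdvdD (IH mn); apply: pdvd_le (hx n).
Qed.

Lemma compl_eqP (p : nat) (R : comPzRingType) (x y : coherent_seq p R) :
  \pi_(completion p R) x = \pi y <-> forall n, pdvd p n (x n - y n).
Proof.
split=> [/eqmodP/cseq_eqP//|h].
by apply/eqmodP/cseq_eqP.
Qed.

(* The primality proof is kept as an argument so that the integral domain
   structure below can be inferred from the type. *)
Definition Zpadic (p : nat) (p_pr : prime p) : Type := completion p int.

Section Zpadic.
Variables (p : nat) (p_pr : prime p).
Local Notation Zpadic := (Zpadic p_pr).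

HB.instance Definition _ := GRing.ComPzRing.on Zpadic.

Lemma pdvd_int n (x : int) : pdvd p n x <-> ((p ^ n)%N %| `|x|)%N.
Proof.
split=> [[y ->]|/dvdnP[k hk]].
  by rewrite abszM abszX natz absz_nat dvdn_mulr.
exists ((-1) ^+ (x < 0)%R * k%:Z).
rewrite {1}[x]intEsign hk PoszM (_ : (p ^ n)%:Z = p%:R ^+ n); first by ring.
by rewrite -natz natrX.
Qed.

Lemma zp_eq0 (x : coherent_seq p int) :
  \pi_Zpadic x = 0 :> Zpadic <-> forall n, pdvd p n (x n).
Proof.
have -> : 0 = \pi_Zpadic 0 :> Zpadic by rewrite !piE.
rewrite compl_eqP; split=> h n; first by have := h n; rewrite subr0.
by rewrite subr0.
Qed.

Lemma zp_oner_neq0 : 1 != 0 :> Zpadic.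
Proof.
have -> : 1 = \pi_Zpadic 1 :> Zpadic by rewrite !piE.
apply/eqP => /zp_eq0/(_ 1%N)/pdvd_int; rewrite expn1 dvdn1 => /eqP p1.
by move: p_pr; rewrite p1.
Qed.

HB.instance Definition _ := GRing.PzSemiRing_isNonZero.Build Zpadic zp_oner_neq0.

Definition zp_unit : {pred Zpadic} := fun x => `[< exists y, y * x = 1 >].
Definition zp_inv (x : Zpadic) : Zpadic :=
  if x \in zp_unit then xget x [set y | y * x = 1] else x.

Lemma zp_mulVx : {in zp_unit, left_inverse 1 zp_inv *%R}.
Proof.
move=> x ux; rewrite /zp_inv ux; have /asboolP[y hy] := ux.
exact: (@xgetPex _ x [set y | y * x = 1] (ex_intro _ y hy)).
Qed.

Lemma zp_unitPl (x y : Zpadic) : y * x = 1 -> zp_unit x.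
Proof. by move=> h; apply/asboolP; exists y. Qed.

Lemma zp_inv_out : {in [predC zp_unit], zp_inv =1 id}.
Proof. by move=> x; rewrite inE /zp_inv => /negPf->. Qed.

HB.instance Definition _ := GRing.ComNzRing_hasMulInverse.Build Zpadic
  zp_mulVx zp_unitPl zp_inv_out.

Lemma zp_mulf_eq0 (x y : Zpadic) : x * y = 0 -> (x == 0) || (y == 0).
Proof.
elim/quotW: x => x; elim/quotW: y => y.
have -> : \pi_Zpadic x * \pi_Zpadic y = \pi_Zpadic (x * y) :> Zpadic by rewrite !piE.
move=> /zp_eq0 hxy; apply/orP; apply: contrapT => /not_orP[].
move=> x0; have /existsNP[n hn] : ~ forall k, pdvd p k (x k).
  by move=> h; apply: x0; apply/eqP/zp_eq0.
move=> y0; have /existsNP[m hm] : ~ forall k, pdvd p k (y k).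
  by move=> h; apply: y0; apply/eqP/zp_eq0.
have hx : ~ pdvd p n (x (n + m)%N).
  move=> h; apply: hn; rewrite -[x n](subKr (x (n + m)%N)).
  by apply: pdvdB => //; apply: coherent_le; rewrite leq_addr.
have hy : ~ pdvd p m (y (n + m)%N).
  move=> h; apply: hm; rewrite -[y m](subKr (y (n + m)%N)).
  by apply: pdvdB => //; apply: coherent_le; rewrite leq_addl.
have /pdvd_int := hxy (n + m)%N; rewrite [X in absz X]/= abszM.
move: hx hy; rewrite !pdvd_int; set a := absz _; set b := absz _ => ha hb.
have a0 : (0 < a)%N by rewrite lt0n; apply/eqP => a0; apply: ha; rewrite a0.
have b0 : (0 < b)%N by rewrite lt0n; apply/eqP => b0; apply: hb; rewrite b0.
move: ha hb; rewrite !pfactor_dvdn ?muln_gt0 ?a0//= lognM//.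
lia.
Qed.

HB.instance Definition _ := GRing.ComUnitRing_isIntegral.Build Zpadic zp_mulf_eq0.

Definition Qpadic := {fraction Zpadic}.

(* binom(x, n) = x (x - 1) ... (x - n + 1) / n!, which lies in Z_p *)
Definition zp_binom (x : Zpadic) (n : nat) : Zpadic :=
  xget 0 [set z : Zpadic | n`!%:R * z = \prod_(i < n) (x - i%:R)].

End Zpadic.

Section ZpBinom.
Variables (p : nat) (p_pr : prime p).
Local Notation Zpadic := (Zpadic p_pr).

Lemma cseq_natr (i k : nat) : (i%:R : coherent_seq p int) k = i%:Z.
Proof.
elim: i => // i IH.
have -> : (i.+1%:R : coherent_seq p int) k = 1 + (i%:R : coherent_seq p int) k.
  by rewrite mulrS.
by rewrite IH.
Qed.

Lemma zp_natr (i : nat) : i%:R = \pi_(completion p int) i%:R :> Zpadic.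
Proof.
elim: i => [|i IH]; first by rewrite !mulr0n !piE.
by rewrite !mulrS IH !piE.
Qed.

Lemma zp_natr_neq0 (n : nat) : (0 < n)%N -> n%:R != 0 :> Zpadic.
Proof.
move=> n0; rewrite zp_natr; apply/eqP => /zp_eq0/(_ n)/pdvd_int.
rewrite cseq_natr absz_nat pfactor_dvdn// leqNgt ltn_logl//.
Qed.

Lemma zp_binom_exists (x : Zpadic) (n : nat) :
  exists z : Zpadic, n`!%:R * z = \prod_(i < n) (x - i%:R).
Proof.
elim/quotW: x => x.
pose d := n`!; have d0 : (0 < d)%N by apply: fact_gt0.
pose m k : nat := absz (x (k + d)%N %% (p ^ (k + d))%N)%Z.
have pk0 k : (p ^ k)%N != 0%N by rewrite -lt0n expn_gt0 prime_gt0.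
have mE k : ((m k)%:Z = x (k + d)%N %% (p ^ (k + d))%N)%Z.
  by rewrite /m gez0_abs// modz_ge0// pk0.
have mx k : pdvd p (k + d) ((m k)%:Z - x (k + d)%N).
  apply/pdvd_int; rewrite -[X in (X %| _)%N]absz_nat -dvdzE mE.
  rewrite {2}[x _](divz_eq _ (p ^ (k + d))%N%:Z) opprD addrCA subrr addr0.
  by rewrite rpredN dvdz_mull.
have ffE k : (d * 'C(m k, n))%N%:Z = \prod_(i < n) ((m k)%:Z - i%:Z).
  rewrite mulnC bin_ffact; move: (m k) => q {mE mx}.
  case: (leqP n q) => nq.
    rewrite ffact_prod -natz natr_prod; apply: eq_bigr => i _.
    by rewrite natz subzn// ltnW// (leq_trans _ nq).
  by rewrite ffact_small// (bigD1 (Ordinal nq))//= subrr mul0r.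
have prodC (a b : int) k : pdvd p k (a - b) ->
    pdvd p k (\prod_(i < n) (a - i%:Z) - \prod_(i < n) (b - i%:Z)).
  move=> hab; elim/big_rec2: _ => [|i u v _ IH]; first by rewrite subrr; apply: pdvd0.
  by apply: pdvd_mulB => //; rewrite opprB addrA subrK.
have lgd : (logn p d <= d)%N.
  by rewrite -ltnS (leq_trans (ltn_logl _ _))// ?prime_gt1.
have cz : (fun k => 'C(m k, n)%:Z : int) \in @coherent p int.
  apply/coherentP => k.
  have : pdvd p (k + d) (d%:Z * ('C(m k.+1, n)%:Z - 'C(m k, n)%:Z)).
    rewrite mulrBr -!PoszM !ffE; apply: prodC.
    rewrite -(subrK (x (k.+1 + d)%N) (m k.+1)%:Z) -addrA.
    apply: pdvdD; first by apply: pdvd_le (mx _); rewrite leq_add2r.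
    rewrite -(subrK (x (k + d)%N) (x (k.+1 + d)%N)) -addrA.
    apply: pdvdD; first by apply: coherent_le; rewrite leq_add2r.
    by rewrite -opprB; apply: pdvdN.
  rewrite !pdvd_int abszM absz_nat; set c := absz _.
  case: (posnP c) => [->|c0]; first by rewrite dvdn0.
  rewrite !pfactor_dvdn ?muln_gt0 ?d0// lognM//; lia.
exists (\pi_(completion p int) (CoherentSeq cz)).
have -> : \prod_(i < n) (\pi_Zpadic x - i%:R) =
    \pi_(completion p int) (\prod_(i < n) (x - i%:R)) :> Zpadic.
  have [pi1 piM] := @pi_cseq_is_monoid_morphism p int.
  rewrite (big_morph _ piM pi1).
  by apply: eq_bigr => i _; rewrite zp_natr !piE.
rewrite zp_natr (_ : _ * _ = \pi_(completion p int) (d%:R * CoherentSeq cz)) ?piE//.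
apply/compl_eqP => k.
have -> : (d%:R * CoherentSeq cz : coherent_seq p int) k =
    (d%:R : coherent_seq p int) k * 'C(m k, n)%:Z by [].
rewrite cseq_natr -PoszM ffE.
have -> : (\prod_(i < n) (x - i%:R)) k = \prod_(i < n) (x k - i%:Z).
  elim/big_rec2: _ => // i u v _ <-.
  have -> : ((x - i%:R) * v : coherent_seq p int) k =
    (x k - (i%:R : coherent_seq p int) k) * v k by [].
  by rewrite cseq_natr.
apply: prodC; rewrite -(subrK (x (k + d)%N) (m k)%:Z) -addrA.
apply: pdvdD; first by apply: pdvd_le (mx _); rewrite leq_addr.
by apply: coherent_le; rewrite leq_addr.
Qed.

Lemma zp_binomE (x : Zpadic) (n : nat) :
  n`!%:R * zp_binom x n = \prod_(i < n) (x - i%:R).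
Proof.
have [z hz] := zp_binom_exists x n.
exact: (@xgetPex _ 0 [set z : Zpadic | n`!%:R * z = \prod_(i < n) (x - i%:R)]
  (ex_intro _ z hz)).
Qed.
End ZpBinom.

Section Tensor.
Variables (R S : comPzRingType) (f : {rmorphism R -> S}).
Variables (V : lmodType S) (W : lmodType R).

(* V \otimes_{R, f} W as an S-module.  The list [:: (v_1, w_1); ...] stands for
   the sum of the v_i \otimes w_i, and lists are taken modulo the congruence
   generated by the relations of the tensor product. *)
Inductive tens_rel : seq (V * W) -> seq (V * W) -> Prop :=
| tens_refl s : tens_rel s s
| tens_sym s t : tens_rel s t -> tens_rel t s
| tens_trans s t u : tens_rel s t -> tens_rel t u -> tens_rel s u
| tens_cat s s' t t' :
    tens_rel s s' -> tens_rel t t' -> tens_rel (s ++ t) (s' ++ t')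
| tens_comm s t : tens_rel (s ++ t) (t ++ s)
| tens_addl v v' w : tens_rel [:: (v + v', w)] [:: (v, w); (v', w)]
| tens_addr v w w' : tens_rel [:: (v, w + w')] [:: (v, w); (v, w')]
| tens_bal r v w : tens_rel [:: (f r *: v, w)] [:: (v, r *: w)]
| tens_nil w : tens_rel [:: (0, w)] [::].

Definition tens_eq (s t : seq (V * W)) : bool := `[< tens_rel s t >].

Lemma tens_eqP s t : reflect (tens_rel s t) (tens_eq s t).
Proof. exact: asboolP. Qed.

Lemma tens_eq_refl : reflexive tens_eq.
Proof. by move=> s; apply/tens_eqP/tens_refl. Qed.

Lemma tens_eq_sym : symmetric tens_eq.
Proof. by move=> s t; apply/tens_eqP/tens_eqP => /tens_sym. Qed.

Lemma tens_eq_trans : transitive tens_eq.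
Proof.
by move=> t s u /tens_eqP h1 /tens_eqP h2; apply/tens_eqP/(tens_trans h1 h2).
Qed.

Canonical tens_eq_equiv :=
  EquivRel tens_eq tens_eq_refl tens_eq_sym tens_eq_trans.

Definition tens := {eq_quot tens_eq}.

HB.instance Definition _ : EqQuotient _ tens_eq tens := EqQuotient.on tens.
HB.instance Definition _ := Choice.on tens.

Definition seq_scale (a : S) (s : seq (V * W)) : seq (V * W) :=
  [seq (a *: x.1, x.2) | x <- s].

Lemma seq_scaleP a s t :
  tens_rel s t -> tens_rel (seq_scale a s) (seq_scale a t).
Proof.
elim=> {s t}.
- by move=> s; apply: tens_refl.
- by move=> s t _; apply: tens_sym.
- by move=> s t u _ h1 _; apply: tens_trans.
- by move=> s s' t t' _ h1 _ h2; rewrite /seq_scale !map_cat; apply: tens_cat.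
- by move=> s t; rewrite /seq_scale !map_cat; apply: tens_comm.
- by move=> v v' w; rewrite /= scalerDr; apply: tens_addl.
- by move=> v w w' /=; apply: tens_addr.
- by move=> r v w; rewrite /= scalerA mulrC -scalerA; apply: tens_bal.
- by move=> w; rewrite /= scaler0; apply: tens_nil.
Qed.

Definition tens_zero : tens := lift_cst tens [::].
Definition tens_opp := lift_op1 tens (seq_scale (-1)).
Definition tens_add := lift_op2 tens cat.
Definition tens_scale (a : S) := lift_op1 tens (seq_scale a).
Canonical pi_tens_zero := PiConst tens_zero.

Lemma tens_reprP s : tens_rel s (repr (\pi_tens s)).
Proof. by apply/tens_eqP/eqmodP; rewrite /= reprK. Qed.

Lemma pi_tens_opp : {morph \pi : s / seq_scale (-1) s >-> tens_opp s}.
Proof.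
move=> s; unlock tens_opp; apply/eqmodP/tens_eqP/seq_scaleP.
exact: tens_reprP.
Qed.
Canonical pi_tens_opp_morph := PiMorph1 pi_tens_opp.

Lemma pi_tens_add : {morph \pi : s t / s ++ t >-> tens_add s t}.
Proof.
move=> s t; unlock tens_add; apply/eqmodP/tens_eqP.
by apply: tens_cat; apply: tens_reprP.
Qed.
Canonical pi_tens_add_morph := PiMorph2 pi_tens_add.

Lemma pi_tens_scale a : {morph \pi : s / seq_scale a s >-> tens_scale a s}.
Proof.
move=> s; unlock tens_scale; apply/eqmodP/tens_eqP/seq_scaleP.
exact: tens_reprP.
Qed.
Canonical pi_tens_scale_morph a := PiMorph1 (pi_tens_scale a).

Lemma tens_addA : associative tens_add.
Proof.
by elim/quotW=> s; elim/quotW=> t; elim/quotW=> u; rewrite !piE catA.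
Qed.

Lemma tens_addC : commutative tens_add.
Proof.
elim/quotW=> s; elim/quotW=> t; rewrite !piE.
exact/eqmodP/tens_eqP/tens_comm.
Qed.

Lemma tens_add0 : left_id tens_zero tens_add.
Proof. by elim/quotW=> s; rewrite !piE. Qed.

Lemma tens_addN : left_inverse tens_zero tens_opp tens_add.
Proof.
elim/quotW=> s; rewrite !piE; apply/eqmodP/tens_eqP.
elim: s => [|[v w] s IH]; first exact: tens_refl.
have -> : seq_scale (-1) ((v, w) :: s) ++ (v, w) :: s =
    [:: (- v, w)] ++ (seq_scale (-1) s ++ [:: (v, w)]) ++ s.
  by rewrite /= scaleN1r -catA.
have swap : tens_rel ([:: (- v, w)] ++ (seq_scale (-1) s ++ [:: (v, w)]) ++ s)
    ([:: (- v, w)] ++ ([:: (v, w)] ++ seq_scale (-1) s) ++ s).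
  apply: tens_cat; first exact: tens_refl.
  by apply: tens_cat _ (tens_refl _); apply: tens_comm.
apply: tens_trans swap _.
change (tens_rel ([:: (- v, w); (v, w)] ++ (seq_scale (-1) s ++ s)) ([::] ++ [::])).
apply: tens_cat _ IH.
apply: tens_trans (tens_sym (tens_addl _ _ _)) _.
by rewrite addNr; apply: tens_nil.
Qed.

HB.instance Definition _ := GRing.isZmodule.Build tens
  tens_addA tens_addC tens_add0 tens_addN.

Lemma tens_scaleA a b t : tens_scale a (tens_scale b t) = tens_scale (a * b) t.
Proof.
elim/quotW: t => s; rewrite !piE; congr (\pi _); rewrite /seq_scale -map_comp.
by apply: eq_map => x /=; rewrite scalerA.
Qed.

Lemma tens_scale1 : left_id 1 tens_scale.
Proof.
elim/quotW=> s; rewrite !piE; congr (\pi _).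
by rewrite -[RHS]map_id; apply: eq_map => -[v w] /=; rewrite scale1r.
Qed.

Lemma tens_scaleDr : right_distributive tens_scale +%R.
Proof.
move=> a; elim/quotW=> s; elim/quotW=> t; rewrite !piE; congr (\pi _).
by rewrite /seq_scale map_cat.
Qed.

Lemma tens_scaleDl t : {morph tens_scale^~ t : a b / a + b}.
Proof.
elim/quotW: t => s a b; rewrite !piE; apply/eqmodP/tens_eqP.
elim: s => [|[v w] s IH]; first exact: tens_refl.
have -> : seq_scale (a + b) ((v, w) :: s) =
    [:: (a *: v + b *: v, w)] ++ seq_scale (a + b) s.
  by rewrite /= scalerDl.
apply: tens_trans (tens_cat (tens_addl _ _ _) IH) _.
have -> : seq_scale a ((v, w) :: s) ++ seq_scale b ((v, w) :: s) =
    [:: (a *: v, w)] ++ (seq_scale a s ++ [:: (b *: v, w)]) ++ seq_scale b s.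
  by rewrite /= -catA.
change (tens_rel
  ([:: (a *: v, w)] ++ ([:: (b *: v, w)] ++ seq_scale a s) ++ seq_scale b s)
  ([:: (a *: v, w)] ++ (seq_scale a s ++ [:: (b *: v, w)]) ++ seq_scale b s)).
apply: tens_cat; first exact: tens_refl.
by apply: tens_cat _ (tens_refl _); apply: tens_comm.
Qed.

HB.instance Definition _ := GRing.Zmodule_isLmodule.Build S tens
  tens_scaleA tens_scale1 tens_scaleDr tens_scaleDl.

Definition ptens (v : V) (w : W) : tens := \pi_tens [:: (v, w)].

End Tensor.

Section TensorMaps.
Variables (R S : comPzRingType) (f : {rmorphism R -> S}).

(* g \otimes id, for an additive map g with g (f r *: v) = f r *: g v *)
Definition tens_map (V V' : lmodType S) (W : lmodType R) (g : V -> V')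
    (t : tens f V W) : tens f V' W :=
  \pi_(tens f V' W) [seq (g x.1, x.2) | x <- repr t].

Lemma tens_map_pi (V V' : lmodType S) (W : lmodType R) (g : V -> V') s :
    {morph g : x y / x + y} -> (forall r v, g (f r *: v) = f r *: g v) ->
  tens_map g (\pi_(tens f V W) s) = \pi [seq (g x.1, x.2) | x <- s].
Proof.
move=> gD gZ; apply/eqmodP/tens_eqP/tens_sym.
elim: (tens_reprP f s) => {s}.
- by move=> s; apply: tens_refl.
- by move=> s t _; apply: tens_sym.
- by move=> s t u _ h1 _; apply: tens_trans.
- by move=> s s' t t' _ h1 _ h2; rewrite !map_cat; apply: tens_cat.
- by move=> s t; rewrite !map_cat; apply: tens_comm.
- by move=> v v' w; rewrite /= gD; apply: tens_addl.
- by move=> v w w' /=; apply: tens_addr.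
- by move=> r v w; rewrite /= gZ; apply: tens_bal.
- move=> w /=; have -> : g 0 = 0 by apply: (addIr (g 0)); rewrite -gD !add0r.
  exact: tens_nil.
Qed.

(* The linearization f^*W = S \otimes_{R, f} W -> V, b \otimes w |-> b g(w),
   of an f-semilinear map g : W -> V *)
Definition linearization (V : lmodType S) (W : lmodType R) (g : W -> V)
    (t : tens f S^o W) : V :=
  \sum_(x <- repr t) (x.1 : S) *: g x.2.

Lemma linearization_pi (V : lmodType S) (W : lmodType R) (g : W -> V) s :
    linear_for (f \; *:%R) g ->
  linearization g (\pi_(tens f S^o W) s) = \sum_(x <- s) (x.1 : S) *: g x.2.
Proof.
move=> gL.
have gD : {morph g : x y / x + y}.
  by move=> x y; have := gL 1 x y; rewrite /= rmorph1 !scale1r.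
have g0 : g 0 = 0 by apply: (addIr (g 0)); rewrite -gD !add0r.
have gZ r w : g (r *: w) = f r *: g w by have := gL r w 0; rewrite g0 !addr0.
rewrite /linearization; apply/esym; elim: (tens_reprP f s) => {s}.
- by [].
- by move=> s t _ ->.
- by move=> s t u _ -> _ ->.
- by move=> s s' t t' _ h1 _ h2; rewrite !big_cat /= h1 h2.
- by move=> s t; rewrite !big_cat /= addrC.
- by move=> v v' w; rewrite !big_cons !big_nil !addr0 -scalerDl.
- by move=> v w w'; rewrite !big_cons !big_nil !addr0 gD scalerDr.
- by move=> r v w; rewrite !big_seq1 /= gZ scalerA mulrC.
- by move=> w; rewrite big_seq1 big_nil scale0r.
Qed.

End TensorMaps.

Section FinProj.
Variable (R : comPzRingType).

Definition finite_projective (V : lmodType R) : Prop :=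
  exists n (i : {linear V -> 'rV[R]_n}) (r : {linear 'rV[R]_n -> V}), cancel i r.

Definition prime_ideal (P : set R) : Prop :=
  [/\ P 0, forall x y, P x -> P y -> P (x + y), forall a x, P x -> P (a * x),
      ~ P 1 & forall x y, P (x * y) -> P x \/ P y].

(* The images of e_1, ..., e_k in the localization V_P form a basis of V_P over
   R_P.  Up to units of R_P any basis of V_P is of this form. *)
Definition local_basis (V : lmodType R) (P : set R) k (e : 'I_k -> V) : Prop :=
  (forall v, exists s (c : 'I_k -> R), ~ P s /\ s *: v = \sum_i c i *: e i) /\
  (forall c : 'I_k -> R, \sum_i c i *: e i = 0 ->
     exists s, ~ P s /\ forall i, s * c i = 0).

Definition constant_rank (V : lmodType R) (k : nat) : Prop :=
  forall P, prime_ideal P -> exists e : 'I_k -> V, local_basis P e.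

Definition invertible_module (L : lmodType R) : Prop :=
  finite_projective L /\ constant_rank L 1.

End FinProj.

Definition AQp (p : nat) (A : comPzRingType) : comPzRingType :=
  completion p (laurent A).

Section PhiGamma.
Variables (p : nat) (p_pr : prime p) (A : comPzRingType).
Variable sA : {rmorphism Zpadic p_pr -> A}.
Local Notation Zpadic := (Zpadic p_pr).
Local Notation AQp := (AQp p A).

Definition aconst : {rmorphism A -> AQp} := @to_completion p (laurent A) \o @lconst A.

Definition aT : AQp := to_completion p (lmono 1 1).

(* (1 + T)^x = \sum_n binom(x, n) T^n for x in Z_p *)
Definition onePlusT_pow (x : Zpadic) : AQp :=
  to_completion p (lseries (fun n => sA (zp_binom x n))).

(* The preimage of T^n (A/p^a)[[T]] under A'_{Q_p, A} -> (A/p^a)((T)) *)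
Definition aball (a : nat) (n : int) : set AQp :=
  [set x | exists g : laurent A, (forall i, i < n -> g i = 0) /\ compl_eqmod a x g].

Definition ring_nbhs0 (W : set AQp) : Prop :=
  exists a n, (aball a n `<=` W)%classic.

(* The quotient topology for a surjection AQp^k -> V; it does not depend on the
   surjection. *)
Definition mod_nbhs0 (V : lmodType AQp) (W : set V) : Prop :=
  exists k (e : 'I_k -> V),
    (forall v, exists c : 'I_k -> AQp, v = \sum_i c i *: e i) /\
    exists a n, forall c : 'I_k -> AQp,
      (forall i, aball a n (c i)) -> W (\sum_i c i *: e i).

Definition continuous_endo (V : zmodType) (nbhs0 : set V -> Prop) (f : V -> V) :=
  forall x W, nbhs0 W ->
    exists W', nbhs0 W' /\ forall y, W' (y - x) -> W (f y - f x).

(* Here and below, Gamma = Z_p^* consists of the units of Z_p; the values of an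
   action at the other elements of Z_p are irrelevant. *)
Definition continuous_action (V : zmodType) (nbhs0 : set V -> Prop)
    (act : Zpadic -> V -> V) :=
  forall g x W, g \is a GRing.unit -> nbhs0 W ->
    exists k W', nbhs0 W' /\
      forall h y, h \is a GRing.unit -> pdvd p k (h - g) -> W' (y - x) ->
        W (act h y - act g x).

Definition group_action (V : Type) (act : Zpadic -> V -> V) : Prop :=
  (forall x, act 1 x = x) /\
  (forall g h x, g \is a GRing.unit -> h \is a GRing.unit ->
     act (g * h) x = act g (act h x)).

Definition A_linear (f : AQp -> AQp) : Prop :=
  forall a x, f (aconst a * x) = aconst a * f x.

Record phiGamma_ring (phi : {rmorphism AQp -> AQp})
    (gam : Zpadic -> {rmorphism AQp -> AQp}) : Prop := {
  ring_phi_continuous : continuous_endo ring_nbhs0 phi;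
  ring_phi_linear : A_linear phi;
  ring_phiT : phi aT = (1 + aT) ^+ p - 1;
  ring_gam_action : group_action gam;
  ring_gam_continuous : continuous_action ring_nbhs0 gam;
  ring_gam_linear : forall g, g \is a GRing.unit -> A_linear (gam g);
  ring_gamT : forall g, g \is a GRing.unit -> gam g aT = onePlusT_pow g - 1;
  ring_phi_gam : forall g x, g \is a GRing.unit -> phi (gam g x) = gam g (phi x)
}.

Record phiGamma_data := PhiGammaData {
  pg_mod :> lmodType AQp;
  pg_phi : pg_mod -> pg_mod;
  pg_gam : Zpadic -> pg_mod -> pg_mod
}.

Definition phiGamma_iso (M N : phiGamma_data) : Prop :=
  exists h : {linear M -> N},
    [/\ bijective h, forall m, h (pg_phi m) = pg_phi (h m)
      & forall g m, g \is a GRing.unit -> h (pg_gam g m) = pg_gam g (h m)].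

Section Modules.
Variables (phi : {rmorphism AQp -> AQp}) (gam : Zpadic -> {rmorphism AQp -> AQp}).

Record etale_phiGamma_module (M : phiGamma_data) : Prop := {
  pg_projective : finite_projective M;
  pg_phi_semilinear : linear_for (phi \; *:%R) (@pg_phi M);
  pg_etale : bijective (linearization (f := phi) (@pg_phi M));
  pg_gam_action : group_action (@pg_gam M);
  pg_gam_semilinear : forall g, g \is a GRing.unit ->
    linear_for (gam g \; *:%R) (@pg_gam M g);
  pg_gam_continuous : continuous_action (@mod_nbhs0 M) (@pg_gam M);
  pg_phi_gam : forall g (m : M), g \is a GRing.unit ->
    pg_phi (pg_gam g m) = pg_gam g (pg_phi m)
}.

(* A character of Q_p^*, as a function on Q_p whose value at 0 is irrelevant.
   A function with these properties takes values in A^*. *)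
Record continuous_character (delta : Qpadic p_pr -> A) : Prop := {
  char1 : delta 1 = 1;
  charM : forall x y, x != 0 -> y != 0 -> delta (x * y) = delta x * delta y;
  char_continuous : forall a x, x != 0 -> exists n, forall y, y != 0 ->
    (exists z : Zpadic, y - x = FracField.tofrac (p%:R ^+ n * z)) ->
    pdvd p a (delta y - delta x)
}.

(* AQp(delta), with basis v = 1 *)
Definition pg_char (delta : Qpadic p_pr -> A) : phiGamma_data := {|
  pg_mod := AQp^o;
  pg_phi := fun x => phi x * aconst (delta p%:R);
  pg_gam := fun g x => gam g x * aconst (delta (FracField.tofrac g))
|}.

End Modules.

(* D \otimes_A L, with phi and Gamma acting through D *)
Definition pg_tens (D : phiGamma_data) (L : lmodType A) : phiGamma_data := {|
  pg_mod := tens aconst D L;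
  pg_phi := tens_map (@pg_phi D);
  pg_gam := fun g => tens_map (pg_gam g)
|}.

End PhiGamma.

(* Main.v *)
(* Let R = A'_{Q_p,A}.  At a prime P of A above p, the order in T of a functional on M can
   be normalized so that phi multiplies it by p; that this is possible follows from the
   commutation with Gamma.  Expanding generators of M and of its dual along a high power
   of phi then produces generators of order 0 at all P at once.  Their Gram matrix has
   polar coefficients in the radical of p, and lifting the idempotent formed by its
   constant terms to W over A yields generators eps_k of M with constant Gram matrix W.
   Since End M = R, phi acts on all the eps_k through a single u in R, with radical polar
   part and invertible constant term, and Gamma acts through a cocycle.  The key lemma
   (Gamma-invariant classes modulo the image of phi - 1 are constant) removes the polar
   part of u in steps of square zero: u phi(f) = c f with f in R^* and c in A^*.  On the
   rescaled generators f eps_k, Gamma acts through phi-fixed elements of R, that is,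
   through A^*; hence delta, while L is the image of W. *)

Require Import Defs.
From HB Require Import structures.
From mathcomp Require Import all_boot all_order all_algebra.
From mathcomp Require Import generic_quotient.
From mathcomp Require Import boolp classical_sets functions fsbigop.
From mathcomp Require Import zify ring.

Set Implicit Arguments.
Unset Strict Implicit.
Unset Printing Implicit Defensive.

Import Order.TTheory GRing.Theory Num.Theory.

Local Open Scope ring_scope.

(** * Ideals and complete rings *)

(** Nothing finite is assumed about A: the nilpotents of A/p have no common order, and M need not be
    free. Hence a two-level method: a statement is tested at the primes P above p, where A/P is a
    domain and orders in T add up, and is then made global. The normalized functional depends on P,
    but the bound B on orders does not; since phi^N multiplies orders by p^N, an error bounded by B
    disappears for large N, and this yields generators common to all P. Modulo p an element has
    finitely many polar coefficients, so only finitely generated nilpotent ideals occur, and these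
    are exhausted by steps from K to K' with K^2 + pK inside K'. On such a step the equation u
    phi(f) = c f is additive: if u = c(1 + X) with X in K, then f = 1 - z requires X - (phi(z) - z)
    to be constant modulo K'. The map phi - 1 alone leaves over the terms T^-n with n prime to p;
    these are excluded by Gamma, tested mainly on a = 1 + p^k, which moves T^-n only slightly. Until
    the character is built, Gamma enters through natural numbers a prime to p, for which (1+T)^a - 1
    is a polynomial. *)

Section Ideals.
Variable S : comPzRingType.

Record is_ideal (I : set S) : Prop := IsIdeal {
  ideal0 : I 0;
  idealD : forall x y, I x -> I y -> I (x + y);
  ideal_mull : forall a x, I x -> I (a * x)
}.

Variable I : set S.
Hypothesis hI : is_ideal I.

Lemma ideal_mulr a x : I x -> I (x * a).
Proof. by rewrite mulrC; apply: ideal_mull. Qed.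

Lemma idealN x : I x -> I (- x).
Proof. by rewrite -mulN1r; apply: ideal_mull. Qed.

Lemma idealB x y : I x -> I y -> I (x - y).
Proof. by move=> hx hy; apply: idealD => //; apply: idealN. Qed.

Lemma ideal_sum J (r : seq J) (P : pred J) (F : J -> S) :
  (forall i, P i -> I (F i)) -> I (\sum_(i <- r | P i) F i).
Proof. by move=> h; elim/big_ind: _ => //; [apply: ideal0 | apply: idealD]. Qed.

Lemma ideal_sum_seq (J : eqType) (r : seq J) (F : J -> S) :
  (forall i, i \in r -> I (F i)) -> I (\sum_(i <- r) F i).
Proof. by move=> h; rewrite big_seq; apply: ideal_sum. Qed.

Lemma ideal_congr x y : I (x - y) -> I x <-> I y.
Proof.
move=> h; split=> [hx|hy]; first by rewrite -(subKr x y); apply: idealB.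
by rewrite -(subrK y x); apply: idealD.
Qed.

Lemma ideal_trans x y z : I (x - y) -> I (y - z) -> I (x - z).
Proof. by move=> h1 h2; rewrite -(subrK y x) -addrA; apply: (idealD hI). Qed.

Lemma ideal_sym x y : I (x - y) -> I (y - x).
Proof. by rewrite -opprB => /idealN; rewrite opprK. Qed.

Lemma ideal_mulB x x' y y' : I (x - x') -> I (y - y') -> I (x * y - x' * y').
Proof.
move=> hx hy; have -> : x * y - x' * y' = (x - x') * y + x' * (y - y') by ring.
by apply: (idealD hI); [apply: ideal_mulr | apply: (ideal_mull hI)].
Qed.

Lemma ideal_expB x y n : I (x - y) -> I (x ^+ n - y ^+ n).
Proof.
move=> h; elim: n => [|n IH]; first by rewrite subrr; apply: ideal0.
by rewrite !exprS; apply: ideal_mulB.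
Qed.

(** An ideal P maximal among those that contain I and no power of a is prime: for x and y outside P,
    both P + (x) and P + (y) contain a power of a, so P + (xy) does too. *)
Lemma prime_ideal_above (a : S) : (forall k, ~ I (a ^+ k)) ->
  exists P, [/\ prime_ideal P, (I `<=` P)%classic & ~ P a].
Proof.
move=> ha.
pose good (J : set S) := is_ideal J /\ forall k, ~ J (a ^+ k).
(* [Zorn_bigcup] also tests the empty chain, whose union is the empty set; adjoining I makes the
   predicate hold there. *)
pose above (J : set S) := good (I `|` J)%classic.
have [|J [gJ Jmax]] := @Zorn_bigcup S above.
  move=> F FP Ftot.
  have [[J0 FJ0]|F0] := pselect (exists J, F J); last first.
    rewrite /above (_ : bigcup F id = set0) ?setU0; first by split.
    by apply/seteqP; split=> // x [J FJ _]; apply: F0; exists J.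
  split; last first.
    move=> k [|[J FJ Jk]]; first exact: ha.
    by have [_ /(_ k)] := FP _ FJ; apply; right.
  split; first by left; apply: ideal0.
    have key x y J : F J -> (I `|` J)%classic x -> (I `|` J)%classic y ->
        (I `|` bigcup F id)%classic (x + y).
      move=> FJ hx hy; have [hJ _] := FP _ FJ.
      by have [?|?] := idealD hJ hx hy; [left | right; exists J].
    move=> x y [Ix|[J1 F1 h1]] [Iy|[J2 F2 h2]].
    - by left; apply: idealD.
    - by apply: (key _ _ J2 F2); [left | right].
    - by apply: (key _ _ J1 F1); [right | left].
    - have [h|h] := Ftot _ _ F1 F2.
        by apply: (key _ _ J2 F2); right => //; apply: h.
      by apply: (key _ _ J1 F1); right => //; apply: h.
  move=> b x [Ix|[J FJ Jx]]; first by left; apply: ideal_mull.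
  have [hJ _] := FP _ FJ.
  have [|?|?] := ideal_mull hJ b (x := x); first by right.
  - by left.
  - by right; exists J.
set P := (I `|` J)%classic in gJ.
have [hP Pk] := gJ.
have max Q : good Q -> (P `<=` Q)%classic -> (Q `<=` P)%classic.
  move=> gQ PQ x Qx; apply: contrapT => nPx.
  apply: (Jmax Q).
    split; first by move=> y Jy; apply: PQ; right.
    by move/(_ _ Qx) => Jx; apply: nPx; right.
  by rewrite /above setUidr// => y Iy; apply: PQ; left.
have add_elt x : ~ P x -> exists k y z, P z /\ a ^+ k = z + y * x.
  move=> nPx; apply: contrapT => nex.
  pose Q : set S := fun w => exists y z, P z /\ w = z + y * x.
  apply: nPx; apply: (max Q).
  - split; last by move=> k [y [z [Pz e]]]; apply: nex; exists k, y, z.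
    split; first by exists 0, 0; split; [apply: ideal0 | ring].
    + move=> _ _ [y [z [Pz ->]]] [y' [z' [Pz' ->]]].
      by exists (y + y'), (z + z'); split; [apply: idealD | ring].
    + move=> b _ [y [z [Pz ->]]].
      by exists (b * y), (b * z); split; [apply: ideal_mull | ring].
  - by move=> w Pw; exists 0, w; split=> //; ring.
  - by exists 1, 0; split; [apply: ideal0 | ring].
exists P; split.
- split.
  + exact: ideal0.
  + exact: idealD.
  + exact: ideal_mull.
  + by move=> P1; apply: (Pk 0%N).
  + move=> x y Pxy; have [|/add_elt[k [b [z [Pz e]]]]] := pselect (P x); first by left.
    have [|/add_elt[l [c [w [Pw e']]]]] := pselect (P y); first by right.
    case: (Pk (k + l)%N); rewrite exprD e e'.
    have -> : (z + b * x) * (w + c * y) = (w + c * y) * z + b * x * w + b * c * (x * y).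
      by ring.
    by do 2?apply: idealD => //; apply: ideal_mull.
- by move=> x; left.
- by move=> Pa; apply: (Pk 1%N).
Qed.

End Ideals.

Lemma prime_is_ideal (S : comPzRingType) (P : set S) : prime_ideal P -> is_ideal P.
Proof. by case. Qed.

Definition is_unit (S : comPzRingType) (x : S) := exists y, x * y = 1.

Section Units.
Variable S : comPzRingType.
Implicit Types x y : S.

Lemma is_unit1 : is_unit (1 : S).
Proof. by exists 1; rewrite mulr1. Qed.

Lemma is_unitM x y : is_unit x -> is_unit y -> is_unit (x * y).
Proof. by move=> [a ha] [b hb]; exists (a * b); rewrite mulrACA ha hb mulr1. Qed.

Lemma is_unit_factor x y : is_unit (x * y) -> is_unit x.
Proof. by move=> [a ha]; exists (y * a); rewrite mulrA. Qed.

Lemma is_unit_cancel x y z : is_unit x -> x * y = x * z -> y = z.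
Proof. by move=> [a ha] h; rewrite -[y]mul1r -[z]mul1r -ha -!mulrA !(mulrCA _ a) h. Qed.

Lemma is_unit_rmorph (S' : comPzRingType) (f : {rmorphism S -> S'}) x :
  is_unit x -> is_unit (f x).
Proof. by move=> [a ha]; exists (f a); rewrite -rmorphM ha rmorph1. Qed.

Lemma unit_notin_prime (P : set S) x : prime_ideal P -> is_unit x -> ~ P x.
Proof.
case=> _ _ PM P1 _ [y hy] Px; apply: P1; rewrite -hy mulrC; exact: PM.
Qed.

(** This is how local statements become global below: I is an annihilator, or an ideal of values,
    that no prime contains. *)
Lemma ideal_whole (I : set S) : is_ideal I ->
  (forall P, prime_ideal P -> (I `<=` P)%classic -> False) -> I 1.
Proof.
move=> hI h; apply: contrapT => nI1.
have [|P [pP IP _]] := @prime_ideal_above _ I hI 1; last exact: (h P).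
by move=> k; rewrite expr1n.
Qed.

End Units.

Section Complete.
Variables (p : nat) (S : comPzRingType).
Implicit Types x y : S.

Lemma pdvd_ideal n : is_ideal (pdvd p n : set S).
Proof. by split; [apply: pdvd0 | apply: pdvdD | apply: pdvdMl]. Qed.

Lemma pdvd_exp n : pdvd p n (p%:R ^+ n : S).
Proof. by exists 1; rewrite mulr1. Qed.

Lemma pdvdM m n (x y : S) : pdvd p m x -> pdvd p n y -> pdvd p (m + n) (x * y).
Proof. by move=> [a ->] [b ->]; exists (a * b); rewrite exprD; ring. Qed.

Lemma pdvdX n k (x : S) : pdvd p n x -> pdvd p (n * k) (x ^+ k).
Proof.
move=> h; elim: k => [|k IH]; first by rewrite muln0; exists (x ^+ 0); rewrite mul1r.
by rewrite mulnS exprS; apply: pdvdM.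
Qed.

Definition pseparated := forall x : S, (forall n, pdvd p n x) -> x = 0.
Definition plimits := forall X : nat -> S, (forall n, pdvd p n (X n.+1 - X n)) ->
  exists x, forall n, pdvd p n (x - X n).

Definition pradical (x : S) := exists k, pdvd p 1 (x ^+ k).

Lemma pdvd_pradical x : pdvd p 1 x -> pradical x.
Proof. by exists 1%N. Qed.

Lemma pradical_ideal : is_ideal pradical.
Proof.
split.
- by exists 1%N; rewrite expr1; apply: pdvd0.
- move=> x y [k hk] [l hl]; exists (k + l)%N; rewrite exprDn.
  apply: (ideal_sum (pdvd_ideal 1)) => i _; rewrite -mulr_natl /=.
  apply: pdvdMl; case: (leqP l i) => hi.
    by apply: pdvdMl; rewrite -(subnK hi) exprD; apply: pdvdMl.
  apply: pdvdMr; rewrite (_ : k + l - i = k + (l - i))%N; last by lia.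
  by rewrite exprD; apply: pdvdMr.
- by move=> a x [k hk]; exists k; rewrite exprMn; apply: pdvdMl.
Qed.

Lemma pradicalP x : ~ pradical x ->
  exists P, [/\ prime_ideal P, P p%:R & ~ P x].
Proof.
move=> h; have [|P [pP IP Px]] := @prime_ideal_above _ _ (pdvd_ideal 1) x.
  by move=> k hk; apply: h; exists k.
by exists P; split=> //; apply: IP; rewrite /= -[X in pdvd _ _ X]expr1; apply: pdvd_exp.
Qed.

Hypotheses (sepS : pseparated) (limS : plimits).

Lemma unit_1Bp x : pdvd p 1 x -> is_unit (1 - x).
Proof.
move=> hx; have [n|y hy] := limS (X := fun n => \sum_(i < n) x ^+ i).
  by rewrite big_ord_recr /= addrAC subrr add0r -{1}(mul1n n); apply: pdvdX.
exists y; apply/eqP; rewrite -subr_eq0; apply/eqP/sepS => n.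
have geo : (1 - x) * \sum_(i < n) x ^+ i = 1 - x ^+ n.
  elim: n => [|n IH]; first by rewrite big_ord0 mulr0 expr0 subrr.
  by rewrite big_ord_recr /= mulrDr IH exprS; ring.
have -> : (1 - x) * y - 1 = (1 - x) * (y - \sum_(i < n) x ^+ i) - x ^+ n.
  by rewrite mulrBr geo; ring.
by apply: pdvdB; [apply: pdvdMl | rewrite -{1}(mul1n n); apply: pdvdX].
Qed.

Lemma unit_modp x y : pdvd p 1 (x * y - 1) -> is_unit x.
Proof.
move=> h; apply: (@is_unit_factor _ x y).
by rewrite -(subKr 1 (x * y)); apply: unit_1Bp; rewrite -opprB; apply: pdvdN.
Qed.

(** The finite geometric series in -x inverts 1 + x modulo p, and units lift from S/p. *)
Lemma unit_1Dpradical x : pradical x -> is_unit (1 + x).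
Proof.
move=> [k hk]; apply: (unit_modp (y := \sum_(i < k) (- x) ^+ i)).
have -> : (1 + x) * \sum_(i < k) (- x) ^+ i = 1 - (- x) ^+ k.
  elim: k {hk} => [|k IH]; first by rewrite big_ord0 mulr0 expr0 subrr.
  by rewrite big_ord_recr /= mulrDr IH exprS; ring.
rewrite addrAC subrr add0r; apply: pdvdN; rewrite exprNn.
exact: pdvdMl.
Qed.

Lemma unit_mod_pradical x y : pradical (x * y - 1) -> is_unit x.
Proof.
move=> h; apply: (@is_unit_factor _ x y).
by rewrite (_ : x * y = 1 + (x * y - 1)); [apply: unit_1Dpradical | ring].
Qed.

Lemma unit_primesP x :
  (forall P, prime_ideal P -> P p%:R -> ~ P x) -> is_unit x.
Proof.
move=> h; pose I : set S := fun z => exists a, pdvd p 1 (z - a * x).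
have hI : is_ideal I.
  split; first by exists 0; rewrite mul0r subr0; apply: pdvd0.
  - move=> y z [a ha] [b hb]; exists (a + b).
    by rewrite mulrDl opprD addrACA; apply: pdvdD.
  - by move=> b y [a ha]; exists (b * a); rewrite -mulrA -mulrBr; apply: pdvdMl.
have [|a ha] := ideal_whole hI; last first.
  by apply: (unit_modp (y := a)); rewrite mulrC -opprB; apply: pdvdN.
move=> P pP IP; apply: (h P) => //; apply: IP.
  by exists 0; rewrite mul0r subr0 -[X in pdvd _ _ X]expr1; apply: pdvd_exp.
by exists 1; rewrite mul1r subrr; apply: pdvd0.
Qed.

End Complete.

Section CompletionComplete.
Variables (p : nat) (S : comPzRingType).
Local Open Scope quotient_scope.
Local Notation C := (completion p S).
Implicit Types x y : C.

Lemma compl_eqP0 x y : (forall n, pdvd p n (repr x n - repr y n)) -> x = y.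
Proof. by move=> h; rewrite -(reprK x) -(reprK y); apply/compl_eqP. Qed.

Lemma repr_sub n x y : pdvd p n (repr (x - y) n - (repr x n - repr y n)).
Proof.
rewrite -opprB; apply: pdvdN.
have -> : x - y = \pi_C (repr x - repr y) by rewrite pi_cseq_is_zmod_morphism !reprK.
exact: (cseq_reprP (repr x - repr y)).
Qed.

Lemma repr_pM n k x : pdvd p n (repr (p%:R ^+ k * x) n - p%:R ^+ k * repr x n).
Proof.
rewrite -opprB; apply: pdvdN.
pose c := CoherentSeq (const_coherent p (p%:R ^+ k : S)).
have -> : p%:R ^+ k * x = \pi_C (c * repr x).
  rewrite (pi_cseq_is_monoid_morphism p S).2 reprK; congr (_ * _).
  by rewrite -[RHS]/(to_completion p _) rmorphXn rmorph_nat.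
exact: (cseq_reprP (c * repr x)).
Qed.

Lemma repr_coherent x n : pdvd p n (repr x n.+1 - repr x n).
Proof. by have /coherentP := cseqP (repr x). Qed.

(** The kernel of the projection to S/p^n is p^n times the completion. As S may have p-torsion, the
    terms of a coherent sequence cannot be divided independently; a coherent quotient is obtained by
    summing quotients of the successive differences. *)
Lemma repr_pdvd n x : pdvd p n x <-> pdvd p n (repr x n).
Proof.
split=> [[y ->]|h].
  rewrite -(subrK (p%:R ^+ n * repr y n) (repr (p%:R ^+ n * y) n)).
  by apply: pdvdD; [apply: repr_pM | exists (repr y n)].
have [t ht] := choice (fun m => repr_coherent x m).
have [w hw] := h.
pose z k := w + \sum_(i < k) p%:R ^+ i * t (n + i)%N.
have zC : z \in @coherent p S.
  apply/coherentP => k; rewrite /z big_ord_recr /=; exists (t (n + k)%N); ring.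
have zE k : p%:R ^+ n * z k = repr x (n + k)%N.
  elim: k => [|k IH]; first by rewrite /z big_ord0 addr0 addn0 hw.
  rewrite /z big_ord_recr /= addrA mulrDr IH addnS.
  by rewrite mulrA -exprD -ht addrC subrK.
exists (\pi_C (CoherentSeq zC)); apply: compl_eqP0 => k.
rewrite -(subrK (p%:R ^+ n * repr (\pi_C (CoherentSeq zC)) k) (repr x k)) -addrA.
apply: pdvdD; last by rewrite -opprB; apply/pdvdN/repr_pM.
rewrite -(subrK (p%:R ^+ n * z k) (repr x k)) -addrA -mulrBr.
apply: pdvdD; last by apply: pdvdMl; apply: (cseq_reprP (CoherentSeq zC)).
by rewrite zE -opprB; apply: pdvdN; apply: coherent_le; rewrite leq_addl.
Qed.

Lemma completion_separated : pseparated p C.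
Proof.
move=> x h; apply: compl_eqP0 => n.
have /repr_pdvd hn := h n.
rewrite -{1}[x]subr0; have := repr_sub n x 0.
have [hsub] : pdvd p n (repr (0 : C) n) /\ True.
  by split=> //; apply/repr_pdvd; apply: pdvd0.
by move=> _ _; rewrite subr0; apply: pdvdB.
Qed.

Lemma completion_limits : plimits p C.
Proof.
move=> X hX; pose y n := repr (X n) n.
have yC : y \in @coherent p S.
  apply/coherentP => n; rewrite /y.
  have /repr_pdvd h := hX n.
  rewrite -(subrK (repr (X n.+1) n) (repr (X n.+1) n.+1)) -addrA.
  apply: pdvdD; first exact: repr_coherent.
  rewrite -(subKr (repr (X n.+1 - X n) n) (_ - _)).
  by apply: pdvdB => //; apply: repr_sub.
exists (\pi_C (CoherentSeq yC)) => n; apply/repr_pdvd.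
rewrite -(subrK (repr (\pi_C (CoherentSeq yC)) n - repr (X n) n) (repr (_ - X n) n)).
apply: pdvdD; first exact: repr_sub.
by rewrite -opprB; apply/pdvdN/(cseq_reprP (CoherentSeq yC)).
Qed.

End CompletionComplete.

Lemma padically_complete_separated p (S : comPzRingType) :
  padically_complete p S -> pseparated p S.
Proof.
move=> [g gK _] x h; apply: (can_inj gK); rewrite rmorph0.
by apply: completion_separated => n; have [y ->] := h n;
  exists (to_completion p y); rewrite rmorphM rmorphXn rmorph_nat.
Qed.

Lemma padically_complete_limits p (S : comPzRingType) :
  padically_complete p S -> plimits p S.
Proof.
move=> [g gK Kg] X hX; have [n|x hx] := @completion_limits p S (@to_completion p S \o X).
  have [y /= hy] := hX n; exists (to_completion p y).
  by rewrite -rmorphB hy rmorphM rmorphXn rmorph_nat.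
exists (g x) => n; have [y hy] := hx n; exists (g y).
apply: (can_inj gK); rewrite rmorphB rmorphM rmorphXn rmorph_nat.
by rewrite /= !Kg -hy.
Qed.

(** * Coefficients *)

Section LaurentDivisibility.
Variables (p : nat) (A : comPzRingType).
Implicit Types g h : laurent A.

Lemma lcoefB g h i : (g - h) i = g i - h i. Proof. by []. Qed.

Lemma lconst_mul (a : A) g i : (lconst a * g) i = a * g i.
Proof. by rewrite [LHS](lmono_mul a 0 g i) subr0. Qed.

Lemma laurent_pdvd n g : pdvd p n g <-> forall i, pdvd p n (g i).
Proof.
have pE h i : (p%:R ^+ n * h) i = p%:R ^+ n * h i.
  by rewrite -[p%:R in LHS](rmorph_nat (@lconst A)) -rmorphXn lconst_mul.
split=> [[h ->] i|hg]; first by exists (h i); rewrite pE.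
have [c hc] := choice hg.
have [N hN] : exists N : int, forall i, i < N -> g i = 0.
  by apply/bounded_belowP; apply: lcoefP.
have cP : (fun i => if i < N then 0 else c i) \in @bounded_below A.
  by apply/bounded_belowP; exists N => i ->.
exists (Laurent cP); apply: laurentP => i; rewrite pE /=.
by case: ifP => [/hN ->|_]; rewrite ?mulr0.
Qed.

Lemma lmonoM (a b : A) (m n : int) : lmono a m * lmono b n = lmono (a * b) (m + n).
Proof.
apply: laurentP => i; rewrite [LHS](lmono_mul a m) /=.
case: (i =P m + n) => [->|h]; first by rewrite addrC addKr eqxx.
by case: eqP => h'; rewrite ?mulr0//; case: h; rewrite -h' addrC subrK.
Qed.

End LaurentDivisibility.

Section Coefficients.
Variables (p : nat) (A : comPzRingType).
Hypothesis A_complete : padically_complete p A.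
Local Notation R := (AQp p A).
Implicit Types (x y : R) (g h : laurent A) (I : set A).

Definition of_laurent : {rmorphism laurent A -> R} := @to_completion p (laurent A).

(** Elements of R are two-sided series whose coefficients tend p-adically to 0 as i goes to minus
    infinity. The coefficient is the limit in A of those of the representatives, which exists and is
    unique because A is complete. *)
Definition tcoef x (i : int) : A :=
  xget 0 (fun a : A => forall n, pdvd p n (a - repr x n i)).

Let sepA := padically_complete_separated A_complete.
Let limA := padically_complete_limits A_complete.

Lemma R_separated : pseparated p R. Proof. exact: completion_separated. Qed.
Lemma R_limits : plimits p R. Proof. exact: completion_limits. Qed.

Lemma tcoefP x i n : pdvd p n (tcoef x i - repr x n i).
Proof.
have hex : exists a, forall n, pdvd p n (a - repr x n i).
  by apply: limA => k; have /laurent_pdvd/(_ i) := repr_coherent x k.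
by have := xgetPex 0 hex; apply.
Qed.

Lemma tcoef_unique x i a : (forall n, pdvd p n (a - repr x n i)) -> tcoef x i = a.
Proof.
move=> h; apply/eqP; rewrite -subr_eq0; apply/eqP/sepA => n.
by apply: (ideal_trans (pdvd_ideal _ _ n) (tcoefP x i n)); rewrite -opprB; apply: pdvdN.
Qed.

Lemma tcoefB x y i : tcoef (x - y) i = tcoef x i - tcoef y i.
Proof.
have trans := ideal_trans (pdvd_ideal _ _ _).
apply: tcoef_unique => n; have /laurent_pdvd/(_ i) h := repr_sub n x y.
apply: (trans _ _ n _ (repr x n i - repr y n i)); last by rewrite -opprB; apply: pdvdN.
have -> : tcoef x i - tcoef y i - (repr x n i - repr y n i) =
  (tcoef x i - repr x n i) - (tcoef y i - repr y n i) by ring.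
by apply: pdvdB; apply: tcoefP.
Qed.

Lemma tcoef0 i : tcoef 0 i = 0.
Proof. by rewrite -[0]subr0 tcoefB subrr. Qed.

Lemma tcoefN x i : tcoef (- x) i = - tcoef x i.
Proof. by rewrite -[- x]sub0r tcoefB tcoef0 sub0r. Qed.

Lemma tcoefD x y i : tcoef (x + y) i = tcoef x i + tcoef y i.
Proof. by rewrite -[y in LHS]opprK tcoefB tcoefN opprK. Qed.

Lemma tcoef_sum J (r : seq J) (P : pred J) (F : J -> R) i :
  tcoef (\sum_(j <- r | P j) F j) i = \sum_(j <- r | P j) tcoef (F j) i.
Proof.
by rewrite (big_morph (fun x => tcoef x i) (fun x y => tcoefD x y i) (tcoef0 i)).
Qed.

Lemma tcoef_of_laurent g i : tcoef (of_laurent g) i = g i.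
Proof.
apply: tcoef_unique => n.
by have /laurent_pdvd := cseq_reprP (CoherentSeq (const_coherent p g)) n; apply.
Qed.

Lemma tcoef_pdvd n x : pdvd p n x <-> forall i, pdvd p n (tcoef x i).
Proof.
rewrite repr_pdvd laurent_pdvd.
split=> h i.
  by rewrite -(subrK (repr x n i) (tcoef x i)); apply: pdvdD => //; apply: tcoefP.
by rewrite -(subKr (tcoef x i) (repr x n i)); apply: pdvdB => //; apply: tcoefP.
Qed.

Lemma tcoef_ext x y : (forall i, tcoef x i = tcoef y i) -> x = y.
Proof.
move=> h; apply/eqP; rewrite -subr_eq0; apply/eqP/R_separated => n.
by apply/tcoef_pdvd => i; rewrite tcoefB h subrr; apply: pdvd0.
Qed.

Lemma of_laurent_repr n x : pdvd p n (x - of_laurent (repr x n)).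
Proof.
by apply/tcoef_pdvd => i; rewrite tcoefB tcoef_of_laurent; apply: tcoefP.
Qed.

Lemma tcoef_modp n x y i : pdvd p n (x - y) -> pdvd p n (tcoef x i - tcoef y i).
Proof. by move=> /tcoef_pdvd/(_ i); rewrite tcoefB. Qed.

Definition tpow (i : int) : R := of_laurent (lmono 1 i).

Lemma tpowD i j : tpow (i + j) = tpow i * tpow j.
Proof. by rewrite -rmorphM lmonoM mulr1. Qed.

Lemma tpow0 : tpow 0 = 1.
Proof. by rewrite -(rmorph1 of_laurent). Qed.

Lemma tpowNK i : tpow i * tpow (- i) = 1.
Proof. by rewrite -tpowD subrr tpow0. Qed.

Lemma tpow_nat (n : nat) : tpow n%:Z = tpow 1 ^+ n.
Proof. by elim: n => [|n IH]; rewrite ?tpow0// exprS -IH -tpowD -intS. Qed.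

Lemma tcoef_aconstM a x i : tcoef (aconst p A a * x) i = a * tcoef x i.
Proof.
apply/eqP; rewrite -subr_eq0; apply/eqP/sepA => n.
have h : pdvd p n (aconst p A a * x - of_laurent (lconst a * repr x n)).
  by rewrite rmorphM -mulrBr; apply/pdvdMl/of_laurent_repr.
apply: (ideal_trans (pdvd_ideal _ _ n) (tcoef_modp i h)).
rewrite tcoef_of_laurent lconst_mul -mulrBr; apply: pdvdMl.
by rewrite -opprB; apply/pdvdN/tcoefP.
Qed.

Lemma tcoef_tpowM j x i : tcoef (tpow j * x) i = tcoef x (i - j).
Proof.
apply/eqP; rewrite -subr_eq0; apply/eqP/sepA => n.
have h : pdvd p n (tpow j * x - of_laurent (lmono 1 j * repr x n)).
  by rewrite rmorphM -mulrBr; apply/pdvdMl/of_laurent_repr.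
apply: (ideal_trans (pdvd_ideal _ _ n) (tcoef_modp i h)).
rewrite tcoef_of_laurent [X in X - _](lmono_mul 1 j) mul1r.
by rewrite -opprB; apply/pdvdN/tcoefP.
Qed.

Lemma tcoef_tpow j i : tcoef (tpow j) i = (i == j)%:R.
Proof. by rewrite tcoef_of_laurent /=; case: eqP. Qed.

Lemma tcoef_aconst a i : tcoef (aconst p A a) i = if i == 0 then a else 0.
Proof. by rewrite [LHS](tcoef_of_laurent (lconst a)). Qed.

Lemma tcoef1 i : tcoef 1 i = (i == 0)%:R.
Proof. by rewrite -tpow0 tcoef_tpow. Qed.

Lemma tcoef_natM (k : nat) x i : tcoef (k%:R * x) i = k%:R * tcoef x i.
Proof. by rewrite -[k%:R](rmorph_nat (aconst p A)) tcoef_aconstM. Qed.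

Lemma aconst_inj : injective (aconst p A).
Proof. by move=> a b h; have := tcoef_aconst a 0; rewrite h tcoef_aconst eqxx. Qed.

Lemma tcoef_bounded x b : exists N : int, forall i, i < N -> pdvd p b (tcoef x i).
Proof.
have /bounded_belowP[N hN] := lcoefP (repr x b).
by exists N => i /hN h; have := tcoefP x i b; rewrite h subr0.
Qed.

Lemma tcoef_truncate x b (N : int) : (forall i, i < N -> pdvd p b (tcoef x i)) ->
  exists g, [/\ forall i, i < N -> g i = 0, forall i, N <= i -> g i = tcoef x i
    & pdvd p b (x - of_laurent g)].
Proof.
move=> h; have cP : (fun i => if i < N then 0 else tcoef x i) \in @bounded_below A.
  by apply/bounded_belowP; exists N => i ->.
exists (Laurent cP); split=> [i /= ->//|i /= Ni|]; first by rewrite ltNge Ni.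
apply/tcoef_pdvd => i; rewrite tcoefB tcoef_of_laurent /=.
by case: ifP => [/h|_]; rewrite ?subr0 ?subrr //; apply: pdvd0.
Qed.

(** The convolution defining a coefficient of x y is an infinite p-adic sum. Modulo an ideal that
    contains p^b both factors may be truncated to Laurent series, and the sum becomes finite. *)
Lemma tcoefM_lead I b x y (v w : int) : is_ideal I -> (pdvd p b `<=` I)%classic ->
    (forall i j, i + j = v + w -> i != v -> I (tcoef x i * tcoef y j)) ->
  I (tcoef (x * y) (v + w) - tcoef x v * tcoef y w).
Proof.
move=> hI pI h.
have [N hN] := tcoef_bounded x b; have [M hM] := tcoef_bounded y b.
have [g [g0 gE hg]] := @tcoef_truncate x b (Num.min N v) (fun i hi => hN i ltac:(lia)).
have [k [k0 kE hk]] := @tcoef_truncate y b (Num.min M w) (fun i hi => hM i ltac:(lia)).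
have hxy : pdvd p b (x * y - of_laurent (g * k)) by rewrite rmorphM; apply: pdvd_mulB.
apply: (ideal_trans hI (pI _ (tcoef_modp (v + w) hxy))).
rewrite tcoef_of_laurent.
pose N' := Num.min N v; pose M' := Num.min M w.
rewrite [(g * k) _](@lconvE _ g k N' M' _ (absz (v + w - N' - M')%R).+1 g0 k0); last by lia.
have hv : (absz (v - N')%R < (absz (v + w - N' - M')%R).+1)%N by rewrite /N' /M'; lia.
rewrite (bigD1 (Ordinal hv)) //=.
have -> : N' + `|v - N'|%N%:Z = v by rewrite /N'; lia.
have -> : v + w - N' - `|v - N'|%N%:Z = w by rewrite /N'; lia.
rewrite gE ?kE /N' ?/M'; [|lia..].
rewrite addrAC subrr add0r; apply: (ideal_sum hI) => i /eqP ni.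
have gx j : g j = 0 \/ g j = tcoef x j.
  by case: (ltP j N') => hj; [left; apply: g0 | right; apply: gE].
have ky j : k j = 0 \/ k j = tcoef y j.
  by case: (ltP j M') => hj; [left; apply: k0 | right; apply: kE].
case: (gx (Num.min N v + i%:Z)) => ->; first by rewrite mul0r; apply: ideal0.
case: (ky (v + w - Num.min N v - i%:Z)) => ->; first by rewrite mulr0; apply: ideal0.
apply: h; first by lia.
by apply/eqP => e; apply: ni; apply/val_inj => /=; rewrite /N'; lia.
Qed.

Lemma tcoefM_ideal I b x y (n : int) : is_ideal I -> (pdvd p b `<=` I)%classic ->
    (forall i j, i + j = n -> I (tcoef x i * tcoef y j)) -> I (tcoef (x * y) n).
Proof.
move=> hI pI h; have e : n = 0 + n by rewrite add0r.
rewrite -(subrK (tcoef x 0 * tcoef y n) (tcoef _ n)); apply: (idealD hI).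
  rewrite {1}e; apply: (tcoefM_lead hI pI) => i j; rewrite add0r => ij _.
  exact: h.
by apply: h; rewrite add0r.
Qed.

Definition coefs_in I x := forall i, I (tcoef x i).

Section CoefsIn.
Variables (I : set A) (hI : is_ideal I).

Lemma coefs_inD x y : coefs_in I x -> coefs_in I y -> coefs_in I (x + y).
Proof. by move=> hx hy i; rewrite tcoefD; apply: (idealD hI). Qed.

Lemma coefs_inN x : coefs_in I x -> coefs_in I (- x).
Proof. by move=> hx i; rewrite tcoefN; apply: (idealN hI). Qed.

Lemma coefs_inB x y : coefs_in I x -> coefs_in I y -> coefs_in I (x - y).
Proof. by move=> hx hy; apply: coefs_inD => //; apply: coefs_inN. Qed.

Lemma coefs_in_aconst a : I a -> coefs_in I (aconst p A a).
Proof. by move=> ha i; rewrite tcoef_aconst; case: eqP => // _; apply: ideal0. Qed.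

Variables (b : nat) (pI : (pdvd p b `<=` I)%classic).

Lemma coefs_in_ideal : is_ideal (coefs_in I : set R).
Proof.
split; first by move=> i; rewrite tcoef0; apply: ideal0.
- exact: coefs_inD.
- move=> a x hx n; apply: (tcoefM_ideal hI pI) => i j _.
  by apply: (ideal_mull hI).
Qed.

Lemma coefs_in_prod (J J' : set A) x y :
    (forall a a', J a -> J' a' -> I (a * a')) ->
  coefs_in J x -> coefs_in J' y -> coefs_in I (x * y).
Proof.
by move=> h hx hy n; apply: (tcoefM_ideal hI pI) => i j _; apply: h.
Qed.

End CoefsIn.

Lemma coefs_in_pdvdE b x : coefs_in (pdvd p b) x <-> pdvd p b x.
Proof. by rewrite tcoef_pdvd. Qed.

End Coefficients.

(** * Units and continuous endomorphisms *)

(** The n-th iterate of the operator already has the right values below n, so the diagonal of the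
    iterates is a fixed point. *)
Lemma strong_recursion (T : Type) (t0 : T) (F : nat -> (nat -> T) -> T) :
    (forall n g h, (forall i, (i < n)%N -> g i = h i) -> F n g = F n h) ->
  exists f, forall n, f n = F n f.
Proof.
move=> hF; pose s n := iter n (fun g k => F k g) (fun=> t0).
have sE n m k : (k < n)%N -> (n <= m)%N -> s n k = s m k.
  elim: n m k => // n IH [//|m] k; rewrite ltnS => kn; rewrite ltnS => nm.
  by apply: hF => i ik; apply: IH => //; apply: leq_trans kn.
exists (fun k => s k.+1 k) => k; rewrite [LHS]/=.
by apply: hF => i ik; apply/esym/sE.
Qed.

Section PowerSeries.
Variables (p : nat) (A : comPzRingType).
Hypothesis A_complete : padically_complete p A.
Local Notation R := (AQp p A).
Local Notation tpow := (tpow p A).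
Implicit Types (x y : R) (c d : nat -> A).

Definition pseries c : R := of_laurent p A (lseries c).

Lemma tcoef_pseries c (n : nat) : tcoef (pseries c) n%:Z = c n.
Proof. by rewrite tcoef_of_laurent. Qed.

Lemma tcoef_pseries_neg c i : i < 0 -> tcoef (pseries c) i = 0.
Proof. by rewrite tcoef_of_laurent //; case: i. Qed.

Lemma lseriesM c d (n : nat) :
  (lseries c * lseries d) n%:Z = \sum_(k < n.+1) c k * d (n - k)%N.
Proof.
rewrite [LHS](@lconvE _ _ _ 0 0 _ n.+1) //; try by case.
  2: by rewrite !subr0; lia.
apply: eq_bigr => k _; rewrite add0r subr0.
by have -> : n%:Z - k%:Z = (n - k)%N%:Z by have := ltn_ord k; lia.
Qed.

Lemma tcoef_pseriesM c d (n : nat) :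
  tcoef (pseries c * pseries d) n%:Z = \sum_(k < n.+1) c k * d (n - k)%N.
Proof. by rewrite -rmorphM tcoef_of_laurent// lseriesM. Qed.

Lemma tcoef_pseriesM_neg c d i : i < 0 -> tcoef (pseries c * pseries d) i = 0.
Proof.
move=> hi; rewrite -rmorphM tcoef_of_laurent //.
by rewrite [LHS](@lconv_small _ _ _ 0 0) //; case.
Qed.

Lemma pseries_unit c : is_unit (c 0%N) -> exists d, pseries c * pseries d = 1.
Proof.
move=> [c' hc]; have [|d hd] := @strong_recursion A 0 (fun n g =>
  c' * ((n == 0%N)%:R - \sum_(k < n) c k.+1 * g (n - k.+1)%N)).
  move=> n g h gh; congr (_ * (_ - _)); apply: eq_bigr => k _.
  by rewrite gh//; have := ltn_ord k; lia.
exists d; apply: (tcoef_ext A_complete) => i; rewrite tcoef1//.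
case: (ltP i 0) => hi; first by rewrite tcoef_pseriesM_neg//; case: eqP hi => // ->.
case: i hi => // n _; rewrite tcoef_pseriesM big_ord_recl subn0.
rewrite {1}hd mulrA hc mul1r addrAC -addrA.
have -> : (n%:Z == 0) = (n == 0%N) by [].
by rewrite (eq_bigr (fun k : 'I_n => c k.+1 * d (n - k.+1)%N)) ?subrr ?addr0 // addrC subrK.
Qed.

Lemma pradical_aconst (a : A) : pradical p a -> pradical p (aconst p A a).
Proof.
move=> [k [y hy]]; exists k, (aconst p A y).
by rewrite -rmorphXn hy rmorphM rmorphXn rmorph_nat.
Qed.

(** An infinite sum of nilpotents need not be nilpotent; here only finitely many coefficients
    survive modulo p. *)
Lemma pradical_coefs x : (forall i, i < 0 -> pradical p (tcoef x i)) ->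
  (forall i, 0 <= i -> tcoef x i = 0) -> pradical p x.
Proof.
move=> xneg xpos; have [N hN] := tcoef_bounded A_complete x 1.
have [|g [g0 gE hg]] := @tcoef_truncate p A A_complete x 1 (Num.min N 0).
  by move=> i hi; apply: hN; lia.
have hI := pradical_ideal p R.
rewrite -(subrK (of_laurent p A g) x); apply: (idealD hI).
  exact: pdvd_pradical.
pose N' := Num.min N 0.
have -> : of_laurent p A g =
    \sum_(k < absz N') aconst p A (g (N' + k%:Z)) * tpow (N' + k%:Z).
  apply: (tcoef_ext A_complete) => i; rewrite tcoef_of_laurent// tcoef_sum//.
  have tE k : tcoef (aconst p A (g (N' + k%:Z)) * tpow (N' + k%:Z)) i =
      if i == N' + k%:Z then g i else 0.
    by rewrite tcoef_aconstM// tcoef_tpow//; case: eqP => [<-|]; rewrite ?mulr1 ?mulr0.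
  under eq_bigr => k _ do rewrite tE.
  case: (ltP i N') => hi; first by rewrite g0// big1 // => k _; case: eqP => // h; rewrite h g0.
  case: (leP 0 i) => hi0.
    have Ni : N' <= i by rewrite /N'; lia.
    by rewrite gE// xpos// big1 // => k _; case: eqP.
  have hk : (absz (i - N')%R < absz N')%N by lia.
  rewrite (bigD1 (Ordinal hk)) //= ifT; last by apply/eqP; lia.
  rewrite big1 ?addr0 // => k /eqP nk; case: eqP => // e; case: nk; apply/val_inj => /=; lia.
apply: (ideal_sum hI) => k _; apply: (ideal_mulr hI); apply: pradical_aconst.
case: (ltP (N' + k%:Z) N') => h; first by lia.
by rewrite gE//; apply: xneg; have := ltn_ord k; lia.
Qed.

Let sepA := padically_complete_separated A_complete.
Let limA := padically_complete_limits A_complete.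

(** Modulo p, x is a power series with invertible constant term plus a nilpotent polar part. *)
Lemma unit_of_coefs x : (forall i, i < 0 -> pradical p (tcoef x i)) ->
  is_unit (tcoef x 0) -> is_unit x.
Proof.
move=> xneg x0; pose c n := tcoef x (Posz n).
have [d hd] : exists d, pseries c * pseries d = 1 by apply: pseries_unit.
apply: (@unit_mod_pradical p R _ _ _ (pseries d)).
- exact: R_separated.
- exact: R_limits.
have -> : x * pseries d - 1 = (x - pseries c) * pseries d by rewrite mulrBl hd.
apply: (ideal_mulr (pradical_ideal p R)); apply: pradical_coefs => i hi.
  by rewrite tcoefB// tcoef_pseries_neg// subr0; apply: xneg.
by rewrite tcoefB//; case: i hi => // n _; rewrite tcoef_pseries subrr.
Qed.

Lemma aballP a n x : aball a n x <-> forall i, i < n -> pdvd p a (tcoef x i).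
Proof.
split=> [[g [g0 hg]] i hi|h].
  have := tcoefP A_complete x i a; have /laurent_pdvd/(_ i) := hg.
  by rewrite lcoefB g0// subr0 => h1 h2; rewrite -(subrK (repr x a i) (tcoef x i));
    apply: pdvdD.
have [g [g0 _ hg]] := tcoef_truncate A_complete h.
exists g; split=> //; apply/laurent_pdvd => i.
rewrite lcoefB -(subrK (tcoef x i) (repr x a i)) -addrA.
apply: pdvdD; first by rewrite -opprB; apply/pdvdN/tcoefP.
by have := tcoef_modp A_complete i hg; rewrite tcoef_of_laurent.
Qed.

Section ContinuousEndo.
Variable sg : {rmorphism R -> R}.
Hypotheses (sg_cont : continuous_endo (@ring_nbhs0 p A) sg) (sg_lin : A_linear sg).

Lemma endo_pdvd n x : pdvd p n x -> pdvd p n (sg x).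
Proof. by move=> [y ->]; exists (sg y); rewrite rmorphM rmorphXn rmorph_nat. Qed.

Lemma endo_aconst a : sg (aconst p A a) = aconst p A a.
Proof. by rewrite -[aconst p A a]mulr1 sg_lin rmorph1. Qed.

Lemma endo_tail b (k0 : int) : exists hi : int, forall x,
  (forall i, i < hi -> pdvd p b (tcoef x i)) ->
  forall i, i < k0 -> pdvd p b (tcoef (sg x) i).
Proof.
have [|W [[a [n aW]] hW]] := sg_cont 0 (W := aball b k0); first by exists b, k0.
exists n => x hx.
(* Continuity provides a ball of some level a unrelated to b. The truncation g lies in the ball
   whatever a is, and x - g is divisible by p^b, which [sg] preserves. *)
have [g [g0 _ hg]] := tcoef_truncate A_complete hx.
have /aballP h : aball b k0 (sg (of_laurent p A g)).
  rewrite -[sg _]subr0 -[in X in _ - X](rmorph0 sg); apply: hW; apply: aW.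
  rewrite subr0; apply/aballP => i hi.
  by rewrite tcoef_of_laurent// g0//; apply: pdvd0.
move=> i hi; rewrite -(subrK (tcoef (sg (of_laurent p A g)) i) (tcoef _ _)).
apply: pdvdD; last exact: h.
by apply: tcoef_modp => //; rewrite -rmorphB; apply: endo_pdvd.
Qed.

(** By continuity and linearity [sg x] is the sum of the x_i [sg] (T^i). Modulo I, which contains
    p^b, finitely many i contribute to the coefficient k, and the last hypothesis discards those
    outside the window from lo to lo + K. *)
Lemma endo_coef (I : set A) b x (k lo : int) (K : nat) : is_ideal I ->
    (pdvd p b `<=` I)%classic ->
    (forall i, ~~ ((lo <= i) && (i < lo + K%:Z)) -> I (tcoef x i * tcoef (sg (tpow i)) k)) ->
  I (tcoef (sg x) k - \sum_(j < K) tcoef x (lo + j%:Z) * tcoef (sg (tpow (lo + j%:Z))) k).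
Proof.
move=> hI pI hout.
have [N0 hN0] := tcoef_bounded A_complete x b.
have [hi0 htail] := endo_tail b (k + 1).
(* The window is enlarged to [N, hi): below N the coefficients of x vanish modulo p^b, and from hi
   on the images start beyond T^k. *)
pose N := Num.min N0 lo; pose hi := Num.max hi0 (lo + K%:Z).
pose d := absz (lo - N)%R; pose e := absz (hi - (lo + K%:Z))%R.
pose F (i : int) := tcoef x i * tcoef (sg (tpow i)) k.
pose y := \sum_(0 <= j < d + K + e) aconst p A (tcoef x (N + j%:Z)) * tpow (N + j%:Z).
have yk : tcoef (sg y) k = \sum_(0 <= j < d + K + e) F (N + j%:Z).
  rewrite rmorph_sum tcoef_sum//; apply: eq_bigr => j _ /=.
  by rewrite sg_lin tcoef_aconstM.
have yi i : i < hi -> pdvd p b (tcoef (x - y) i).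
  move=> ihi; rewrite tcoefB// tcoef_sum//.
  have tE j : tcoef (aconst p A (tcoef x (N + j%:Z)) * tpow (N + j%:Z)) i =
      if i == N + j%:Z then tcoef x i else 0.
    by rewrite tcoef_aconstM// tcoef_tpow//; case: eqP => [<-|]; rewrite ?mulr1 ?mulr0.
  under eq_bigr => j _ do rewrite tE.
  case: (ltP i N) => iN.
    rewrite big1 => [|j _]; first by rewrite subr0; apply: hN0; lia.
    by case: eqP => //; lia.
  rewrite big_mkord; have hj : (absz (i - N)%R < d + K + e)%N by rewrite /d /e /hi; lia.
  rewrite (bigD1 (Ordinal hj)) //= ifT; last by apply/eqP; lia.
  rewrite big1 => [|j /eqP nj]; first by rewrite addr0 subrr; apply: pdvd0.
  by case: eqP => // e'; case: nj; apply/val_inj => /=; lia.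
have hk : I (tcoef (sg x) k - tcoef (sg y) k).
  apply: pI; rewrite -tcoefB// -rmorphB; apply: htail; last by lia.
  by move=> i ih; apply: yi; rewrite /hi; lia.
apply: (ideal_trans hI hk); rewrite yk.
rewrite (big_cat_nat _ (n := d)) //=; last by rewrite -addnA leq_addr.
rewrite (big_cat_nat _ (m := d) (n := d + K)) //=; [|exact: leq_addr..].
have -> : \sum_(d <= j < d + K) F (N + j%:Z) = \sum_(j < K) F (lo + j%:Z).
  rewrite -{1}[d]add0n [(d + K)%N]addnC big_addn addnK big_mkord.
  by apply: eq_bigr => j _; congr F; rewrite /d; lia.
rewrite addrCA -/(F _) [X in I X](_ : _ = \sum_(0 <= j < d) F (N + j%:Z) +
   \sum_(d + K <= j < d + K + e) F (N + j%:Z)); last by rewrite [LHS]addrAC subrr add0r.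
apply: (idealD hI); apply: (ideal_sum_seq hI) => j; rewrite mem_index_iota => hj.
  by apply: hout; rewrite /d in hj *; lia.
by apply: hout; rewrite /d in hj *; lia.
Qed.

Lemma endo_coefs_in (I : set A) b x : is_ideal I -> (pdvd p b `<=` I)%classic ->
  coefs_in I x -> coefs_in I (sg x).
Proof.
move=> hI pI hx k; have := @endo_coef I b x k 0 0%N hI pI.
rewrite big_ord0 => h; rewrite -[tcoef _ _]subr0; apply: h => i _.
exact: (ideal_mulr hI).
Qed.

End ContinuousEndo.
End PowerSeries.

(** * Arithmetic of exponents modulo p - 1 *)

Lemma exp_all_one p n : prime p ->
  (forall a, coprime a p -> a ^ n = 1 %[mod p]) -> (p.-1 %| n)%N.
Proof.
move=> p_pr h; have p1 := prime_gt1 p_pr.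
rewrite /dvdn; apply/negPn/negP; set r := (n %% p.-1)%N => r0.
have rp : (r < p.-1)%N by rewrite ltn_mod; lia.
have hF (x : 'F_p) : x != 0 -> x ^+ r = 1.
  move=> x0; have xp : coprime x p.
    rewrite coprime_sym prime_coprime//; apply: contra x0 => px.
    by rewrite -(natr_Zp x) -(Fp_nat_mod p_pr) (eqP px).
  have one m : (x ^ m = 1 %[mod p])%N -> x ^+ m = 1.
    move=> e; rewrite -{1}(natr_Zp x) -natrX -(Fp_nat_mod p_pr) e.
    by rewrite (Fp_nat_mod p_pr).
  have e1 := one _ (h _ xp).
  have e2 : x ^+ p.-1 = 1.
    apply: (mulfI x0); rewrite -exprS mulr1 prednK ?prime_gt0//.
    have e : ((x ^ p)%N%:R : 'F_p) = x%:R.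
      by rewrite -(Fp_nat_mod p_pr) fermat_little// (Fp_nat_mod p_pr).
    by rewrite natrX natr_Zp in e.
  by rewrite (divn_eq n p.-1) exprD mulnC exprM e2 expr1n mul1r in e1.
(* All p - 1 nonzero classes are roots of X^r - 1, which is too many for 0 < r < p - 1. *)
have := @max_unity_roots 'F_p r [seq x <- enum 'F_p | x != 0].
rewrite lt0n r0 filter_uniq ?enum_uniq// => /(_ isT) hmax.
have : (#|[pred x : 'F_p | x != 0%R]| <= r)%N.
  rewrite cardE -[X in size X]filter_predT -filter_predI.
  apply: leq_trans (hmax _ isT); first by rewrite -enumT.
  by apply/allP => x; rewrite mem_filter => /andP[x0 _]; apply/unity_rootP/hF.
rewrite leqNgt => /negP; apply; have := cardC1 (0 : 'F_p).
by rewrite card_Fp// => ->.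
Qed.

(** If p divides N + 1, then N + 1 = p + p(p-1)l. Here l = 0 and l = 1 give p - 1 and p^2 - 1, and l
    >= 2 gives N >= p^2 + p, except for p = 2 and l = 2, where N = 5. Each case is excluded by a
    different lemma in the proof of [polar_vanish]. *)
Lemma exponent_cases p N : prime p -> (0 < N)%N -> ~~ (p %| N)%N -> (p.-1 %| N)%N ->
  [\/ ~~ (p %| N.+1)%N /\ (p <= N.+1)%N, N = p.-1 \/ N = (p ^ 2).-1,
      (p %| N.+1)%N /\ (p ^ 2 + p <= N)%N | p = 2 /\ N = 5].
Proof.
move=> p_pr N0 pN /dvdnP[m Nm]; have p1 := prime_gt1 p_pr.
have pNS : (p <= N.+1)%N.
  by move: N0; rewrite Nm; case: m {Nm} => // m _; rewrite mulSn; lia.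
have [pN1|h] := boolP (p %| N.+1)%N; last by constructor 1.
have /dvdnP[k Nk] := pN1.
have [l kl] : exists l, (k = 1 + p.-1 * l)%N.
  have k0 : (0 < k)%N by case: k Nk => //; rewrite mul0n.
  have : (p.-1 %| k.-1)%N.
    rewrite -(dvdn_addl k.-1 (dvdn_mulr k (dvdnn p.-1))).
    suff -> : (k.-1 + p.-1 * k = N)%N by rewrite Nm dvdn_mull.
    case: k k0 Nk => // k _ Nk; case: p p1 Nk {pNS p_pr pN pN1 Nm} => //= q _; nia.
  by move=> /dvdnP[l hl]; exists l; rewrite mulnC -hl; lia.
have NE : (N.+1 = p + p * p.-1 * l)%N by rewrite Nk kl; nia.
case: l {kl} NE => [|[|l]] NE.
- by constructor 2; left; lia.
- by constructor 2; right; rewrite -mulnn; nia.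
case: (leqP p 2) => p2; last first.
  constructor 3; split=> //.
  rewrite -mulnn; have e : (p * p.-1 + p = p * p)%N by rewrite -mulnSr prednK// ltnW.
  have l1 : (p * p.-1 * 2 <= p * p.-1 * l.+2)%N by rewrite leq_mul2l orbT.
  have l2 : (3 * p <= p * p)%N by rewrite leq_mul2r p2 orbT.
  by move: (p * p.-1 * _)%N NE l1 => z NE l1; lia.
have {p2} p2 : p = 2 by lia.
rewrite p2 in NE pN1 *; case: l NE => [|l] NE; first by constructor 4; lia.
by constructor 3; split=> //; lia.
Qed.

(** * From nilpotent ideals to p by square-zero steps *)

Section NilpotentChain.
Variables (p : nat) (A : comPzRingType).

(** The ideal generated by p and s; the recursion lets [nilpotent_chain] remove one generator at a
    time. *)
Fixpoint padic_gen (s : seq A) : set A :=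
  if s is g :: s' then fun a => exists r, padic_gen s' (a - r * g) else pdvd p 1.

Lemma padic_gen_ideal s : is_ideal (padic_gen s).
Proof.
elim: s => [|g s IH]; first exact: pdvd_ideal.
split.
- by exists 0; rewrite mul0r subr0; apply: ideal0.
- move=> a b [r hr] [t ht]; exists (r + t).
  by have := idealD IH hr ht; congr padic_gen; ring.
- move=> a b [r hr]; exists (a * r).
  by have := ideal_mull IH a hr; congr padic_gen; ring.
Qed.

Lemma padic_gen_tail g s a : padic_gen s a -> padic_gen (g :: s) a.
Proof. by exists 0; rewrite mul0r subr0. Qed.

Lemma padic_gen_p s a : pdvd p 1 a -> padic_gen s a.
Proof. by move=> h; elim: s => // g s IH; apply: padic_gen_tail. Qed.

Lemma padic_gen_mem s a : a \in s -> padic_gen s a.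
Proof.
elim: s => // g s IH; rewrite in_cons => /predU1P[->|/IH]; last exact: padic_gen_tail.
by exists 1; rewrite mul1r subrr; apply: (ideal0 (padic_gen_ideal s)).
Qed.

Lemma padic_gen_radical s : (forall g, g \in s -> pradical p g) ->
  (padic_gen s `<=` @pradical p A)%classic.
Proof.
have hI := pradical_ideal p A.
elim: s => [_ a|g s IH hs a [r]]; first exact: pdvd_pradical.
have hs' h : h \in s -> pradical p h by move=> hh; apply: hs; rewrite in_cons hh orbT.
move=> /(IH hs') h.
rewrite -(subrK (r * g) a); apply: (idealD hI h); apply: (ideal_mull hI).
by apply: hs; rewrite mem_head.
Qed.

(** Both the nilpotent steps modulo p and the p-adic steps of [power_step] have this form. Products
    and p-multiples vanish in K/K', so the multiplicative group 1 + K is additive modulo K';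
    [step_radical] makes its elements invertible. *)
Record square_step (K K' : set A) : Prop := SquareStep {
  step_ideal : is_ideal K;
  step_ideal' : is_ideal K';
  step_sub : (K' `<=` K)%classic;
  step_sq : forall a a', K a -> K a' -> K' (a * a');
  step_p : forall a, K a -> K' (p%:R * a);
  step_radical : (K `<=` @pradical p A)%classic
}.

(* Since (h) + I has square in (h^2) + I, a chain of square steps replaces each
   generator by high powers of it. *)
Lemma nilpotent_chain (Q : set A -> Prop) :
    (forall K K', square_step K K' -> (pdvd p 1 `<=` K')%classic -> Q K -> Q K') ->
  forall s, (forall g, g \in s -> pradical p g) -> Q (padic_gen s) -> Q (pdvd p 1).
Proof.
move=> step; elim=> [_ //|g s IH] hs.
have hs' h : h \in s -> pradical p h by move=> hh; apply: hs; rewrite in_cons hh orbT.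
have hI := padic_gen_ideal.
have pgen t : (pdvd p 1 `<=` padic_gen t)%classic by move=> a; apply: padic_gen_p.
have pR : pdvd p 1 (p%:R : A) by rewrite -[X in pdvd _ _ X]expr1; apply: pdvd_exp.
suff chain t h : pradical p h -> padic_gen s (h ^+ (2 ^ t)) ->
    Q (padic_gen (h :: s)) -> Q (padic_gen s).
  move=> hQ; apply: IH => //; have [k hk] := hs _ (mem_head g s).
  apply: (chain k g) => //; first by exists k.
  apply: pgen; rewrite -(subnK (ltnW (ltn_expl k (isT : 1 < 2)%N))) exprD.
  exact: pdvdMl.
have square g' K' : pradical p g' -> is_ideal K' -> (padic_gen s `<=` K')%classic ->
    (K' `<=` padic_gen (g' :: s))%classic -> K' (g' * g') ->
    square_step (padic_gen (g' :: s)) K'.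
  move=> hr hK' sK' K'g' hh; split=> //.
  - move=> a a' [r hra] [r' hra'].
    have -> : a * a' = r * r' * (g' * g') + ((a - r * g') * a' + (r * g') * (a' - r' * g')).
      by ring.
    apply: (idealD hK'); first exact: (ideal_mull hK').
    by apply: (idealD hK'); [apply: (ideal_mulr hK') | apply: (ideal_mull hK')];
      apply: sK'.
  - by move=> a _; apply: (ideal_mulr hK'); apply/sK'/pgen.
  - apply: padic_gen_radical => g''; rewrite in_cons => /predU1P[->//|]; exact: hs'.
elim: t h => [|t IHt] h hr ht hQ.
  apply: (step _ _ (square h _ hr (hI s) _ _ _) (pgen s) hQ) => //.
    by move=> a; apply: padic_gen_tail.
  by apply: (ideal_mull (hI s)); rewrite expr1 in ht.
apply: (IHt (h * h)).
- exact: (ideal_mull (pradical_ideal p A)).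
- by rewrite -expr2 -exprM -expnS.
apply: (step _ _ (square h _ hr (hI _) _ _ _) (pgen _) hQ).
- by move=> a; apply: padic_gen_tail.
- by move=> a [r hr']; exists (r * h); rewrite -mulrA.
- by exists 1; rewrite mul1r subrr; apply: (ideal0 (hI s)).
Qed.

Lemma power_step n : square_step (pdvd p n.+1) (pdvd p n.+2).
Proof.
split; try exact: pdvd_ideal.
- by move=> a; apply: pdvd_le.
- by move=> a a' h h'; apply: (pdvd_le (m := n.+2) _ (pdvdM h h')); lia.
- by move=> a h; rewrite -add1n -[p%:R]expr1; apply: pdvdM (pdvd_exp _ _ 1) h.
- by move=> a h; apply: pdvd_pradical; apply: pdvd_le h.
Qed.

End NilpotentChain.

(** * Frobenius and the action of Gamma on coefficients *)

Section Padic.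
Variables (p : nat) (p_pr : prime p).
Local Notation Z_p := (Zpadic p_pr).

Lemma nat_inverse_mod (a : nat) : coprime a p -> exists b, (b * a = 1 %[mod p])%N.
Proof.
move=> ap; have a0 : (0 < a)%N.
  by rewrite lt0n; apply: contraTneq ap => ->; rewrite /coprime gcd0n; case: p p_pr => [|[]].
have [u v e _] := egcdnP p a0; exists u.
by rewrite e (eqP ap) modnMDl.
Qed.

Lemma natr_unit_complete (S : comPzRingType) (a : nat) : pseparated p S -> plimits p S ->
  coprime a p -> is_unit (a%:R : S).
Proof.
move=> sepS limS /nat_inverse_mod[b hb]; apply: (@unit_modp p S sepS limS _ b%:R).
rewrite -natrM mulnC; have := divn_eq (b * a) p.
rewrite hb modn_small ?prime_gt1// => ->.
by rewrite natrD addrK natrM; exists (b * a %/ p)%:R; rewrite expr1 mulrC.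
Qed.

Lemma Zpadic_unitP (x : Z_p) : is_unit x <-> x \is a GRing.unit.
Proof.
split=> [[y xy]|ux]; first by apply/unitrPr; exists y.
by exists x^-1; rewrite divrr.
Qed.

Lemma Zpadic_nat_unit (a : nat) : coprime a p -> (a%:R : Z_p) \is a GRing.unit.
Proof.
move=> ap; apply/Zpadic_unitP; apply: natr_unit_complete => //.
  exact: completion_separated.
exact: completion_limits.
Qed.

Lemma zp_binom_nat (a n : nat) : zp_binom (a%:R : Z_p) n = 'C(a, n)%:R.
Proof.
have n0 : (n`!%:R : Z_p) != 0 by apply: zp_natr_neq0; apply: fact_gt0.
apply: (mulfI n0); rewrite zp_binomE -natrM mulnC bin_ffact.
elim: n {n0} => [|n IH]; first by rewrite big_ord0 ffactn0.
rewrite big_ord_recr /= IH ffactnSr natrM.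
case: (leqP n a) => na; first by rewrite natrB.
by rewrite ffact_small// !mul0r.
Qed.

End Padic.

Section Frobenius.
Variables (p : nat) (p_pr : prime p) (S : comPzRingType).
Implicit Types x y : S.

Lemma pdvd_binomial x y : pdvd p 1 ((x + y) ^+ p - (x ^+ p + y ^+ p)).
Proof.
have p0 := prime_gt0 p_pr.
rewrite exprDn (bigD1 ord0) //= (bigD1 ord_max) //=; last by rewrite -lt0n.
rewrite bin0 binn subn0 subnn !expr0 mulr1 mul1r !mulr1n.
set s := \sum_(i < _ | _) _; set u := x ^+ p; set v := y ^+ p.
have -> : u + (v + s) - (u + v) = s by ring.
apply: (ideal_sum (pdvd_ideal _ _ 1)) => i /andP[i0 ip]; rewrite -mulr_natl.
apply: (ideal_mulr (pdvd_ideal _ _ 1)).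
have /dvdnP[k ->] : (p %| 'C(p, i))%N.
  apply: prime_dvd_bin => //; rewrite lt0n i0 /= ltn_neqAle -ltnS ltn_ord andbT.
  exact: ip.
by rewrite natrM mulrC; exists k%:R; rewrite expr1.
Qed.

Lemma pdvd_frob_1D x k : pdvd p 1 ((1 + x) ^+ (p ^ k) - (1 + x ^+ (p ^ k))).
Proof.
elim: k => [|k IH]; first by rewrite expn0 !expr1 subrr; apply: pdvd0.
rewrite expnSr !exprM.
apply: (ideal_trans (pdvd_ideal _ _ 1) (ideal_expB (pdvd_ideal _ _ 1) p IH)).
by have := pdvd_binomial 1 (x ^+ (p ^ k)); rewrite expr1n.
Qed.

End Frobenius.

Section Action.
Variables (p : nat) (p_pr : prime p) (A : comPzRingType).
Variable sA : {rmorphism Zpadic p_pr -> A}.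
Hypothesis A_complete : padically_complete p A.
Local Notation R := (AQp p A).
Local Notation tpow := (tpow p A).
Variables (phi : {rmorphism R -> R}) (gam : Zpadic p_pr -> {rmorphism R -> R}).
Hypothesis phi_gam : phiGamma_ring sA phi gam.
Implicit Types x y : R.
Local Notation pI := (pdvd_ideal _ _ _).
Local Notation ptrans := (ideal_trans (pdvd_ideal _ _ _)).

Let sepA := padically_complete_separated A_complete.
Let limA := padically_complete_limits A_complete.

Let phi_cont := ring_phi_continuous phi_gam.
Let phi_lin := ring_phi_linear phi_gam.

Lemma phi_tpow_nat (n : nat) : pdvd p 1 (phi (tpow n%:Z) - tpow (p * n)%N%:Z).
Proof.
rewrite (tpow_nat p A n) (tpow_nat p A (p * n)%N) rmorphXn exprM; apply: (ideal_expB pI).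
rewrite (ring_phiT phi_gam) -[aT p A]/(tpow 1).
have := pdvd_binomial p_pr 1 (tpow 1); rewrite expr1n; congr (pdvd _ _ _).
ring.
Qed.

Lemma phi_tpow i : pdvd p 1 (phi (tpow i) - tpow (p%:Z * i)).
Proof.
case: (leP 0 i) => hi; first by case: i hi => // n _; apply: phi_tpow_nat.
have [n ->] : exists n : nat, i = - n%:Z by exists (absz i); lia.
have h := phi_tpow_nat n.
have e1 : phi (tpow n%:Z) * phi (tpow (- n%:Z)) = 1 by rewrite -rmorphM tpowNK rmorph1.
have -> : phi (tpow (- n%:Z)) - tpow (p%:Z * - n%:Z) =
    - (phi (tpow (- n%:Z)) * tpow (- (p * n)%N%:Z)) * (phi (tpow n%:Z) - tpow (p * n)%N%:Z).
  have e2 := tpowNK p A (p * n)%N%:Z.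
  have -> : p%:Z * - n%:Z = - (p * n)%N%:Z by rewrite mulrN -PoszM.
  transitivity (phi (tpow (- n%:Z)) * (tpow (p * n)%N%:Z * tpow (- (p * n)%N%:Z)) -
     phi (tpow n%:Z) * phi (tpow (- n%:Z)) * tpow (- (p * n)%N%:Z)).
    by rewrite e1 e2 mulr1 mul1r.
  ring.
exact: pdvdMl.
Qed.

Lemma tcoef_phi_tpow i k : pdvd p 1 (tcoef (phi (tpow i)) k - (k == p%:Z * i)%:R).
Proof. by have := tcoef_modp A_complete k (phi_tpow i); rewrite tcoef_tpow. Qed.

Section PhiCoef.
Variables (I : set A) (b : nat) (hI : is_ideal I) (bI : (pdvd p b `<=` I)%classic).
Variables (x : R) (px : forall i, I (p%:R * tcoef x i)).

Let pxM i a a' : pdvd p 1 (a - a') -> I (tcoef x i * a - tcoef x i * a').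
Proof.
move=> [w hw]; rewrite -mulrBr hw expr1 mulrA (mulrC _ p%:R).
exact: (ideal_mulr hI).
Qed.

(** Since phi(T^j) is T^(pj) modulo p, and p kills the coefficients of x modulo I, phi acts on x
    modulo I as T -> T^p, although I need not contain p. *)
Lemma tcoef_phi i : I (tcoef (phi x) (p%:Z * i) - tcoef x i).
Proof.
have := @endo_coef p A A_complete phi phi_cont phi_lin I b x (p%:Z * i) i 1%N hI bI.
rewrite big_ord1 /= addr0 => h.
have h1 := pxM i (tcoef_phi_tpow i (p%:Z * i)).
rewrite eqxx mulr1 in h1; apply: (ideal_trans hI _ h1); apply: h => j hj.
have := pxM j (tcoef_phi_tpow j (p%:Z * i)).
rewrite (_ : (_ == _) = false) ?mulr0 ?subr0 //.
by apply/eqP => /mulfI e; have := prime_gt0 p_pr; move: e => /(_ _); lia.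
Qed.

Lemma tcoef_phi_ndvd k : ~~ (p%:Z %| k)%Z -> I (tcoef (phi x) k).
Proof.
move=> pk.
have := @endo_coef p A A_complete phi phi_cont phi_lin I b x k 0 0%N hI bI.
rewrite big_ord0 => h; rewrite -[tcoef _ _]subr0; apply: h => j _.
have := pxM j (tcoef_phi_tpow j k).
rewrite (_ : (_ == _) = false) ?mulr0 ?subr0 //.
by apply/eqP => e; move/negP: pk; apply; rewrite e dvdz_mulr.
Qed.

End PhiCoef.

Section Gamma.
Variables (a : nat) (ap : coprime a p).

Let ua := Zpadic_nat_unit p_pr ap.
Definition gamn : {rmorphism R -> R} := gam a%:R.
Local Notation sg := gamn.

Lemma gamn_continuous : continuous_endo (@ring_nbhs0 p A) sg.
Proof.
move=> x W hW; have [k [W' [hW' h]]] := ring_gam_continuous phi_gam x ua hW.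
exists W'; split=> // y hy; apply: h => //.
by rewrite subrr; apply: pdvd0.
Qed.

Lemma gamn_linear : A_linear sg.
Proof. exact: ring_gam_linear phi_gam _ ua. Qed.

Lemma gamn_phi x : phi (sg x) = sg (phi x).
Proof. exact: ring_phi_gam phi_gam _ _ ua. Qed.

(** The coefficients of ((1+T)^a - 1)/T; the constant term is a, a unit of A. *)
Definition gser n : A := 'C(a, n.+1)%:R.

Lemma gamnT : sg (tpow 1) = (1 + tpow 1) ^+ a - 1.
Proof.
rewrite [LHS](ring_gamT phi_gam ua); congr (_ - _).
apply: (tcoef_ext A_complete) => i; rewrite tcoef_of_laurent//.
rewrite exprDn tcoef_sum//.
under eq_bigr => k _ do rewrite expr1n mul1r -tpow_nat -mulr_natl tcoef_natM// tcoef_tpow//.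
case: i => n /=; last by rewrite big1// => k _; rewrite mulr0.
rewrite zp_binom_nat rmorph_nat.
case: (ltnP n a.+1) => hn; last first.
  rewrite bin_small// big1// => k _.
  by have := ltn_ord k; case: eqP => [|_]; rewrite ?mulr0 //; lia.
rewrite (bigD1 (Ordinal hn)) //= eqxx mulr1 big1 ?addr0// => k /eqP nk.
by case: eqP => [[e]|]; rewrite ?mulr0//; case: nk; apply/val_inj.
Qed.

Lemma gamnT_series : sg (tpow 1) = tpow 1 * pseries p gser.
Proof.
rewrite gamnT; apply: (tcoef_ext A_complete) => i.
rewrite tcoefB// tcoef_tpowM// exprDn tcoef_sum// tcoef1//.
under eq_bigr => k _ do rewrite expr1n mul1r -tpow_nat -mulr_natl tcoef_natM// tcoef_tpow//.
rewrite big_ord_recl /= bin0 mul1r addrAC subrr add0r.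
case: (ltP i 1) => hi.
  rewrite tcoef_pseries_neg; [|done|by lia].
  rewrite big1// => k _; case: eqP => [|_]; rewrite ?mulr0 // /bump /=; lia.
have [n ->] : exists n : nat, i = n.+1%:Z by exists (absz (i - 1)%R); lia.
have -> : n.+1%:Z - 1 = n%:Z by lia.
rewrite tcoef_pseries//.
case: (ltnP n a) => hn; last first.
  rewrite /gser bin_small// big1// => k _.
  by have := ltn_ord k; case: eqP => [|_]; rewrite ?mulr0 //= /bump; lia.
rewrite (bigD1 (Ordinal hn)) //= eqxx mulr1 big1 ?addr0// => k /eqP nk.
by case: eqP => [[e]|]; rewrite ?mulr0//; case: nk; apply/val_inj.
Qed.

End Gamma.
(** * The key lemma: Gamma-invariants modulo the image of phi - 1 *)

Local Notation pseries := (@pseries p A).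

Definition is_pseries x := forall i, i < 0 -> tcoef x i = 0.

Lemma is_pseriesP x : is_pseries x <-> exists c, x = pseries c.
Proof.
split=> [h|[c ->]]; last by move=> i; apply: tcoef_pseries_neg.
exists (fun n => tcoef x n%:Z); apply: (tcoef_ext A_complete) => -[n|n].
  by rewrite tcoef_pseries.
by rewrite tcoef_pseries_neg// h.
Qed.

Lemma is_pseriesD x y : is_pseries x -> is_pseries y -> is_pseries (x + y).
Proof. by move=> hx hy i hi; rewrite tcoefD// hx// hy// addr0. Qed.

Lemma is_pseriesN x : is_pseries x -> is_pseries (- x).
Proof. by move=> hx i hi; rewrite tcoefN// hx// oppr0. Qed.

Lemma is_pseriesM x y : is_pseries x -> is_pseries y -> is_pseries (x * y).
Proof.
move=> /is_pseriesP[c ->] /is_pseriesP[d ->] i hi.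
exact: tcoef_pseriesM_neg.
Qed.

Lemma is_pseries_tpow (n : nat) : is_pseries (tpow n%:Z).
Proof. by move=> i hi; rewrite tcoef_tpow//; case: eqP hi => // ->. Qed.

Lemma is_pseries1 : is_pseries 1.
Proof. by rewrite -tpow0; apply: is_pseries_tpow. Qed.

Lemma is_pseries_nat (n : nat) : is_pseries n%:R.
Proof.
elim: n => [|n IH]; first by move=> i _; rewrite tcoef0.
by rewrite mulrS; apply: is_pseriesD => //; apply: is_pseries1.
Qed.

Lemma pseriesX c n : exists d, pseries c ^+ n = pseries d /\ d 0%N = c 0%N ^+ n.
Proof.
elim: n => [|n [d [e e0]]].
  exists (fun n => (n == 0%N)%:R); split=> //.
  apply: (tcoef_ext A_complete) => -[n|n]; last by rewrite tcoef_pseries_neg// tcoef1.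
  by rewrite tcoef_pseries// tcoef1.
exists (fun n => \sum_(k < n.+1) c k * d (n - k)%N); split; last first.
  by rewrite big_ord1 exprS e0.
rewrite exprS e; apply: (tcoef_ext A_complete) => -[m|m].
  by rewrite tcoef_pseriesM// tcoef_pseries.
by rewrite tcoef_pseriesM_neg// tcoef_pseries_neg.
Qed.

Lemma tpow_opp (n : nat) : tpow (- n%:Z) = tpow (-1) ^+ n.
Proof. by elim: n => [|n IH]; rewrite ?tpow0// exprS -IH -tpowD; congr tpow; lia. Qed.

Section OneGamma.
Variables (a : nat) (ap : coprime a p).
Local Notation sg := (gamn a).

Lemma gam_tpow_nat (n : nat) :
  exists c, sg (tpow n%:Z) = tpow n%:Z * pseries c /\ c 0%N = a%:R ^+ n.
Proof.
have [c [e c0]] := pseriesX (gser a) n; exists c; split; last by rewrite c0 /gser bin1.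
by rewrite (tpow_nat p A n) rmorphXn (gamnT_series ap) exprMn e.
Qed.

Lemma gam_tpow_inv : exists d, sg (tpow (-1)) = tpow (-1) * pseries d /\
  pseries (gser a) * pseries d = 1.
Proof.
have [|d hd] := @pseries_unit p A A_complete (gser a).
  by rewrite /gser bin1; apply: (natr_unit_complete p_pr sepA limA).
exists d; split=> //.
have e : sg (tpow 1) * sg (tpow (-1)) = 1 by rewrite -rmorphM tpowNK rmorph1.
rewrite (gamnT_series ap) in e.
transitivity ((tpow 1 * pseries (gser a) * sg (tpow (-1))) * (tpow (-1) * pseries d)).
  have t1 := tpowNK p A 1.
  transitivity ((tpow 1 * tpow (-1)) * (pseries (gser a) * pseries d) * sg (tpow (-1))).
    by rewrite t1 hd !mul1r.
  move: (tpow 1) (tpow (-1)) (pseries _) (pseries d) (sg _) => u v w z s.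
  by ring.
by rewrite e mul1r.
Qed.

Lemma gam_tpow_opp (n : nat) : exists c,
  sg (tpow (- n%:Z)) = tpow (- n%:Z) * pseries c /\ a%:R ^+ n * c 0%N = 1.
Proof.
have [d [e1 e2]] := gam_tpow_inv; have [c [e c0]] := pseriesX d n.
exists c; split; first by rewrite tpow_opp rmorphXn e1 exprMn e.
rewrite c0 -exprMn (_ : a%:R * d 0%N = 1) ?expr1n//.
have := tcoef_pseriesM A_complete (gser a) d 0.
by rewrite e2 big_ord1 tcoef1// /gser bin1.
Qed.

Lemma gam_tpow i : exists c, sg (tpow i) = tpow i * pseries c.
Proof.
case: (leP 0 i) => hi.
  by case: i hi => // n _; have [c [e _]] := gam_tpow_nat n; exists c.
have [n ->] : exists n : nat, i = - n%:Z by exists (absz i); lia.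
by have [c [e _]] := gam_tpow_opp n; exists c.
Qed.

Lemma tcoef_gam_low i k : k < i -> tcoef (sg (tpow i)) k = 0.
Proof.
have [c ->] := gam_tpow i => ki.
by rewrite tcoef_tpowM// tcoef_pseries_neg//; lia.
Qed.

Lemma tcoef_gam_nat (n : nat) : tcoef (sg (tpow n%:Z)) n%:Z = a%:R ^+ n.
Proof.
have [c [-> c0]] := gam_tpow_nat n.
by rewrite tcoef_tpowM// subrr [LHS](tcoef_pseries A_complete c 0).
Qed.

Lemma tcoef_gam_opp (n : nat) : a%:R ^+ n * tcoef (sg (tpow (- n%:Z))) (- n%:Z) = 1.
Proof.
have [c [-> c0]] := gam_tpow_opp n.
by rewrite tcoef_tpowM// subrr [X in _ * X](tcoef_pseries A_complete c 0).
Qed.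

(** The image of T^i under gamma is T^i times a power series, so gamma never lowers exponents, and
    the lowest term only sees itself. *)
Lemma gam_leading (I : set A) b x (w : int) : is_ideal I -> (pdvd p b `<=` I)%classic ->
    (forall i, i < w -> I (tcoef x i)) ->
  (forall k, k < w -> I (tcoef (sg x) k)) /\
  I (tcoef (sg x) w - tcoef x w * tcoef (sg (tpow w)) w).
Proof.
move=> hI bI hx.
have cont := gamn_continuous ap; have lin := gamn_linear ap.
split=> [k kw|].
  have := @endo_coef p A A_complete sg cont lin I b x k w 0%N hI bI.
  rewrite big_ord0 => h; rewrite -[tcoef _ _]subr0; apply: h => j _.
  case: (ltP j w) => jw; first by apply: (ideal_mulr hI); apply: hx.
  by rewrite tcoef_gam_low ?mulr0; [apply: ideal0 | lia].
have := @endo_coef p A A_complete sg cont lin I b x w w 1%N hI bI.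
rewrite big_ord1 addr0 => h; apply: h => j hj.
case: (ltP j w) => jw; first by apply: (ideal_mulr hI); apply: hx.
by rewrite tcoef_gam_low ?mulr0; [apply: ideal0 | lia].
Qed.

End OneGamma.

Section OnePlusPower.
Variable k : nat.
Let q := (p ^ k.+1)%N.

Lemma coprime_1Dpower : coprime q.+1 p.
Proof.
by rewrite coprime_sym prime_coprime// -addn1 dvdn_addr ?dvdn_exp// dvdn1;
  case: p p_pr => [|[]].
Qed.
Local Notation cq := coprime_1Dpower.
Local Notation sg := (gamn q.+1).

(** Modulo p, (1+T)^(q+1) = (1+T)(1+T^q), so gamma(T)/T = 1 + T^(q-1) + T^q = 1 + [eps]. Large q
    makes gamma close to the identity. *)
Let eps : R := tpow (q%:Z - 1) + tpow q%:Z.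

Let q0 : (0 < q)%N. Proof. by rewrite expn_gt0 prime_gt0. Qed.

Let eps_pseries : is_pseries eps.
Proof.
have [n hn] : exists n : nat, q%:Z - 1 = n%:Z by exists q.-1; lia.
by rewrite /eps hn; apply: is_pseriesD; apply: is_pseries_tpow.
Qed.

Lemma gamq_gser : pdvd p 1 (pseries (gser q.+1) - (1 + eps)).
Proof.
have e := gamnT cq.
rewrite (gamnT_series cq) in e.
have t1 : tpow (-1) * tpow 1 = 1 by rewrite mulrC tpowNK.
have -> : pseries (gser q.+1) - (1 + eps) =
    tpow (-1) * (tpow 1 * pseries (gser q.+1) - tpow 1 * (1 + eps)).
  by rewrite -mulrBr mulrA t1 mul1r.
apply: pdvdMl; rewrite e /eps mulrDr mulr1 mulrDr -!tpowD.
have -> : 1 + (q%:Z - 1) = q%:Z by lia.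
have := pdvd_frob_1D p_pr (tpow 1) k.+1; rewrite -/q -[tpow 1 ^+ q]tpow_nat.
rewrite exprS tpowD; move: (tpow 1) (tpow q) => t tq h.
have -> : (1 + t) * (1 + t) ^+ q - 1 - (t + (tq + t * tq)) =
  (1 + t) * ((1 + t) ^+ q - (1 + tq)).
  by move: (_ ^+ q) => v; ring.
exact: pdvdMl.
Qed.

(** First-order expansion of (1 + eps)^-n, with a remainder that is eps^2 times a power series. It
    rests on D = 1 - eps + eps^2 D for the inverse D of 1 + eps. *)
Lemma gamq_tpow_opp (n : nat) : exists h, is_pseries h /\
  pdvd p 1 (sg (tpow (- n%:Z)) - tpow (- n%:Z) * (1 - n%:R * eps + eps * eps * h)).
Proof.
have [d [e1 e2]] := gam_tpow_inv cq.
have dps : is_pseries (pseries d) by apply/is_pseriesP; exists d.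
have hD : pdvd p 1 (pseries d - (1 - eps + eps * eps * pseries d)).
  have h := pdvdMr (pseries d * (1 - eps)) gamq_gser.
  move: h e2; move: (pseries d) (pseries _) eps => D w e h e2.
  have -> : D - (1 - e + e * e * D) = - ((w - (1 + e)) * (D * (1 - e))) + (1 - e) * (w * D - 1).
    by ring.
  by rewrite e2 subrr mulr0 addr0; apply: pdvdN.
suff [h [hps hh]] : exists h, is_pseries h /\
    pdvd p 1 (pseries d ^+ n - (1 - n%:R * eps + eps * eps * h)).
  exists h; split=> //.
  by rewrite tpow_opp rmorphXn e1 exprMn -mulrBr; apply: pdvdMl.
elim: n => [|n [h [hps hh]]].
  exists 0; split; first by move=> i _; rewrite tcoef0.
  by rewrite expr0 mul0r mulr0 addr0 subr0 subrr; apply: pdvd0.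
(* With e for [eps] and D for [pseries d], this is the cofactor of e^2 in (1 - e + e^2 D)(1 - n e +
   e^2 h). *)
exists (pseries d + n%:R - n%:R * eps * pseries d +
  h * (1 - eps + eps * eps * pseries d)); split.
  repeat (apply: is_pseriesD || apply: is_pseriesM || apply: is_pseriesN) => //.
  - exact: is_pseries_nat.
  - exact: is_pseries_nat.
  - exact: is_pseries1.
have := pdvd_mulB hD hh; rewrite exprS; congr (pdvd p 1 (_ - _)).
rewrite -(natr1 n); move: (pseries d) eps (n%:R : R) => D e m; ring.
Qed.

(** The remainder of the expansion starts at T^(-n + 2(q-1)), because eps^2 = T^(2(q-1)) (1+T)^2;
    below that exponent the first-order terms are exact modulo p. *)
Lemma tcoef_gamq (n : nat) (j : int) : j < - n%:Z + 2 * (q%:Z - 1) ->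
  pdvd p 1 (tcoef (sg (tpow (- n%:Z))) j -
    ((j == - n%:Z)%:R - n%:R * ((j == q%:Z - 1 - n%:Z)%:R + (j == q%:Z - n%:Z)%:R))).
Proof.
move=> hj; have [h [hps hh]] := gamq_tpow_opp n.
have := tcoef_modp A_complete j hh; congr (pdvd p 1 (_ - _)).
have -> : tpow (- n%:Z) * (1 - n%:R * eps + eps * eps * h) =
    tpow (- n%:Z) - n%:R * (tpow (q%:Z - 1 - n%:Z) + tpow (q%:Z - n%:Z)) +
    tpow (- n%:Z + 2 * (q%:Z - 1)) * ((1 + tpow 1) * (1 + tpow 1) * h).
  have E1 : tpow (q%:Z - 1 - n%:Z) = tpow (- n%:Z) * tpow (q%:Z - 1).
    by rewrite -tpowD; congr tpow; lia.
  have E2 : tpow (q%:Z - n%:Z) = tpow (- n%:Z) * (tpow (q%:Z - 1) * tpow 1).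
    by rewrite -!tpowD; congr tpow; lia.
  have E3 : tpow (- n%:Z + 2 * (q%:Z - 1)) =
      tpow (- n%:Z) * (tpow (q%:Z - 1) * tpow (q%:Z - 1)).
    by rewrite -!tpowD; congr tpow; lia.
  have E4 : tpow q%:Z = tpow (q%:Z - 1) * tpow 1 by rewrite -tpowD subrK.
  rewrite /eps E1 E2 E3 E4.
  move: (tpow (- n%:Z)) (tpow (q%:Z - 1)) (tpow 1) (n%:R : R) => u v w m.
  ring.
rewrite tcoefD// [X in _ + X]tcoef_tpowM// [X in _ + X](_ : _ = 0) ?addr0; last first.
  have hps2 : is_pseries ((1 + tpow 1) * (1 + tpow 1) * h).
    have h1 : is_pseries (1 + tpow 1).
      by apply: is_pseriesD; [apply: is_pseries1 | apply: is_pseries_tpow].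
    by do 2?apply: is_pseriesM.
  by apply: hps2; lia.
by rewrite tcoefB// tcoef_natM// tcoefD// !tcoef_tpow.
Qed.

End OnePlusPower.
Section KeyLemma.
Variables (K K' : set A) (b : nat).
Hypotheses (hK : is_ideal K) (hK' : is_ideal K').
Hypothesis K'K : (K' `<=` K)%classic.
Hypothesis pK : forall a, K a -> K' (p%:R * a).
Hypothesis bK' : (pdvd p b `<=` K')%classic.

Let p0 := prime_gt0 p_pr.
Let p1 := prime_gt1 p_pr.

Lemma ndvd_cancel (n : nat) (c : A) : ~~ (p %| n)%N -> K c -> K' (n%:R * c) -> K' c.
Proof.
move=> pn Kc Knc; have cn : coprime n p by rewrite coprime_sym prime_coprime.
have [m hm] := nat_inverse_mod p_pr cn.
have := divn_eq (m * n)%N p; rewrite hm modn_small// => e.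
have -> : c = m%:R * (n%:R * c) - (m * n %/ p)%:R * (p%:R * c).
  by rewrite !mulrA -!natrM {1}e natrD mulrDl mul1r addrC addKr.
by apply: (idealB hK'); apply: (ideal_mull hK') => //; apply: pK.
Qed.

Lemma modp_mul (c : A) a a' : K c -> pdvd p 1 (a - a') -> K' (c * a - c * a').
Proof.
move=> Kc [w hw]; rewrite -mulrBr hw expr1 mulrA (mulrC _ p%:R).
by apply: (ideal_mulr hK'); apply: pK.
Qed.

Section PhiMinusOne.
Variable y : R.
Hypothesis yK : coefs_in K y.
Let py i : K' (p%:R * tcoef y i) := pK (yK i).
Local Notation f k := (tcoef (phi y - y) k).

Lemma phiB1_dvd (k : int) : K' (f (p%:Z * k) - (tcoef y k - tcoef y (p%:Z * k))).
Proof.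
rewrite tcoefB//.
have -> : forall u v w : A, u - v - (w - v) = u - w by move=> *; ring.
exact: (tcoef_phi hK' bK').
Qed.

Lemma phiB1_ndvd (k : int) : ~~ (p%:Z %| k)%Z -> K' (f k + tcoef y k).
Proof.
move=> pk; rewrite tcoefB// subrK.
exact: (tcoef_phi_ndvd hK' bK').
Qed.

Lemma phiB1_const : K' (f 0).
Proof. by have := phiB1_dvd 0; rewrite mulr0 subrr subr0. Qed.

(** Where phi(y) - y vanishes, the coefficient of y at -j equals the one at -pj. Iterating moves it
    arbitrarily far to the left, where the coefficients of y lie in p^b A. *)
Lemma phiB1_polar (m : nat) : (0 < m)%N ->
    (forall k : nat, (p * m <= k)%N -> K' (f (- k%:Z))) ->
  forall k : nat, (m <= k)%N -> K' (tcoef y (- k%:Z)).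
Proof.
move=> m0 hf k mk; have [N hN] := tcoef_bounded A_complete y b.
have down j : (m <= j)%N -> K' (tcoef y (- (p * j)%N%:Z)) -> K' (tcoef y (- j%:Z)).
  move=> mj hj; have := phiB1_dvd (- j%:Z).
  have -> : p%:Z * - j%:Z = - (p * j)%N%:Z by rewrite mulrN -PoszM.
  move=> h; apply/(ideal_congr hK' (y := tcoef y (- (p * j)%N%:Z))) => //.
  apply/(ideal_congr hK' (ideal_sym hK' h)); apply: hf.
  by rewrite leq_pmul2l.
have iter_down n : K' (tcoef y (- (p ^ n * k)%N%:Z)) -> K' (tcoef y (- k%:Z)).
  elim: n => [|n IH]; first by rewrite mul1n.
  rewrite expnS -mulnA => h; apply: IH; apply: down => //.
  by apply: leq_trans mk _; rewrite leq_pmull// expn_gt0 p0.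
apply: (iter_down `|N|.+1); apply: bK'; apply: hN.
have : (`|N|.+1 < p ^ `|N|.+1)%N by apply: ltn_expl.
have : (p ^ `|N|.+1 <= p ^ `|N|.+1 * k)%N by rewrite leq_pmulr//; apply: leq_trans mk.
move: (p ^ _)%N (p ^ _ * k)%N => u v; lia.
Qed.

(** At an exponent prime to p only -y contributes to phi(y) - y, and y vanishes there by
    [phiB1_polar]. *)
Lemma phiB1_vanish (m : nat) : ~~ (p %| m)%N ->
    (forall k : nat, (p * m <= k)%N -> K' (f (- k%:Z))) -> K' (f (- m%:Z)).
Proof.
move=> pm hf; have m0 : (0 < m)%N by case: m pm {hf} => //; rewrite dvdn0.
have h := phiB1_polar m0 hf (leqnn m).
rewrite -(addrK (tcoef y (- m%:Z)) (f _)); apply: (idealB hK') => //.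
by apply: phiB1_ndvd; rewrite dvdzE abszN.
Qed.

End PhiMinusOne.

(** Positive exponents are removed by z = -(x + phi(x) + ...), and in the polar part subtracting
    phi(T^-k) - T^-k trades T^-pk for T^-k. What survives is the constant term and the T^-k with k
    prime to p. *)
Lemma normalize x : coefs_in K x -> exists z, [/\ coefs_in K z,
    forall i, 0 < i -> K' (tcoef (x - (phi z - z)) i)
  & forall k : nat, (0 < k)%N -> (p %| k)%N -> K' (tcoef (x - (phi z - z)) (- k%:Z))].
Proof.
move=> xK; have [N hN] := tcoef_bounded A_complete x b.
pose L := `|N|.+1.
(* Cutting off the polar coefficients divisible by p^b makes the sums below finite. *)
pose x' (k : nat) := if (k < L)%N then tcoef x (- k%:Z) else 0.
have x'P k : K' (tcoef x (- k%:Z) - x' k).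
  rewrite /x'; case: ltnP => h; first by rewrite subrr; apply: ideal0.
  by rewrite subr0; apply: bK'; apply: hN; move: h; rewrite /L; lia.
(* The coefficient of z at -k collects everything at -kp, -kp^2, ..., so that w(k) - w(pk) is the
   coefficient to be removed at -pk. *)
pose w k := \sum_(j < L) x' (k * p ^ j.+1)%N.
have pj j : (j < p ^ j)%N by apply: ltn_expl.
have wE k : (0 < k)%N -> w k - w (p * k)%N = x' (p * k)%N.
  move=> k0; have -> : w (p * k)%N = \sum_(j < L) x' (k * p ^ j.+2)%N.
    by apply: eq_bigr => j _; congr x'; rewrite (expnS p j.+1) mulnCA mulnA.
  rewrite /w [X in X - _](_ : _ = \sum_(j < L.+1) x' (k * p ^ j.+1)%N).
    rewrite big_ord_recl /= expn1 mulnC.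
    by rewrite [X in _ + X - _](eq_bigr (fun j : 'I_L => x' (k * p ^ j.+2)%N)) ?addrK.
  suff e : x' (k * p ^ L.+1)%N = 0 by rewrite [RHS]big_ord_recr /= e addr0.
  rewrite /x' ltnNge (_ : (L <= _)%N)//.
  have := pj L.+1; have : (p ^ L.+1 <= k * p ^ L.+1)%N by rewrite leq_pmull.
  lia.
have w0 k : (L <= k)%N -> w k = 0.
  move=> Lk; rewrite /w big1// => j _; rewrite /x' ltnNge.
  by rewrite (leq_trans Lk)// leq_pmulr// expn_gt0 p0.
(* Positive part of z = phi(z) - x, solved by recursion since phi takes exponent n/p to n. *)
have [|u hu] := @strong_recursion A 0 (fun n g => if n == 0%N then 0 else
    (if (p %| n)%N then g (n %/ p)%N else 0) - tcoef x n%:Z).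
  move=> n g h gh; case: eqP => // /eqP n0; congr (_ - _); case: ifP => // _.
  by rewrite gh// ltn_Pdiv// lt0n.
have zP : (fun i : int => match i with Posz n => u n | Negz n => w n.+1 end)
    \in @bounded_below A.
  apply/bounded_belowP; exists (- L%:Z) => -[n|n] hi; first by lia.
  by apply: w0; lia.
pose z : R := of_laurent p A (Laurent zP).
have zpos (n : nat) : tcoef z n%:Z = u n by rewrite tcoef_of_laurent.
have zneg (n : nat) : (0 < n)%N -> tcoef z (- n%:Z) = w n.
  by case: n => // n _; rewrite tcoef_of_laurent.
have zK : coefs_in K z.
  move=> [n|n]; last first.
    rewrite tcoef_of_laurent//=; apply: (ideal_sum hK) => j _; rewrite /x'.
    by case: ifP => _; [apply: xK | apply: ideal0].
  rewrite zpos; elim/ltn_ind: n => n IH; rewrite hu.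
  case: eqP => [_|/eqP n0]; first exact: ideal0.
  apply: (idealB hK); last exact: xK.
  by case: ifP => _; [apply: IH; rewrite ltn_Pdiv// lt0n | apply: ideal0].
exists z; split=> //.
  move=> [[//|n]|//] _; rewrite tcoefB//.
  have := hu n.+1; rewrite /= => hun.
  have [pn|pn] := boolP (p %| n.+1)%N; last first.
    rewrite (negPf pn) sub0r in hun.
    have := @phiB1_ndvd z zK n.+1%:Z; rewrite dvdzE => /(_ pn).
    by rewrite zpos hun => /(idealN hK'); rewrite opprB.
  rewrite pn in hun; have := phiB1_dvd zK (n.+1 %/ p)%N%:Z.
  rewrite -PoszM mulnC divnK// !zpos hun => /(idealN hK').
  by rewrite opprB; congr K'; ring.
move=> k k0 pk; rewrite tcoefB//.
have k'0 : (0 < k %/ p)%N by rewrite divn_gt0// dvdn_leq.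
have := phiB1_dvd zK (- (k %/ p)%N%:Z).
rewrite mulrN -PoszM [(p * _)%N]mulnC divnK// !zneg//.
have := wE _ k'0; rewrite [(p * _)%N]mulnC divnK// => -> h.
exact: (ideal_trans hK' (x'P k) (ideal_sym hK' h)).
Qed.

(** Exponents are not lowered by gamma, so the positive part of w cannot reach k <= 0. *)
Lemma gam_sum w (N : nat) a k : coprime a p -> k <= 0 ->
    (forall n : nat, (N < n)%N -> K' (tcoef w (- n%:Z))) ->
  K' (tcoef (gamn a w) k -
      \sum_(n < N.+1) tcoef w (- n%:Z) * tcoef (gamn a (tpow (- n%:Z))) k).
Proof.
move=> ap k0 wN.
have cont := gamn_continuous ap; have lin := gamn_linear ap.
have := @endo_coef p A A_complete _ cont lin K' b w k (- N%:Z) N.+1 hK' bK'.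
rewrite (reindex_inj rev_ord_inj) /=.
under eq_bigr => n _.
  rewrite (_ : - N%:Z + (N.+1 - n.+1)%N%:Z = - n%:Z); last by have := ltn_ord n; lia.
  over.
apply=> i hi; case: (ltP 0 i) => i0.
  by rewrite (tcoef_gam_low ap) ?mulr0; [apply: ideal0 | lia].
apply: (ideal_mulr hK'); have [n e] : exists n : nat, i = - n%:Z by exists `|i|%N; lia.
by rewrite e; apply: wN; move: hi; lia.
Qed.

Section Normalized.
Variables (x : R) (y : nat -> R).
Hypotheses (xK : coefs_in K x) (yK : forall a, coprime a p -> coefs_in K (y a)).
Hypothesis rel : forall a, coprime a p ->
  coefs_in K' (gamn a x - x - (phi (y a) - y a)).
Hypothesis comm : forall a a', coprime a p -> coprime a' p ->
  coefs_in K' (gamn a (y a') - y a' - (gamn a' (y a) - y a)).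
Hypothesis xp : forall k : nat, (0 < k)%N -> (p %| k)%N -> K' (tcoef x (- k%:Z)).

Local Notation c n := (tcoef x (- n%:Z)).
Local Notation f a k := (tcoef (phi (y a) - y a) k).

Lemma rel_coef a k : coprime a p -> K' (tcoef (gamn a x) k - tcoef x k - f a k).
Proof. by move=> ap; rewrite -!tcoefB//; apply: rel. Qed.

Section Top.
Variables (N : nat).
Hypothesis topN : forall n, (N < n)%N -> K' (c n).

Lemma polar_out i : i < - N%:Z -> K' (tcoef x i).
Proof.
move=> h; have [n e] : exists n : nat, i = - n%:Z by exists `|i|%N; lia.
by rewrite e; apply: topN; lia.
Qed.

(** Compare coefficients of T^-N in the relation for a: gamma multiplies the lowest coefficient by
    a^-N, while phi(y) - y contributes nothing there, by [phiB1_vanish]. *)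
Lemma top_unity a : coprime a p -> (0 < N)%N -> ~~ (p %| N)%N ->
  K' ((a%:R ^+ N - 1) * c N).
Proof.
move=> ap N0 pN.
have [hlow hN] := gam_leading ap hK' bK' polar_out.
have fN : K' (f a (- N%:Z)).
  apply: (phiB1_vanish (yK ap)) => // k pk.
  have Nk : (N < k)%N by apply: leq_trans pk; rewrite ltn_Pmull.
  rewrite -[f a _](subKr (tcoef (gamn a x) (- k%:Z) - tcoef x (- k%:Z))).
  apply: (idealB hK'); last exact: rel_coef.
  by apply: (idealB hK'); [apply: hlow; lia | apply: topN].
have h1 := idealD hK' (rel_coef (- N%:Z) ap) fN; rewrite subrK in h1.
have := idealB hK' h1 hN => /(ideal_mull hK' (a%:R ^+ N)).
have := tcoef_gam_opp ap N.
move: (a%:R ^+ N) (c N) (tcoef (gamn a x) _) (tcoef _ (- N%:Z)) => u v w s us h.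
have -> : (u - 1) * v = - (u * (w - v - (w - v * s))) + (1 - u * s) * - v by ring.
by rewrite us subrr mul0r addr0; apply: (idealN hK').
Qed.

Lemma sum_pick (F : nat -> A) (j : nat) : ((N < j)%N -> K' (F j)) ->
  K' (\sum_(m < N.+1) F m * (m == j :> nat)%:R - F j).
Proof.
move=> hF; case: (ltnP N j) => hj.
  rewrite big1 ?sub0r => [|m _]; first by apply: (idealN hK'); apply: hF.
  by rewrite (_ : (_ == _) = false) ?mulr0//; apply/eqP; have := ltn_ord m; lia.
rewrite (bigD1 (Ordinal (hj : (j < N.+1)%N))) //= eqxx mulr1 big1 => [|m /eqP nm].
  by rewrite addr0 subrr; apply: ideal0.
by rewrite (_ : (_ == _) = false) ?mulr0//; apply/eqP => e; apply: nm; apply/val_inj.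
Qed.

(** This is the relation for a = q + 1 at T^-(n-q). There the first-order part of gamma(x) - x comes
    only from T^-n (through T^q) and from T^-(n-1) (through T^(q-1)). The bound N + 2 < n + q keeps
    the second-order terms of every T^-m with m <= N above this exponent. *)
Lemma gamq_rel (j n : nat) : let q := (p ^ j.+1)%N in (q <= n)%N -> (N.+2 < n + q)%N ->
  K' (f q.+1 (- (n - q)%N%:Z) + (n%:R * c n + n.-1%:R * c n.-1)).
Proof.
move=> q qn Nnq; have cq := coprime_1Dpower j; rewrite -/q in cq.
have q0 : (0 < q)%N by rewrite expn_gt0 p0.
set k := - (n - q)%N%:Z.
have k0 : k <= 0 by rewrite /k; lia.
have h1 := gam_sum cq k0 topN; have h2 := rel_coef k cq.
pose G (m : nat) := c m * (m == (n - q)%N)%:R -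
  (m%:R * c m * (m == n.-1)%:R + m%:R * c m * (m == n)%:R).
have h3 : K' (\sum_(m < N.+1) c m * tcoef (gamn q.+1 (tpow (- m%:Z))) k -
              \sum_(m < N.+1) G m).
  rewrite -sumrB; apply: (ideal_sum hK') => m _.
  have hm : k < - (m : nat)%:Z + 2 * (q%:Z - 1) by rewrite /k; have := ltn_ord m; lia.
  have := @tcoef_gamq j m k hm.
  move=> /(modp_mul (xK (- (m : nat)%:Z))); rewrite -/q.
  have -> : (k == - m%:Z) = (m == (n - q)%N :> nat) by apply/eqP/eqP; rewrite /k; lia.
  have -> : (k == q%:Z - 1 - m%:Z) = (m == n.-1 :> nat) by apply/eqP/eqP; rewrite /k; lia.
  have -> : (k == q%:Z - m%:Z) = (m == n :> nat) by apply/eqP/eqP; rewrite /k; lia.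
  rewrite /G; congr K'; ring.
have h4 : K' (\sum_(m < N.+1) G m - (c (n - q)%N - (n.-1%:R * c n.-1 + n%:R * c n))).
  rewrite /G sumrB big_split /=.
  have hp1 := @sum_pick (fun m => c m) (n - q)%N (topN (n := _)).
  have hp2 := @sum_pick (fun m => m%:R * c m) n.-1
    (fun h => ideal_mull hK' _ (topN h)).
  have hp3 := @sum_pick (fun m => m%:R * c m) n (fun h => ideal_mull hK' _ (topN h)).
  have := idealB hK' hp1 (idealD hK' hp2 hp3); congr K'.
  by move: (\sum_(m < _) _ * _) (\sum_(m < _) _ * (_ == n.-1)%:R)
    (\sum_(m < _) _ * (_ == n)%:R) => *; ring.
have := ideal_trans hK' h1 (ideal_trans hK' h3 h4).
move=> /(idealB hK') /(_ h2); congr K'.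
rewrite -/(c (n - q)%N); ring.
Qed.

Lemma gamq_high (j n : nat) : let q := (p ^ j.+1)%N in (q <= n)%N -> (N.+1 < n)%N ->
  K' (f q.+1 (- (n - q)%N%:Z)).
Proof.
move=> q qn Nn; have q0 : (0 < q)%N by rewrite expn_gt0 p0.
have Nnq : (N.+2 < n + q)%N by lia.
have := gamq_rel qn Nnq; rewrite -/q => h.
rewrite -[f _ _](addrK (n%:R * c n + n.-1%:R * c n.-1)); apply: (idealB hK') => //.
by apply: (idealD hK'); apply: (ideal_mull hK'); apply: topN; lia.
Qed.

Hypotheses (N0 : (0 < N)%N) (pN : ~~ (p %| N)%N).

Let cancel_top : K' (N%:R * c N) -> K' (c N).
Proof. exact: ndvd_cancel. Qed.

(** Take a = p + 1 and n = N + 1 in [gamq_rel]: the coefficient c_(N+1) vanishes, and so does the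
    phi-term, because N + 1 - p is prime to p. This leaves N c_N. *)
Lemma top_ndvd : ~~ (p %| N.+1)%N -> (p <= N.+1)%N -> K' (c N).
Proof.
move=> pN1 leN; apply: cancel_top.
have m0 : (0 < N.+1 - p)%N.
  by rewrite subn_gt0 ltn_neqAle leN andbT; apply: contra pN1 => /eqP <-.
have cp : coprime p.+1 p by have := coprime_1Dpower 0; rewrite expn1.
have hf : K' (f p.+1 (- (N.+1 - p)%N%:Z)).
  apply: (phiB1_vanish (yK cp)); first by rewrite dvdn_subl.
  move=> k hk; have h := @gamq_high 0 (k + p)%N; rewrite /= expn1 addnK in h; apply: h.
    by rewrite leq_addl.
  have : (2 * (N.+1 - p) <= k)%N by apply: leq_trans hk; rewrite leq_mul2r p1 orbT.
  lia.
have hlt : (N.+2 < N.+1 + p)%N by have := p1; lia.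
have := @gamq_rel 0 N.+1; rewrite /= expn1 => /(_ leN hlt) h.
have := idealB hK' (idealB hK' h hf) (ideal_mull hK' N.+1%:R (topN (ltnSn N))).
by congr K'; ring.
Qed.

(** For q = N + 1 and n = q the relation is read at T^0, where phi - 1 always vanishes. *)
Lemma top_power j : N = (p ^ j.+1).-1 -> K' (c N).
Proof.
move=> NE; apply: cancel_top; set q := (p ^ j.+1)%N in NE.
have q1 : (1 < q)%N by apply: leq_trans p1 _; rewrite -{1}(expn1 p) leq_exp2l.
have cq := coprime_1Dpower j.
have := @gamq_rel j q; rewrite /= -/q => /(_ (leqnn q) ltac:(lia)).
rewrite subnn => /(idealB hK') /(_ (phiB1_const (yK cq))).
have cq0 : K' (q%:R * c q) by apply: (ideal_mull hK'); apply: topN; lia.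
move=> /(idealB hK') /(_ cq0); rewrite NE oppr0; congr K'; ring.
Qed.

(** The coefficient at N + 1 - p vanishes, since p divides that exponent. The relations for a = p^2
    + 1 link n c_n to (n-1) c_(n-1) as long as n is prime to p, and carry this vanishing up to N. *)
Lemma top_large : (p %| N.+1)%N -> (p ^ 2 + p <= N)%N -> K' (c N).
Proof.
move=> pN1 leN; apply: cancel_top; set q := (p ^ 2)%N in leN.
have cq : coprime q.+1 p := coprime_1Dpower 1.
have pq : (p %| q)%N by rewrite /q dvdn_exp.
have ltpq : (p < q)%N by rewrite /q -mulnn ltn_Pmull.
have chain i : (i < p)%N -> K' ((N.+1 - p + i)%N%:R * c (N.+1 - p + i)%N).
  elim: i => [|i IH] ip.
    apply: (ideal_mull hK'); rewrite addn0; apply: xp; first by lia.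
    by rewrite dvdn_subr//; lia.
  set n := (N.+1 - p + i.+1)%N.
  (* From n - q >= 2 one gets p(n - q) >= n - q + p, which is far enough for [gamq_high] to supply
     the hypothesis of [phiB1_vanish]. *)
  have qn : (q.+2 <= n)%N by rewrite /n; lia.
  have hf : K' (f q.+1 (- (n - q)%N%:Z)).
    apply: (phiB1_vanish (yK cq)).
      rewrite dvdn_subl//; last by lia.
      rewrite /n dvdn_addr; last by rewrite dvdn_subr//; lia.
      by rewrite gtnNdvd.
    move=> k hk; have h := @gamq_high 1 (k + q)%N; rewrite /= -/q addnK in h; apply: h.
      by rewrite leq_addl.
    have : (n - q + p <= p * (n - q))%N.
      rewrite -[X in (X + _)%N]mul1n.
      apply: (@leq_trans (1 * (n - q) + p.-1 * (n - q)))%N; last first.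
        by rewrite -mulnDl add1n prednK.
      rewrite leq_add2l; apply: (@leq_trans (p.-1 * 2)); first by lia.
      by rewrite leq_mul2l; apply/orP; right; lia.
    move: (p * (n - q))%N hk => z; rewrite /n; lia.
  have := @gamq_rel 1 n; rewrite /= -/q => /(_ ltac:(lia) ltac:(rewrite /n; lia)) h.
  have nE : n.-1 = (N.+1 - p + i)%N by rewrite /n; lia.
  have := idealB hK' (idealB hK' h hf) (IH ltac:(lia)).
  by rewrite nE; congr K'; ring.
have := chain p.-1; rewrite prednK// => /(_ (leqnn p)).
by have -> : (N.+1 - p + p.-1)%N = N by lia.
Qed.

(* For p = 2 the exponent 5 survives all the conditions on x alone (the class of
   T^-5 + T^-1 is Gamma-invariant); the commutation of 3 and 5 in Gamma excludes it. *)
Lemma top_two : p = 2 -> N = 5 -> K' (c N).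
Proof.
move=> p2 N5; have c3 : coprime 3 p by rewrite p2.
have c5 : coprime 5 p by rewrite p2.
have E1 : (p ^ 1)%N = 2 by rewrite p2.
have E2 : (p ^ 2)%N = 4 by rewrite p2.
have y3 : forall k : nat, (3 <= k)%N -> K' (tcoef (y 3) (- k%:Z)).
  apply: (phiB1_polar (yK c3)) => // k hk.
  by have h := @gamq_high 0 (k + 2)%N; rewrite /= E1 addnK in h; apply: h; lia.
have y5 : forall k : nat, (2 <= k)%N -> K' (tcoef (y 5) (- k%:Z)).
  apply: (phiB1_polar (yK c5)) => // k hk.
  by have h := @gamq_high 1 (k + 4)%N; rewrite /= E2 addnK in h; apply: h; lia.
(* At T^-2 the term phi(y) - y for y = y_5 is y_(-1) - y_(-2), and [gamq_rel] with q = 4, n = 6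
   evaluates it as -6 c_6 - 5 c_5. *)
have y51 : K' (tcoef (y 5) (-1) + 5%:R * c N).
  have := @gamq_rel 1 6; rewrite /= E2 N5 => /(_ isT isT) h.
  have := phiB1_dvd (yK c5) (-1); rewrite (_ : p%:Z * -1 = - 2%:Z); last by lia.
  move=> /(ideal_sym hK') h2; have c6 := topN (n := 6); rewrite N5 in c6.
  have := idealB hK' (idealD hK' (idealD hK' h2 h) (y5 2%N isT)) (ideal_mull hK' 6%:R (c6 isT)).
  by congr K'; rewrite /=; ring.
have g (a n : nat) j : coprime a p -> a = (p ^ j.+1).+1 -> (n < 2 * (p ^ j.+1).-1)%N ->
    pdvd p 1 (tcoef (gamn a (tpow (- n%:Z))) 0 -
      ((n == 0)%N%:R - n%:R * ((n == (p ^ j.+1).-1)%:R + (n == p ^ j.+1)%N%:R))).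
  move=> ap aE hn; have q0 : (0 < p ^ j.+1)%N by rewrite expn_gt0 p0.
  have := @tcoef_gamq j n 0 ltac:(lia).
  rewrite -aE; congr (pdvd p 1 (_ - (_%:R - _ * (_%:R + _%:R)))).
  - by rewrite eq_sym oppr_eq0.
  - by apply/eqP/eqP; lia.
  - by apply/eqP/eqP; lia.
(* In the constant term of the cocycle identity, a = 5 sends T^-1 and T^-2 to themselves plus terms
   of positive order, whereas a = 3 sends T^-1 to T^-1 - 1 + ... . Only the coefficient of y_5 at -1
   is left, so it vanishes. *)
have C := comm c5 c3 0; rewrite !tcoefB// in C.
have h3 := gam_sum c5 (lexx 0) (N := 2) y3; rewrite !big_ord_recl big_ord0 /= in h3.
have h5 := gam_sum c3 (lexx 0) (N := 1) y5; rewrite !big_ord_recl big_ord0 /= in h5.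
have t0 (a : nat) : tcoef (gamn a (tpow (- 0%:Z))) 0 = 1.
  by rewrite oppr0 tpow0 rmorph1 tcoef1.
rewrite !t0 oppr0 in h3 h5.
have e1 := modp_mul (yK c3 (-1)) (g 5 1%N 1%N c5 ltac:(by rewrite E2) ltac:(by rewrite E2)).
have e2 := modp_mul (yK c3 (-2)) (g 5 2 1%N c5 ltac:(by rewrite E2) ltac:(by rewrite E2)).
have e3 := modp_mul (yK c5 (-1)) (g 3 1%N 0%N c3 ltac:(by rewrite E1) ltac:(by rewrite E1)).
rewrite E2 /= in e1 e2; rewrite E1 /= in e3.
have v0 : K' (tcoef (y 5) (-1)).
  have := idealD hK' (idealD hK' e3 C) (idealB hK' h5 h3).
  move=> /(idealB hK') /(_ e1) /(idealB hK') /(_ e2).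
  by rewrite /bump /=; congr K'; ring.
rewrite N5 in y51 *; apply: (@ndvd_cancel 5); first by rewrite p2.
  exact: xK.
by have := idealB hK' y51 v0; congr K'; ring.
Qed.

End Top.

(** Let N be the largest exponent whose coefficient is outside K'. It is prime to p by [xp], and p -
    1 divides it: otherwise some a^N - 1 is prime to p and [top_unity] applies. The remaining cases
    are those of [exponent_cases]. *)
Lemma polar_vanish (n : nat) : (0 < n)%N -> K' (c n).
Proof.
move=> n0; apply: contrapT => hn.
pose bad m := `[< (0 < m)%N /\ ~ K' (c m) >].
have [M hM] := tcoef_bounded A_complete x b.
have badn : exists m, bad m by exists n; apply/asboolP.
have badM m : bad m -> (m <= `|M|)%N.
  move=> /asboolP[_ hm]; rewrite leqNgt; apply/negP => Mm; apply: hm; apply: bK'.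
  by apply: hM; lia.
have [N /asboolP[N0 hN] maxN] := ex_maxnP badn badM.
have topN m : (N < m)%N -> K' (c m).
  move=> Nm; apply: contrapT => hm; have /maxN : bad m by apply/asboolP; split=> //; lia.
  by rewrite leqNgt Nm.
have pN : ~~ (p %| N)%N by apply/negP => pN; apply: hN; apply: xp.
apply: hN; have [pm|pm] := boolP (p.-1 %| N)%N; last first.
  apply: contrapT => hN; move/negP: pm; apply; apply: exp_all_one => // a ap.
  have a0 : (0 < a ^ N)%N.
    by rewrite expn_gt0; case: a ap => //; rewrite /coprime gcd0n => /eqP p1'; lia.
  apply/eqP; rewrite eqn_mod_dvd//; apply/negPn/negP => pa; apply: hN.
  apply: (ndvd_cancel pa) => //; rewrite natrB// natrX.
  exact: top_unity.
have [[]|[]|[]|[]] := exponent_cases p_pr N0 pN pm.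
- exact: top_ndvd.
- by move=> NE; apply: (top_power topN N0 pN (j := 0)); rewrite expn1.
- exact: (top_power topN N0 pN (j := 1)).
- exact: top_large.
- exact: top_two.
Qed.

End Normalized.

Lemma phi_gamn_comm a z : coprime a p ->
  gamn a (phi z - z) - (phi z - z) = phi (gamn a z - z) - (gamn a z - z).
Proof.
move=> ap; rewrite !rmorphB (gamn_phi ap) !opprB.
by move: (gamn a (phi z)) (gamn a z) (phi z) => u v w; ring.
Qed.

Lemma gamn_comm a a' z : coprime a p -> coprime a' p ->
  gamn a (gamn a' z) = gamn a' (gamn a z).
Proof.
move=> ap ap'; have [_ act] := ring_gam_action phi_gam.
by rewrite -!act ?Zpadic_nat_unit// mulrC.
Qed.

Let shift (S : comPzRingType) (u v u' v' w t w' t' : S) : w - t = w' - t' ->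
  u - v - (u' - v') = u - w - (v - t) - (u' - w' - (v' - t')).
Proof.
move=> e; have -> : u - w - (v - t) - (u' - w' - (v' - t')) =
  u - v - (u' - v') - ((w - t) - (w' - t')) by ring.
by rewrite e subrr subr0.
Qed.

Theorem key_lemma (x : R) (y : nat -> R) :
    coefs_in K x -> (forall a, coprime a p -> coefs_in K (y a)) ->
    (forall a, coprime a p -> coefs_in K' (gamn a x - x - (phi (y a) - y a))) ->
    (forall a a', coprime a p -> coprime a' p ->
      coefs_in K' (gamn a (y a') - y a' - (gamn a' (y a) - y a))) ->
  exists z, coefs_in K z /\ forall i, i != 0 -> K' (tcoef (x - (phi z - z)) i).
Proof.
move=> xK yK rel comm; have [z [zK zpos zp]] := normalize xK.
have bK : (pdvd p b `<=` K)%classic by move=> a /bK' /K'K.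
have phiK w : coefs_in K w -> coefs_in K (phi w).
  exact: (endo_coefs_in A_complete (ring_phi_continuous phi_gam) (ring_phi_linear phi_gam) hK bK).
have gamK a w : coprime a p -> coefs_in K w -> coefs_in K (gamn a w).
  by move=> ap; apply: (endo_coefs_in A_complete (gamn_continuous ap)
    (gamn_linear ap) hK bK).
have BK := coefs_inB A_complete hK.
exists z; split=> // i; case: (ltgtP i 0) => // i0 _; last exact: zpos.
have [n [n0 ->]] : exists n : nat, (0 < n)%N /\ i = - n%:Z by exists `|i|%N; lia.
have x'K : coefs_in K (x - (phi z - z)) by do 2?apply: (BK) => //; apply: phiK.
(* Replacing x by x - (phi(z) - z) and y_a by y_a - (gamma_a(z) - z) preserves both relations,
   because phi and the gamma_a commute. *)
apply: (polar_vanish (y := fun a => y a - (gamn a z - z)) x'K) => //.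
- by move=> a ap; do 2?apply: (BK) => //; [apply: yK | apply: gamK].
- move=> a ap; have := rel a ap; congr coefs_in.
  rewrite [gamn a (x - _)]rmorphB [phi (y a - _)]rmorphB.
  exact: shift (phi_gamn_comm z ap).
- move=> a a' ap ap'; have := comm a a' ap ap'; congr coefs_in.
  rewrite [gamn a (y a' - _)]rmorphB [gamn a' (y a - _)]rmorphB.
  apply: shift; rewrite !rmorphB (gamn_comm z ap ap').
  by move: (gamn a' (gamn a z)) (gamn a z) (gamn a' z) => u v w; ring.
Qed.

End KeyLemma.
(** * Rank one modules over a trivialized lattice *)

Local Notation cst := (aconst p A).

(** Let h' be h minus its constant term. If h' vanishes modulo K + p^j, then modulo K + p^(j+1) phi
    acts on it as T -> T^p. Coefficients at exponents prime to p then vanish, and one at pk reduces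
    to the one at k. *)
Lemma phi_fixed_const (K : set A) b h : is_ideal K -> (pdvd p b `<=` K)%classic ->
  coefs_in K (phi h - h) -> coefs_in K (h - cst (tcoef h 0)).
Proof.
move=> hK bK hh; set h' := h - _.
have hh' : coefs_in K (phi h' - h').
  suff -> : phi h' - h' = phi h - h by [].
  rewrite rmorphB (endo_aconst phi_lin).
  by rewrite /h'; move: (phi h) (cst _) => u v; ring.
have h'0 : tcoef h' 0 = 0 by rewrite tcoefB// tcoef_aconst// eqxx subrr.
(* The ideal K + p^j A: everything for j = 0, and K itself for j = b. *)
pose Kj j : set A := fun a => exists r, K (a - p%:R ^+ j * r).
have KjI j : is_ideal (Kj j).
  split.
  - by exists 0; rewrite mulr0 subr0; apply: ideal0.
  - move=> a a' [r hr] [r' hr']; exists (r + r').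
    by have := idealD hK hr hr'; congr K; ring.
  - by move=> a a' [r hr]; exists (a * r); have := ideal_mull hK a hr; congr K; ring.
have KKj j a : K a -> Kj j a by exists 0; rewrite mulr0 subr0.
have bKj j : (pdvd p b `<=` Kj j)%classic by move=> a /bK; apply: KKj.
suff main j : coefs_in (Kj j) h'.
  move=> i; have [r hr] := main b i.
  by rewrite -(subrK (p%:R ^+ b * r) (tcoef h' i)); apply: (idealD hK hr); apply: bK; exists r.
elim: j => [|j IH]; first by move=> i; exists (tcoef h' i); rewrite mul1r subrr; apply: ideal0.
have ph i : Kj j.+1 (p%:R * tcoef h' i).
  have [r hr] := IH i; exists r; have := ideal_mull hK p%:R hr.
  by rewrite mulrBr mulrA -exprS.
have B := fun i => KKj j.+1 _ (hh' i).
have dvd i : Kj j.+1 (tcoef h' i) -> Kj j.+1 (tcoef h' (p%:Z * i)).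
  have h1 := tcoef_phi (KjI j.+1) (bKj j.+1) ph i.
  have := B (p%:Z * i); rewrite tcoefB// => h2 h3.
  have h4 := ideal_trans (KjI _) (ideal_sym (KjI _) h2) h1.
  exact: (iffRL (ideal_congr (KjI _) h4)).
have ndvd k : ~~ (p%:Z %| k)%Z -> Kj j.+1 (tcoef h' k).
  move=> pk; have h1 := tcoef_phi_ndvd (KjI j.+1) (bKj j.+1) ph pk.
  have := B k; rewrite tcoefB// => /(ideal_sym (KjI _)) h2.
  exact: (iffRL (ideal_congr (KjI _) h2)).
move=> i; have [n hn] := ubnP `|i|%N; elim: n => // n IHn in i hn *.
have [/dvdzP[k ik]|] := boolP (p%:Z %| i)%Z; last exact: ndvd.
have [->|i0] := eqVneq i 0; first by rewrite h'0; apply: (ideal0 (KjI _)).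
rewrite ik mulrC; apply: dvd; apply: IHn.
have : (`|k| < `|i|)%N.
  rewrite ik abszM /= -{1}[`|k|%N]muln1 ltn_pmul2l ?prime_gt1// absz_gt0.
  by apply: contraNneq i0 => k0; rewrite ik k0 mul0r.
by move: hn; lia.
Qed.

(** The relations satisfied by the scalars u and g_a through which phi and the gamma_a act on a
    common eigenvector; that phi and Gamma commute gives [twist_rel], and that Gamma is commutative
    gives [twist_comm]. *)
Record twist (u : R) (g : nat -> R) : Prop := Twist {
  twist_unit : is_unit u;
  twist_gunit : forall a, coprime a p -> is_unit (g a);
  twist_rel : forall a, coprime a p -> phi (g a) * u = gamn a u * g a;
  twist_comm : forall a a', coprime a p -> coprime a' p ->
    g a * gamn a (g a') = g a' * gamn a' (g a)
}.

Lemma twist_basis_change u g f f' : twist u g -> f * f' = 1 ->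
  twist (u * phi f * f') (fun a => g a * gamn a f * f').
Proof.
move=> [uu gu rel comm] ff'.
have fu : is_unit f by exists f'.
have fu' : is_unit f' by exists f; rewrite mulrC.
split.
- by do 2!apply: is_unitM => //; apply: is_unit_rmorph.
- by move=> a ap; do 2!apply: is_unitM => //; [apply: gu | apply: is_unit_rmorph].
- move=> a ap; rewrite !rmorphM (gamn_phi ap).
  have pf : phi f * phi f' = 1 by rewrite -rmorphM ff' rmorph1.
  have gf : gamn a f * gamn a f' = 1 by rewrite -rmorphM ff' rmorph1.
  transitivity ((phi (g a) * u) * gamn a (phi f) * f' * (phi f * phi f')).
    by move: (phi _) (phi _) (phi _) (gamn a _) => *; ring.
  rewrite rel// pf mulr1.
  transitivity (gamn a u * g a * gamn a (phi f) * f' * (gamn a f * gamn a f')).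
    by rewrite gf mulr1.
  by move: (gamn a u) (gamn a f) (gamn a f') (gamn a _) => *; ring.
- move=> a a' ap ap'; rewrite !rmorphM (gamn_comm f ap ap').
  have gf : gamn a f * gamn a f' = 1 by rewrite -rmorphM ff' rmorph1.
  have gf' : gamn a' f * gamn a' f' = 1 by rewrite -rmorphM ff' rmorph1.
  transitivity (g a * gamn a (g a') * gamn a' (gamn a f) * f' * (gamn a f * gamn a f')).
    by move: (gamn a _) (gamn a _) (gamn a _) (gamn a' _) => *; ring.
  rewrite gf -gf' comm//.
  by move: (gamn a' _) (gamn a' _) (gamn a' _) (gamn a' _) => *; ring.
Qed.

(** After the change of eigenvector by f, phi acts through the constant c modulo K; the denominator
    f is cleared. *)
Definition near_const u (K : set A) f :=
  is_unit f /\ exists c, is_unit c /\ coefs_in K (u * phi f - cst c * f).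

Lemma is_unit_1B_coefs (K : set A) (z : R) :
  (K `<=` @pradical p A)%classic -> coefs_in K z -> is_unit (1 - z).
Proof.
move=> Kr zK; have hI := pradical_ideal p A.
apply: (unit_of_coefs A_complete) => [i i0|]; rewrite tcoefB// tcoef1//.
  by rewrite (_ : (i == 0) = false) ?sub0r; [apply: (idealN hI); apply: Kr | lia].
by rewrite eqxx; apply: (unit_1Dpradical sepA limA); apply: (idealN hI); apply: Kr.
Qed.

(** Write U = c(1 + X) and G_a = d_a + y_a with X and y_a in K; G_a is constant modulo K since phi
    fixes it there. Products in K vanish modulo K', so the twist relations become the additive
    hypotheses of [key_lemma] on X and y_a / d_a. *)
Lemma twist_step U G K K' b c : twist U G -> square_step p K K' ->
    (pdvd p b `<=` K')%classic -> is_unit c -> coefs_in K (U - cst c) ->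
  exists z, coefs_in K z /\ exists c1, is_unit c1 /\
    coefs_in K' (U * phi (1 - z) - cst c1 * (1 - z)).
Proof.
move=> [Uu Gu rel comm] [hK hK' K'K KK pK Kr] bK' [c' cc'] UK.
have bK : (pdvd p b `<=` K)%classic by move=> a /bK'/K'K.
have RK := coefs_in_ideal A_complete hK bK.
have RK' := coefs_in_ideal A_complete hK' bK'.
have RKK (v w : R) : coefs_in K v -> coefs_in K w -> coefs_in K' (v * w).
  exact: (coefs_in_prod A_complete hK' bK').
have phiK w : coefs_in K w -> coefs_in K (phi w).
  exact: (endo_coefs_in A_complete phi_cont phi_lin hK bK).
have gamK a w : coprime a p -> coefs_in K w -> coefs_in K (gamn a w).
  by move=> ap; apply: (endo_coefs_in A_complete (gamn_continuous ap)
    (gamn_linear ap) hK bK).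
have ccR : cst c * cst c' = 1 by rewrite -rmorphM cc' rmorph1.
pose X := cst c' * (U - cst c).
have XK : coefs_in K X by apply: (ideal_mull RK).
have UE : U = cst c * (1 + X).
  rewrite /X; transitivity (cst c * cst c' * (U - cst c) + cst c).
    by rewrite ccR mul1r subrK.
  by move: (cst c) (cst c') => v w; ring.
have relX a : coprime a p -> phi (G a) * (1 + X) = (1 + gamn a X) * G a.
  move=> ap; have := rel a ap; rewrite UE [gamn a _]rmorphM.
  rewrite (endo_aconst (gamn_linear ap)) [gamn a (1 + X)]rmorphD rmorph1 => e.
  transitivity ((cst c * cst c') * (phi (G a) * (1 + X))); first by rewrite ccR mul1r.
  transitivity (cst c' * (phi (G a) * (cst c * (1 + X)))).
    by move: (phi (G a)) (cst c) (cst c') => *; ring.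
  rewrite e; transitivity ((cst c * cst c') * ((1 + gamn a X) * G a)).
    by move: (gamn a X) (cst c) (cst c') => *; ring.
  by rewrite ccR mul1r.
have fixG a : coprime a p -> coefs_in K (phi (G a) - G a).
  move=> ap; have e := relX a ap.
  have -> : phi (G a) - G a = gamn a X * G a - phi (G a) * X.
    have -> : phi (G a) - G a = phi (G a) * (1 + X) - phi (G a) * X - G a by ring.
    by rewrite e; ring.
  by apply: (idealB RK); [apply: (ideal_mulr RK); apply: gamK | apply: (ideal_mull RK)].
pose d a := tcoef (G a) 0; pose y a := G a - cst (d a).
have yK a : coprime a p -> coefs_in K (y a).
  by move=> ap; apply: (phi_fixed_const hK bK); apply: fixG.
have dinv a : exists d', coprime a p -> K (d' * d a - 1).
  have [ap|nap] := boolP (coprime a p); last by exists 0.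
  have [G' GG'] := Gu a ap; exists (tcoef G' 0) => _.
  have := tcoefM_lead A_complete (x := G a) (y := G') (v := 0) (w := 0) hK bK.
  rewrite addr0 GG' tcoef1// eqxx => h.
  have {}h : K (1 - d a * tcoef G' 0).
    apply: h => i j _ i0; apply: (ideal_mulr hK).
    have := yK a ap i; rewrite tcoefB// tcoef_aconst//.
    by rewrite (negPf i0) subr0.
  by have := idealN hK h; congr K; ring.
have [d' hd'] := choice dinv.
pose Y a := cst (d' a) * y a.
have YK a : coprime a p -> coefs_in K (Y a).
  by move=> ap; apply: (ideal_mull RK); apply: yK.
have dd a (w : R) : coprime a p -> coefs_in K w ->
    coefs_in K' (cst (d' a) * (cst (d a) * w) - w).
  move=> ap wK; have -> : cst (d' a) * (cst (d a) * w) - w = cst (d' a * d a - 1) * w.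
    by rewrite rmorphB rmorphM rmorph1 mulrBl mul1r mulrA.
  by apply: RKK => //; apply: coefs_in_aconst => //; apply: hd'.
have GE a : G a = cst (d a) + y a by rewrite /y addrC subrK.
clearbody y.
have relY a : coprime a p -> coefs_in K' (gamn a X - X - (phi (Y a) - Y a)).
  move=> ap; have := relX a ap; rewrite GE rmorphD (endo_aconst phi_lin) => e.
  rewrite /Y phi_lin.
  have h1 : coefs_in K' (cst (d a) * (gamn a X - X) - (phi (y a) - y a)).
    have -> : cst (d a) * (gamn a X - X) - (phi (y a) - y a) =
        phi (y a) * X - gamn a X * y a.
      apply/eqP; rewrite -subr_eq0; apply/eqP.
      transitivity ((1 + gamn a X) * (cst (d a) + y a) - (cst (d a) + phi (y a)) * (1 + X)).
        by move: (gamn a X) (cst (d a)) (phi (y a)) (y a) => *; ring.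
      by rewrite e subrr.
    by apply: (idealB RK'); apply: RKK => //; [apply/phiK/yK | apply: gamK | apply: yK].
  have h2 := dd a _ ap (idealB RK (gamK a X ap XK) XK).
  have := idealB RK' (ideal_mull RK' (cst (d' a)) h1) h2.
  move: (gamn a X) (cst (d a)) (cst (d' a)) (phi (y a)) (y a) => gX v w t s.
  by congr coefs_in; ring.
have commY a a' : coprime a p -> coprime a' p ->
    coefs_in K' (gamn a (Y a') - Y a' - (gamn a' (Y a) - Y a)).
  move=> ap ap'; have := comm a a' ap ap'; rewrite !GE !rmorphD.
  rewrite (endo_aconst (gamn_linear ap)) (endo_aconst (gamn_linear ap')) => e.
  rewrite /Y (gamn_linear ap) (gamn_linear ap').
  have h1 : coefs_in K' (cst (d a) * (gamn a (y a') - y a') -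
      cst (d a') * (gamn a' (y a) - y a)).
    have -> : cst (d a) * (gamn a (y a') - y a') - cst (d a') * (gamn a' (y a) - y a) =
        y a' * gamn a' (y a) - y a * gamn a (y a').
      apply/eqP; rewrite -subr_eq0; apply/eqP.
      transitivity ((cst (d a) + y a) * (cst (d a') + gamn a (y a')) -
        (cst (d a') + y a') * (cst (d a) + gamn a' (y a))).
        move: (gamn a (y a')) (gamn a' (y a)) (cst (d a)) (cst (d a')) (y a) (y a') => *.
        by ring.
      by rewrite e subrr.
    by apply: (idealB RK'); apply: RKK => //; try apply: gamK => //; apply: yK.
  have k1 := dd a _ ap (idealB RK (gamK a _ ap (YK a' ap')) (YK a' ap')).
  have k2 := dd a' _ ap' (idealB RK (gamK a' _ ap' (YK a ap)) (YK a ap)).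
  have := idealB RK' (ideal_mull RK' (cst (d' a) * cst (d' a')) h1) (idealB RK' k1 k2).
  rewrite /Y (gamn_linear ap) (gamn_linear ap').
  move: (gamn a (y a')) (gamn a' (y a)) (cst (d a)) (cst (d a')) (cst (d' a)) (cst (d' a')).
  move: (y a) (y a') => w w' v1 v2 v3 v4 v5 v6.
  by congr coefs_in; ring.
have [z [zK hz]] := key_lemma hK hK' K'K pK bK' XK YK relY commY.
exists z; split=> //.
have zz : coefs_in K (phi z - z) by apply: (idealB RK) => //; apply: phiK.
set a0 := tcoef (X - (phi z - z)) 0.
have a0K : K a0 by apply: (idealB RK XK zz).
exists (c * (1 + a0)); split.
  apply: is_unitM; first by exists c'.
  by apply: (unit_1Dpradical sepA limA); apply: Kr.
have h1 : coefs_in K' (X - (phi z - z) - cst a0).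
  move=> i; rewrite tcoefB// tcoef_aconst//.
  by case: eqP => [->|/eqP /hz]; rewrite ?subrr ?subr0 //; apply: (ideal0 hK').
have h2 : coefs_in K' (- (X * phi z) + cst a0 * z).
  apply: (idealD RK'); first by apply: (idealN RK'); apply: RKK => //; apply: phiK.
  by apply: RKK => //; apply: coefs_in_aconst.
rewrite [phi (1 - z)]rmorphB rmorph1 [cst (c * _)]rmorphM [cst (1 + a0)]rmorphD rmorph1.
have -> : U * (1 - phi z) - cst c * (1 + cst a0) * (1 - z) =
    cst c * ((X - (phi z - z) - cst a0) + (- (X * phi z) + cst a0 * z)).
  by rewrite UE; move: (phi z) (cst c) (cst a0) => *; ring.
by apply: (ideal_mull RK'); apply: (idealD RK').
Qed.

Lemma near_const_step u g K K' b f : twist u g -> square_step p K K' ->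
    (pdvd p b `<=` K')%classic -> near_const u K f ->
  exists z, coefs_in K z /\ near_const u K' (f * (1 - z)).
Proof.
move=> tw st bK' [[f' ff'] [c [cu fK]]].
have [hK hK' K'K _ _ Kr] := st.
have bK : (pdvd p b `<=` K)%classic by move=> a /bK'/K'K.
have RK := coefs_in_ideal A_complete hK bK.
have RK' := coefs_in_ideal A_complete hK' bK'.
have tw' := twist_basis_change tw ff'.
have [|z [zK [c1 [c1u hz]]]] := twist_step tw' st bK' cu.
  have -> : u * phi f * f' - cst c = f' * (u * phi f - cst c * f) + (f * f' - 1) * cst c.
    by move: (phi f) (cst c) => v w; ring.
  by rewrite ff' subrr mul0r addr0; apply: (ideal_mull RK).
exists z; split=> //; split.
  by apply: is_unitM; [exists f' | apply: is_unit_1B_coefs zK].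
exists c1; split=> //; rewrite rmorphM.
have -> : u * (phi f * phi (1 - z)) - cst c1 * (f * (1 - z)) =
    f * (u * phi f * f' * phi (1 - z) - cst c1 * (1 - z)) +
    (1 - f * f') * (u * phi f * phi (1 - z)).
  by move: (phi f) (phi _) (cst _) => *; ring.
by rewrite ff' subrr mul0r addr0; apply: (ideal_mull RK').
Qed.

(** Modulo p and its polar coefficients u is a power series with unit constant term, and u phi(f) =
    c f can be solved there with f in 1 + T A[[T]]. *)
Lemma near_const_initial u : (forall i, i < 0 -> pradical p (tcoef u i)) ->
    is_unit (tcoef u 0) -> exists s, (forall g, g \in s -> pradical p g) /\
  exists f, near_const u (padic_gen p s) f.
Proof.
move=> uneg [c' cc']; set c := tcoef u 0 in cc' *.
have [N hN] := tcoef_bounded A_complete u 1.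
pose s := [seq tcoef u (- k.+1%:Z) | k <- iota 0 `|N|].
exists s; split; first by move=> _ /mapP[k _ ->]; apply: uneg; lia.
have sneg i : i < 0 -> padic_gen p s (tcoef u i).
  move=> i0; case: (ltP i N) => iN; first by apply: padic_gen_p; apply: hN.
  apply: padic_gen_mem; apply/mapP; exists (absz (i + 1)); first by rewrite mem_iota; lia.
  by congr tcoef; lia.
pose uc n := tcoef u n%:Z.
pose spread (f : nat -> A) n := if (p %| n)%N then f (n %/ p)%N else 0.
(* Modulo p the coefficient of phi(f) at n is that of f at n/p, so the equation at T^n determines
   f_n from earlier coefficients. *)
have [|f hf] := @strong_recursion A 0 (fun n f => if n == 0%N then 1 else
    c' * \sum_(j < n.+1) uc j * spread f (n - j)%N).
  move=> n g h gh; case: eqP => // /eqP n0; congr (_ * _); apply: eq_bigr => j _.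
  congr (_ * _); rewrite /spread; case: ifP => // _; apply: gh.
  apply: leq_ltn_trans (leq_div2r _ (leq_subr _ _)) _.
  by rewrite ltn_Pdiv ?prime_gt1// lt0n.
have f0 : f 0%N = 1 by rewrite hf.
exists (pseries f); split.
  have [|d hd] := @pseries_unit p A A_complete f; last by exists (pseries d).
  by rewrite f0; apply: is_unit1.
exists c; split; first by exists c'.
have hI := padic_gen_ideal p s.
have pI : (pdvd p 1 `<=` padic_gen p s)%classic by move=> a; apply: padic_gen_p.
have RI := coefs_in_ideal A_complete hI pI.
have h1 : coefs_in (padic_gen p s) (u - pseries uc).
  move=> [n|n]; rewrite tcoefB//.
    by rewrite tcoef_pseries// subrr; apply: (ideal0 hI).
  by rewrite tcoef_pseries_neg// subr0; apply: sneg.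
have h2 : coefs_in (padic_gen p s) (phi (pseries f) - pseries (spread f)).
  have pf i : pdvd p 1 (p%:R * tcoef (pseries f) i).
    by exists (tcoef (pseries f) i); rewrite expr1.
  move=> i; apply: pI; rewrite tcoefB//.
  have [/dvdzP[k ->]|pi] := boolP (p%:Z %| i)%Z; last first.
    have := tcoef_phi_ndvd (pdvd_ideal _ _ 1) (fun=> id) pf pi.
    rewrite (_ : tcoef (pseries (spread f)) i = 0) ?subr0//.
    case: i pi => n pn; last by rewrite tcoef_pseries_neg.
    by rewrite tcoef_pseries// /spread ifN.
  have := tcoef_phi (pdvd_ideal _ _ 1) (fun=> id) pf k.
  rewrite [k * _]mulrC; congr (pdvd p 1 (_ - _)).
  case: k => n; last first.
    by rewrite !tcoef_pseries_neg//; have := prime_gt0 p_pr; lia.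
  by rewrite -PoszM !tcoef_pseries// /spread dvdn_mulr// mulKn// prime_gt0.
have h3 : pseries uc * pseries (spread f) = cst c * pseries f.
  apply: (tcoef_ext A_complete) => -[n|n]; rewrite tcoef_aconstM//; last first.
    by rewrite tcoef_pseriesM_neg// tcoef_pseries_neg// mulr0.
  rewrite tcoef_pseriesM// tcoef_pseries//.
  case: n => [|n]; first by rewrite big_ord1 subn0 /spread dvdn0 div0n.
  by rewrite (hf n.+1) /= mulrA cc' mul1r.
rewrite -h3.
exact: (ideal_mulB RI).
Qed.

(** The nilpotent chain reaches the modulus p. From there each step multiplies f by some 1 - z with
    z divisible by p^(n+1), so the successive f converge, and the quotient u phi(l)/l of the limit
    is constant modulo every p^n. *)
Theorem twist_trivial u g : twist u g ->
    (forall i, i < 0 -> pradical p (tcoef u i)) -> is_unit (tcoef u 0) ->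
  exists f c, [/\ is_unit f, is_unit c & u * phi f = cst c * f].
Proof.
move=> tw uneg u0; have [s [hs hfs]] := near_const_initial uneg u0.
have [f1 hf1] : exists f, near_const u (pdvd p 1) f.
  apply: (nilpotent_chain (Q := fun K => exists f, near_const u K f) _ hs hfs).
  move=> K K' st pK' [f hf].
  by have [z [_ hz]] := near_const_step tw st pK' hf; exists (f * (1 - z)).
have next (nf : nat * R) : exists f', near_const u (pdvd p nf.1.+1) nf.2 ->
    near_const u (pdvd p nf.1.+2) f' /\ pdvd p nf.1.+1 (f' - nf.2).
  have [h|h] := pselect (near_const u (pdvd p nf.1.+1) nf.2); last by exists 0.
  have [z [zK hz]] := near_const_step tw (power_step p A nf.1) (fun=> id) h.
  exists (nf.2 * (1 - z)) => _; split=> //.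
  have -> : nf.2 * (1 - z) - nf.2 = - nf.2 * z by ring.
  by apply: pdvdMl; apply/coefs_in_pdvdE.
have [F hF] := choice next.
pose f := fix f n := if n is m.+1 then F (m, f m) else f1.
have fP n : near_const u (pdvd p n.+1) (f n).
  by elim: n => //= n IH; have [] := hF (n, f n) IH.
have [n|l hl] := @R_limits p A f.
  by have [_] := hF (n, f n) (fP n); apply: pdvd_le.
have lu : is_unit l.
  have [[f1' e1] _] := fP 1%N.
  apply: (unit_modp (@R_separated p A) (@R_limits p A) (y := f1')).
  by rewrite -e1 -mulrBl; apply: pdvdMr.
have [l' ll'] := lu.
pose D := u * phi l * l'.
have DE : D = cst (tcoef D 0).
  apply: (tcoef_ext A_complete) => i; rewrite tcoef_aconst//; case: eqP => [->//|i0].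
  apply: sepA => n; have [_ [cn [_ hc]]] := fP n.
  have h : pdvd p n (D - cst cn).
    have -> : D - cst cn = l' * ((u * phi (f n) - cst cn * f n) +
        (u * (phi l - phi (f n)) - cst cn * (l - f n))) + (l * l' - 1) * cst cn.
      by rewrite /D; move: (phi l) (phi (f n)) (cst cn) => *; ring.
    rewrite ll' subrr mul0r addr0; apply: pdvdMl; apply: pdvdD.
      by apply: (pdvd_le (leqnSn n)); apply/coefs_in_pdvdE.
    apply: pdvdB; apply: pdvdMl => //.
    by rewrite -rmorphB; apply: endo_pdvd.
  have := tcoef_modp A_complete i h.
  by rewrite tcoef_aconst//; case: eqP => //; rewrite subr0.
have lE : u * phi l = cst (tcoef D 0) * l.
  rewrite -DE /D; transitivity (l * l' * (u * phi l)); first by rewrite ll' mul1r.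
  by move: (phi l) => v; ring.
exists l, (tcoef D 0); split=> //.
have [D' DD'] : is_unit D.
  apply: is_unitM; last by exists l; rewrite mulrC.
  by apply: is_unitM; [apply: twist_unit tw | apply: is_unit_rmorph].
have e := tcoef1 A_complete 0; rewrite -DD' {1}DE tcoef_aconstM// in e.
by exists (tcoef D' 0).
Qed.

End Action.

(** * Projective modules of rank one *)

Section RankOne.
Variables (S : comPzRingType) (V : lmodType S).

Definition functional (f : V -> S) := forall a v w, f (a *: v + w) = a * f v + f w.

Definition dual_basis n (m : 'I_n -> V) (f : 'I_n -> V -> S) :=
  (forall j, functional (f j)) /\ forall v, v = \sum_j f j v *: m j.

(** Vanishing of the second exterior power, tested on functionals. It replaces the choice of local
    bases in all later computations. *)
Definition rank_one := forall f g v w, functional f -> functional g ->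
  f v * g w = f w * g v.

Section Functional.
Variables (f : V -> S) (hf : functional f).

Lemma functional0 : f 0 = 0.
Proof.
by apply: (addIr (f 0)); have := hf 1 0 0; rewrite scaler0 mul1r !addr0 add0r => <-.
Qed.

Lemma functionalD v w : f (v + w) = f v + f w.
Proof. by have := hf 1 v w; rewrite scale1r mul1r. Qed.

Lemma functionalZ a v : f (a *: v) = a * f v.
Proof. by have := hf a v 0; rewrite !addr0 functional0 addr0. Qed.

Lemma functional_sum J (r : seq J) (P : pred J) (c : J -> S) (v : J -> V) :
  f (\sum_(j <- r | P j) c j *: v j) = \sum_(j <- r | P j) c j * f (v j).
Proof.
rewrite (big_morph f functionalD functional0).
by apply: eq_bigr => j _; rewrite functionalZ.
Qed.

Lemma functional_scale a : functional (fun v => a * f v).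
Proof. by move=> b v w; rewrite hf; ring. Qed.

End Functional.

Lemma functional_lincomb J (r : seq J) (c : J -> S) (f : J -> V -> S) :
  (forall j, functional (f j)) -> functional (fun v => \sum_(j <- r) c j * f j v).
Proof.
move=> hf a v w; rewrite mulr_sumr -big_split; apply: eq_bigr => j _ /=.
by rewrite hf; ring.
Qed.

Lemma finite_projective_dual_basis : finite_projective V ->
  exists n (m : 'I_n -> V) f, dual_basis m f.
Proof.
move=> [n [i [r ri]]]; exists n, (fun j => r (delta_mx 0 j)), (fun j v => i v 0 j).
split=> [j a v w|v]; first by rewrite linearP !mxE.
rewrite -{1}(ri v) {1}(row_sum_delta (i v)) linear_sum.
by apply: eq_bigr => j _; rewrite linearZ.
Qed.

(** At each prime v and w are multiples of one vector up to denominators, so the annihilator of the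
    difference of the two sides lies in no prime. *)
Lemma constant_rank_one : constant_rank V 1 -> rank_one.
Proof.
move=> rk f g v w hf hg; set x := f v * g w; set y := f w * g v.
apply/eqP; rewrite -subr_eq0; apply/eqP.
pose ann : set S := fun a => a * (x - y) = 0.
have hann : is_ideal ann.
  split; rewrite /ann; first by rewrite mul0r.
  - by move=> a b ha hb; rewrite mulrDl ha hb addr0.
  - by move=> a b hb; rewrite -mulrA hb mulr0.
suff: ann 1 by rewrite /ann mul1r.
apply: (ideal_whole hann) => P pP annP.
have [e [span _]] := rk P pP; have [_ _ _ _ PP] := pP.
have [s [c [Ps sv]]] := span v; have [t [d [Pt tw]]] := span w.
rewrite !big_ord1 in sv tw.
have : P (s * t).
  apply: annP; rewrite /ann.
  transitivity ((s * f v) * (t * g w) - (t * f w) * (s * g v)); first by rewrite /x /y; ring.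
  rewrite -!(functionalZ hf) -!(functionalZ hg) sv tw !functionalZ//.
  by ring.
by move=> /PP[].
Qed.

Section DualBasis.
Variables (n : nat) (m : 'I_n -> V) (f : 'I_n -> V -> S).
Hypotheses (mf : dual_basis m f) (r1 : rank_one).
Let ff := mf.1.
Let mfE := mf.2.

Lemma functional_dual_basis g v : functional g -> g v = \sum_j f j v * g (m j).
Proof. by move=> hg; rewrite {1}(mfE v) functional_sum. Qed.

Lemma functional_separate v w : (forall j, f j v = f j w) -> v = w.
Proof. by move=> h; rewrite (mfE v) (mfE w); apply: eq_bigr => j _; rewrite h. Qed.

Lemma functional_trace (v : V) : (\sum_j f j (m j)) *: v = v.
Proof.
apply: functional_separate => k; rewrite functionalZ// mulr_suml.
rewrite [RHS](functional_dual_basis _ (ff k)); apply: eq_bigr => j _.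
by rewrite (r1 (m j) v (ff j) (ff k)).
Qed.

(** The trace acts as the identity on V by [functional_trace]. The predicate [rank_one] alone also
    admits V = 0; constant rank 1 makes V faithful. *)
Lemma trace_one : constant_rank V 1 -> \sum_j f j (m j) = 1.
Proof.
move=> rk; set t := \sum_j _; apply/eqP; rewrite eq_sym -subr_eq0; apply/eqP.
pose ann : set S := fun a => a * (1 - t) = 0.
have hann : is_ideal ann.
  split; rewrite /ann; first by rewrite mul0r.
  - by move=> a b ha hb; rewrite mulrDl ha hb addr0.
  - by move=> a b hb; rewrite -mulrA hb mulr0.
suff: ann 1 by rewrite /ann mul1r.
apply: (ideal_whole hann) => P pP annP.
have [e [_ indep]] := rk P pP.
have [|s [Ps /(_ ord0) hs]] := indep (fun=> 1 - t).
  by rewrite big_ord1 scalerBl scale1r functional_trace subrr.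
by apply: Ps; apply: annP.
Qed.

(** Exchanging arguments by [rank_one] turns f_k(h(v)) into f_k(v) times the trace of h. *)
Lemma rank_one_scalar (h : V -> V) : (forall a v w, h (a *: v + w) = a *: h v + h w) ->
  forall v, h v = (\sum_j f j (h (m j))) *: v.
Proof.
move=> hL v; have hg k : functional (f k \o h) by move=> a w w' /=; rewrite hL ff.
apply: functional_separate => k; rewrite functionalZ// mulr_suml.
rewrite [LHS](functional_dual_basis v (hg k)) /=; apply: eq_bigr => j _.
by rewrite (r1 (h (m j)) v (ff j) (ff k)).
Qed.

Section Semilinear.
Variables (sg : {rmorphism S -> S}) (h : V -> V).
Hypothesis hL : forall a v w, h (a *: v + w) = sg a *: h v + h w.

Lemma semilinear0 : h 0 = 0.
Proof.
by apply: (addIr (h 0)); have := hL 1 0 0; rewrite rmorph1 !scale1r !addr0 add0r => <-.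
Qed.

Lemma semilinearD v w : h (v + w) = h v + h w.
Proof. by have := hL 1 v w; rewrite rmorph1 !scale1r. Qed.

Lemma semilinearZ a v : h (a *: v) = sg a *: h v.
Proof. by have := hL a v 0; rewrite semilinear0 !addr0. Qed.

Lemma semilinear_sum J (r : seq J) (P : pred J) (c : J -> S) (v : J -> V) :
  h (\sum_(j <- r | P j) c j *: v j) = \sum_(j <- r | P j) sg (c j) *: h (v j).
Proof.
rewrite (big_morph h semilinearD semilinear0).
by apply: eq_bigr => j _; rewrite semilinearZ.
Qed.

(** The ratio of e(h(v)) to sg(g(v)) does not depend on v, as on a line; this stands in for the
    matrix of h when V has no basis. *)
Lemma semilinear_rank_one e g v w : functional e -> functional g ->
  sg (g w) * e (h v) = sg (g v) * e (h w).
Proof.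
move=> he hg; rewrite (mfE v) (mfE w) !semilinear_sum !functional_sum// !mulr_sumr.
have key v' w' : \sum_j sg (\sum_i f i w' * g (m i)) * (sg (f j v') * e (h (m j))) =
    \sum_j sg (g w' * f j v') * e (h (m j)).
  by apply: eq_bigr => j _; rewrite -functional_dual_basis// rmorphM mulrA.
rewrite !key; apply: eq_bigr => j _.
by rewrite (r1 v w hg (ff j)).
Qed.

End Semilinear.
End DualBasis.
End RankOne.

(** * Orders of vanishing at the primes above p *)

Section Orders.
Variables (p : nat) (p_pr : prime p) (A : comPzRingType).
Hypothesis A_complete : padically_complete p A.
Local Notation R := (AQp p A).
Local Notation tpow := (tpow p A).
Variable P : set A.
Hypotheses (pP : prime_ideal P) (Pp : P p%:R).
Implicit Types x y : R.

Let PI := prime_is_ideal pP.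
Let P1 : ~ P 1. Proof. by case: pP. Qed.
Let PM a b : P (a * b) -> P a \/ P b. Proof. by case: pP => _ _ _ _; apply. Qed.

Lemma pdvd_prime : (pdvd p 1 `<=` P)%classic.
Proof. by move=> a [b ->]; rewrite expr1; apply: (ideal_mulr PI). Qed.
Let bP := pdvd_prime.

(** A lower bound for the order in T of the image of x in (A/P)((T)). *)
Definition ord_ge x (w : int) := forall i, i < w -> P (tcoef x i).
Definition ord_eq x (w : int) := ord_ge x w /\ ~ P (tcoef x w).

Lemma ord_ge_le x v w : v <= w -> ord_ge x w -> ord_ge x v.
Proof. by move=> vw h i iv; apply: h; lia. Qed.

Lemma ord_eq_le x v w : ord_ge x v -> ord_eq x w -> v <= w.
Proof. by move=> h [_ xw]; rewrite leNgt; apply/negP => /h. Qed.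

Lemma ord_geD x y w : ord_ge x w -> ord_ge y w -> ord_ge (x + y) w.
Proof. by move=> hx hy i iw; rewrite tcoefD//; apply: (idealD PI); [apply: hx | apply: hy]. Qed.

Lemma ord_ge_sum J (r : seq J) (F : J -> R) w :
  (forall j, ord_ge (F j) w) -> ord_ge (\sum_(j <- r) F j) w.
Proof.
move=> h; elim/big_ind: _ => [i _|x y hx hy|j _]; last exact: h.
  by rewrite tcoef0//; apply: (ideal0 PI).
exact: ord_geD.
Qed.

Lemma ord_geM x y v w : ord_ge x v -> ord_ge y w -> ord_ge (x * y) (v + w).
Proof.
move=> hx hy i ivw; apply: (tcoefM_ideal A_complete PI bP) => j k jk.
case: (ltP j v) => jv; first by apply: (ideal_mulr PI); apply: hx.
by apply: (ideal_mull PI); apply: hy; lia.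
Qed.

Lemma tcoefM_ord x y v w : ord_ge x v -> ord_ge y w ->
  P (tcoef (x * y) (v + w) - tcoef x v * tcoef y w).
Proof.
move=> hx hy; apply: (tcoefM_lead A_complete PI bP) => j k jk jv.
case: (ltP j v) => jv'; first by apply: (ideal_mulr PI); apply: hx.
by apply: (ideal_mull PI); apply: hy; move/eqP: jv; lia.
Qed.

Lemma ord_eqM x y v w : ord_eq x v -> ord_eq y w -> ord_eq (x * y) (v + w).
Proof.
move=> [hx xv] [hy yw]; split; first exact: ord_geM.
have e := ideal_congr PI (tcoefM_ord hx hy).
by move=> /e /PM[].
Qed.

Lemma ord_tpow i : ord_eq (tpow i) i.
Proof.
split=> [j ji|]; rewrite tcoef_tpow//; last by rewrite eqxx.
by rewrite (_ : (j == i) = false); [apply: (ideal0 PI) | apply/eqP; lia].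
Qed.

Lemma ord_eq1 : ord_eq 1 0.
Proof. by rewrite -tpow0; apply: ord_tpow. Qed.

Lemma ord_ge_pdvd x y w : pdvd p 1 (x - y) -> ord_ge x w -> ord_ge y w.
Proof.
move=> h hx i iw; have e := ideal_congr PI (bP (tcoef_modp A_complete i h)).
by apply/e; apply: hx.
Qed.

Lemma family_order n (x : 'I_n -> R) : (forall j, coefs_in P (x j)) \/
  exists j w, ord_eq (x j) w /\ forall k, ord_ge (x k) w.
Proof.
have [h|/existsNP[j0 /existsNP[i0 hi0]]] := pselect (forall j, coefs_in P (x j)); first by left.
right; have [N hN] : exists N : int, forall k, ord_ge (x k) N.
  have [N hN] := choice (fun k => tcoef_bounded A_complete (x k) 1).
  exists (- \sum_k `|N k|%N%:Z) => k i ik; apply: bP; apply: (hN k).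
  have : `|N k|%N%:Z <= \sum_k `|N k|%N%:Z.
    by rewrite (bigD1 k) //= lerDl; apply: sumr_ge0.
  by move: ik; lia.
pose bad (t : nat) := `[< exists k, ~ P (tcoef (x k) (N + t%:Z)) >].
have badn : exists t, bad t.
  exists (absz (i0 - N)); apply/asboolP; exists j0.
  suff -> : N + (absz (i0 - N))%:Z = i0 by [].
  by case: (ltP i0 N) => [/hN //|]; lia.
case: (ex_minnP badn) => t /asboolP[k hk] tmin.
exists k, (N + t%:Z); rewrite /ord_eq.
have low l : ord_ge (x l) (N + t%:Z).
  move=> i it; case: (ltP i N) => iN; first exact: (hN l).
  apply: contrapT => hi; have /tmin : bad (absz (i - N)).
    apply/asboolP; exists l; suff -> : N + (absz (i - N))%:Z = i by [].
    by lia.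
  by lia.
by split=> //; split.
Qed.

Lemma ord_cases x : coefs_in P x \/ exists w, ord_eq x w.
Proof.
have [h|[j [w [h _]]]] := @family_order 1 (fun=> x); first by left; apply: (h ord0).
by right; exists w.
Qed.

Lemma ord_ge_cancel a x e w : ord_eq a e -> ord_ge (a * x) (e + w) -> ord_ge x w.
Proof.
move=> ae h; have [xP|[v xv]] := ord_cases x; first by move=> i _; apply: xP.
apply: (ord_ge_le _ xv.1); have := ord_eq_le h (ord_eqM ae xv); lia.
Qed.

Lemma ord_eq_unique x v w : ord_eq x v -> ord_eq x w -> v = w.
Proof.
move=> xv xw; apply/le_anti; apply/andP.
by split; [apply: (ord_eq_le xv.1 xw) | apply: (ord_eq_le xw.1 xv)].
Qed.

Lemma ord_eq_cancel a x e w : ord_eq a e -> ord_eq (a * x) (e + w) -> ord_eq x w.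
Proof.
move=> ae h; have [xP|[v xv]] := ord_cases x.
  have RI := coefs_in_ideal A_complete PI bP.
  by have := ideal_mull RI a xP (e + w); case: h.
by have := ord_eq_unique h (ord_eqM ae xv) => /addrI ->.
Qed.

Lemma nat_in_prime (k : nat) : P k%:R -> (p %| k)%N.
Proof.
move=> Pk; apply/negPn/negP => pk; apply: P1.
have ck : coprime k p by rewrite coprime_sym prime_coprime.
have [m hm] := nat_inverse_mod p_pr ck.
have := divn_eq (m * k)%N p; rewrite hm modn_small ?prime_gt1// => e.
have -> : 1 = m%:R * k%:R - (m * k %/ p)%:R * p%:R :> A.
  by rewrite -!natrM {1}e natrD; ring.
by apply: (idealB PI); apply: (ideal_mull PI).
Qed.

End Orders.

Lemma exp_congruence p i j : prime p ->
  (forall a, coprime a p -> a ^ i = a ^ j %[mod p]) -> exists k : int, i%:Z - j%:Z = p.-1%:Z * k.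
Proof.
move=> p_pr; wlog ij : i j / (i <= j)%N => [hw|] h.
  case: (leqP i j) => ij; first exact: hw.
  have [|k hk] := hw j i (ltnW ij); first by move=> a ap; rewrite h.
  by exists (- k); rewrite mulrN -hk opprB.
have /dvdnP[k hk] : (p.-1 %| j - i)%N.
  apply: exp_all_one => // a ap.
  have e : a ^ i = a ^ i * a ^ (j - i) %[mod p] by rewrite -expnD subnKC// h.
  have a0 : (0 < a ^ (j - i))%N.
    by rewrite expn_gt0; case: a ap {h e} => //; rewrite /coprime gcd0n => /eqP p1;
      move: p_pr; rewrite p1.
  have : (p %| a ^ i * (a ^ (j - i) - 1))%N.
    rewrite mulnBr muln1 -eqn_mod_dvd; first by apply/eqP.
    by rewrite leq_pmulr.
  rewrite Gauss_dvdr; last by rewrite coprime_sym; apply: coprimeXl.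
  by move=> h2; apply/eqP; rewrite eqn_mod_dvd.
exists (- k%:Z); have -> : j = (i + k * p.-1)%N by lia.
by rewrite PoszD PoszM; ring.
Qed.

Section Normalization.
Variables (p : nat) (p_pr : prime p) (A : comPzRingType).
Variable sA : {rmorphism Zpadic p_pr -> A}.
Hypothesis A_complete : padically_complete p A.
Local Notation R := (AQp p A).
Local Notation tpow := (tpow p A).
Variables (phi : {rmorphism R -> R}) (gam : Zpadic p_pr -> {rmorphism R -> R}).
Hypothesis phi_gam : phiGamma_ring sA phi gam.
Local Notation gamn := (gamn gam).
Implicit Types x y : R.

Let p0 := prime_gt0 p_pr.

Fixpoint phin (n : nat) : {rmorphism R -> R} :=
  if n is k.+1 then (phi \o phin k)%FUN : {rmorphism R -> R} else idfun.

Lemma phinS n x : phin n.+1 x = phi (phin n x). Proof. by []. Qed.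

Lemma tcoef_phin n x i :
  pdvd p 1 (tcoef (phin n x) ((p ^ n)%N%:Z * i) - tcoef x i).
Proof.
have px y j : pdvd p 1 (p%:R * tcoef y j) by exists (tcoef y j); rewrite expr1.
elim: n i => [|n IH] i; first by rewrite mul1r subrr; apply: pdvd0.
have h := tcoef_phi A_complete phi_gam (pdvd_ideal p A 1) (fun=> id) (px (phin n x)).
by rewrite expnS PoszM -mulrA; apply: (ideal_trans (pdvd_ideal _ _ 1) (h _) (IH i)).
Qed.

Lemma tcoef_phin_ndvd n x k : ~~ ((p ^ n)%N%:Z %| k)%Z -> pdvd p 1 (tcoef (phin n x) k).
Proof.
have px y j : pdvd p 1 (p%:R * tcoef y j) by exists (tcoef y j); rewrite expr1.
elim: n k => [|n IH] k; first by rewrite dvd1z.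
rewrite expnS PoszM => pk; rewrite phinS.
have [/dvdzP[i ki]|pi] := boolP (p%:Z %| k)%Z; last first.
  exact: (tcoef_phi_ndvd A_complete phi_gam (pdvd_ideal _ _ 1) (fun=> id) (px _) pi).
have h := tcoef_phi A_complete phi_gam (pdvd_ideal p A 1) (fun=> id) (px (phin n x)) i.
rewrite ki [i * _]mulrC; apply/(ideal_congr (pdvd_ideal _ _ 1) h); apply: IH.
apply: contra pk => /dvdzP[j ij]; rewrite ki ij; apply/dvdzP; exists j; ring.
Qed.

Section AtPrime.
Variable P : set A.
Hypotheses (pP : prime_ideal P) (Pp : P p%:R).
Let PI := prime_is_ideal pP.
Let bP := pdvd_prime pP Pp.

Lemma ord_ge_phin n x w : ord_ge P x w -> ord_ge P (phin n x) ((p ^ n)%N%:Z * w).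
Proof.
have q0 : (0 < p ^ n)%N by rewrite expn_gt0 p0.
move=> hx k kw; have [/dvdzP[i ki]|pk] := boolP ((p ^ n)%N%:Z %| k)%Z; last first.
  by apply: bP; apply: tcoef_phin_ndvd.
rewrite ki [i * _]mulrC; apply/(ideal_congr PI (bP (tcoef_phin n x i))); apply: hx.
by move: kw; rewrite ki [i * _]mulrC ltr_pM2l.
Qed.

Lemma ord_eq_phin n x w : ord_eq P x w -> ord_eq P (phin n x) ((p ^ n)%N%:Z * w).
Proof.
move=> [hx xw]; split; first exact: ord_ge_phin.
by move/(ideal_congr PI (bP (tcoef_phin n x w))).
Qed.

Lemma ord_eq_phi x w : ord_eq P x w -> ord_eq P (phi x) (p%:Z * w).
Proof. by have := @ord_eq_phin 1 x w; rewrite expn1. Qed.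

Lemma tcoef_gam_ord a x (w : nat) : coprime a p -> ord_ge P x w ->
  P (tcoef (gamn a x) w - a%:R ^+ w * tcoef x w).
Proof.
move=> ap hx; have [_ h] := gam_leading A_complete phi_gam ap PI bP hx.
by rewrite (tcoef_gam_nat A_complete phi_gam ap) mulrC in h.
Qed.

Lemma ord_ge_gam a x (w : int) : coprime a p -> ord_ge P x w -> ord_ge P (gamn a x) w.
Proof. by move=> ap hx; have [] := gam_leading A_complete phi_gam ap PI bP hx. Qed.

Lemma nat_notin_prime a w : coprime a p -> ~ P (a%:R ^+ w).
Proof.
move=> ap; apply: (unit_notin_prime pP).
have [b hb] := natr_unit_complete p_pr (padically_complete_separated A_complete)
  (padically_complete_limits A_complete) ap.
by exists (b ^+ w); rewrite -exprMn hb expr1n.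
Qed.

Lemma ord_eq_gam a x (w : nat) : coprime a p -> ord_eq P x w -> ord_eq P (gamn a x) w.
Proof.
move=> ap [hx xw]; split; first exact: ord_ge_gam.
have [_ _ _ _ PM] := pP.
by move/(ideal_congr PI (tcoef_gam_ord ap hx)) => /PM[] //; apply: nat_notin_prime.
Qed.

End AtPrime.
Variable M : phiGamma_data p_pr A.
Hypothesis M_etale : etale_phiGamma_module phi gam M.
Variables (n : nat) (m : 'I_n -> M) (f : 'I_n -> M -> R).
Hypotheses (mf : dual_basis m f) (r1 : rank_one M) (tr1 : \sum_j f j (m j) = 1).

Let p1 := prime_gt1 p_pr.
Local Notation phiM := (@pg_phi _ _ _ M).
Local Notation gamM a := (@pg_gam _ _ _ M a%:R).

Lemma phiM_semilinear a v w : phiM (a *: v + w) = phi a *: phiM v + phiM w.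
Proof. exact: (pg_phi_semilinear M_etale). Qed.

Lemma gamM_semilinear k : coprime k p ->
  forall a v w, gamM k (a *: v + w) = gamn k a *: gamM k v + gamM k w.
Proof. by move=> kp a v w; apply: (pg_gam_semilinear M_etale); apply: Zpadic_nat_unit. Qed.

Lemma etale_span v : exists r, v = \sum_k r k *: phiM (m k).
Proof.
have [g _ gK] := pg_etale M_etale.
have [s hs] : exists s : seq (R * M), v = \sum_(x <- s) x.1 *: phiM x.2.
  by exists (repr (g v)); rewrite -[LHS]gK.
exists (fun k => \sum_(x <- s) x.1 * phi (f k x.2)).
rewrite hs; under [RHS]eq_bigr do rewrite scaler_suml.
rewrite exchange_big; apply: eq_bigr => x _ /=.
rewrite {1}(mf.2 x.2) (semilinear_sum phiM_semilinear) scaler_sumr.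
by apply: eq_bigr => k _; rewrite scalerA.
Qed.

Definition phiMn N (v : M) : M := iter N phiM v.

Lemma phiMn_semilinear N a v w :
  phiMn N (a *: v + w) = phin N a *: phiMn N v + phiMn N w.
Proof. by elim: N => //= N IH; rewrite IH phiM_semilinear. Qed.

Lemma etale_span_iter N v : exists r, v = \sum_k r k *: phiMn N (m k).
Proof.
elim: N v => [|N IH] v; first by exists (f^~ v); apply: mf.2.
have [r hr] := etale_span v; have [s hs] := choice (fun k => IH (m k)).
exists (fun l => \sum_k r k * phi (s k l)).
rewrite hr; under [RHS]eq_bigr do rewrite scaler_suml.
rewrite exchange_big; apply: eq_bigr => k _ /=.
rewrite {1}(hs k) (semilinear_sum phiM_semilinear) scaler_sumr.
by apply: eq_bigr => l _; rewrite scalerA.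
Qed.

(* One point suffices: the order of [e0] is then multiplied by p under phi everywhere. *)
Record normalized (P : set A) (e0 : M -> R) : Prop := Normalized {
  norm_functional : functional e0;
  norm_point : exists v w, ord_eq P (e0 v) w /\ ord_eq P (e0 (phiM v)) (p%:Z * w)
}.

Section AtPrime.
Variable P : set A.
Hypotheses (pP : prime_ideal P) (Pp : P p%:R).
Let PI := prime_is_ideal pP.
Let bP := pdvd_prime pP Pp.
Let RI := coefs_in_ideal A_complete PI bP.
Local Notation ord_ge := (ord_ge P).
Local Notation ord_eq := (ord_eq P).

Let oM {x y v w} := @ord_eqM p p_pr A A_complete P pP Pp x y v w.
Let gM {x y v w} := @ord_geM p p_pr A A_complete P pP Pp x y v w.
Let ocancel {a x e w} := @ord_eq_cancel p p_pr A A_complete P pP Pp a x e w.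
Let gcancel {a x e w} := @ord_ge_cancel p p_pr A A_complete P pP Pp a x e w.
Let ocases := @ord_cases p p_pr A A_complete P pP Pp.

Lemma coefs_in_cancel (x y : R) w : ord_eq x w -> coefs_in P (x * y) -> coefs_in P y.
Proof.
move=> hx hxy; have [//|[v hy]] := ocases y.
by have [_] := oM hx hy; case; apply: hxy.
Qed.

Lemma natB_in_prime (u v : nat) : P (u%:R - v%:R) -> u = v %[mod p].
Proof.
wlog uv : u v / (v <= u)%N => [hw h|].
  case: (leqP v u) => uv; first exact: hw.
  by apply/esym; apply: hw; [apply: ltnW | apply: (ideal_sym PI)].
rewrite -natrB// => /(nat_in_prime p_pr pP Pp) h.
by apply/eqP; rewrite eqn_mod_dvd.
Qed.

(** If e(h(v)) vanished at P, then by [semilinear_rank_one] e would vanish on the whole image of h,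
    hence on v, which lies in its span. *)
Lemma semilinear_nonzero (sg : {rmorphism R -> R}) (h : M -> M) e v w w' :
    (forall a v w, h (a *: v + w) = sg a *: h v + h w) -> functional e ->
    (exists s : seq (R * M), v = \sum_(x <- s) x.1 *: h x.2) ->
    ord_eq (e v) w -> ord_eq (sg (e v)) w' -> exists b, ord_eq (e (h v)) b.
Proof.
move=> hL he [s hs] ev sev; have [hP|//] := ocases (e (h v)).
have all u : coefs_in P (e (h u)).
  apply: (coefs_in_cancel sev).
  rewrite (semilinear_rank_one mf r1 hL u v he he).
  exact: (ideal_mull RI).
case: ev => _; case; rewrite hs functional_sum//.
by apply: (ideal_sum RI) => x _; apply: (ideal_mull RI).
Qed.

Lemma tcoefM3_ord (x y z : R) u v w : ord_ge x u -> ord_ge y v -> ord_ge z w ->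
  P (tcoef (x * y * z) (u + v + w) - tcoef x u * tcoef y v * tcoef z w).
Proof.
move=> hx hy hz.
have h1 := tcoefM_ord p_pr A_complete pP Pp (gM hx hy) hz.
have h2 := tcoefM_ord p_pr A_complete pP Pp hx hy.
by apply: (ideal_trans PI h1); rewrite -mulrBl; apply: (ideal_mulr PI).
Qed.

(* Comparing leading coefficients in [phi gam = gam phi] shows that the order of the
   Frobenius on M is divisible by p - 1, so it can be normalized away. *)
Lemma exists_normalized : exists e0, normalized P e0.
Proof.
have [j hj] : exists j, ~ coefs_in P (f j (m j)).
  apply: contrapT => /forallNP h.
  have : coefs_in P (1 : R).
    by rewrite -tr1; apply: (ideal_sum RI) => j _; apply: contrapT; apply: h.
  by move/(_ 0); rewrite tcoef1//; case: pP.
have [//|[w hw]] := ocases (f j (m j)).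
set v0 := m j in hj hw; set e1 := f j in hj hw.
have he1 : functional e1 := mf.1 j.
have [b hb] : exists b, ord_eq (e1 (phiM v0)) b.
  apply: (semilinear_nonzero phiM_semilinear he1 _ hw).
    have [g _ gK] := pg_etale M_etale.
    by exists (repr (g v0)); rewrite -[LHS]gK.
  exact: (ord_eq_phi pP Pp hw).
(* A shift by T^k makes both orders nonnegative, so that gamma multiplies leading coefficients by
   natural powers of a. *)
pose k : nat := (`|w| + `|b|)%N.
pose e v := tpow k * e1 v.
have he : functional e by apply: functional_scale.
have [wa hwa] : exists wa : nat, k%:Z + w = wa%:Z by exists (absz (k%:Z + w)); rewrite /k; lia.
have [wb hwb] : exists wb : nat, k%:Z + b = wb%:Z by exists (absz (k%:Z + b)); rewrite /k; lia.
have ok := ord_tpow p_pr A_complete pP k%:Z.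
have ha : ord_eq (e v0) wa by rewrite -hwa; apply: oM.
have hb' : ord_eq (e (phiM v0)) wb by rewrite -hwb; apply: oM.
have [t ht] : exists t : int, wa%:Z - wb%:Z = p.-1%:Z * t.
  apply: exp_congruence => // a ap.
  have gL := gamM_semilinear ap.
  have ga := ord_eq_gam pP Pp ap ha.
  have gb := ord_eq_gam pP Pp ap hb'.
  have pa := ord_eq_phi pP Pp ha.
  have [s hs] : exists s, ord_eq (e (gamM a v0)) s.
    apply: (semilinear_nonzero gL he _ ha ga).
    have ua := Zpadic_nat_unit p_pr ap.
    have [act1 act] := pg_gam_action M_etale.
    exists [:: (1, pg_gam (a%:R^-1) v0)]; rewrite big_seq1 scale1r /=.
    by rewrite -act ?unitrV// mulrV// act1.
  have ps := ord_eq_phi pP Pp hs.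
  have E1 := semilinear_rank_one mf r1 phiM_semilinear (gamM a v0) v0 he he.
  have E2 := semilinear_rank_one mf r1 gL (phiM v0) v0 he he.
  (* The two ways of computing e(phi(gamma(v0))) = e(gamma(phi(v0))). Comparing orders gives (p-1)(s
     - wa) = 0, and then comparing leading coefficients gives a^wa = a^wb modulo p. *)
  have E : gamn a (e v0) * phi (e (gamM a v0)) * e (phiM v0) =
      phi (e v0) * gamn a (e (phiM v0)) * e (gamM a v0).
    rewrite -mulrA -E1 -mulrA -E2 (pg_phi_gam M_etale) ?Zpadic_nat_unit//.
    by rewrite mulrCA.
  have o1 := oM (oM ga ps) hb'; have o2 := oM (oM pa gb) hs.
  rewrite -E in o2; have wE := ord_eq_unique o1 o2.
  have sE : s = wa.
    have h : (p%:Z - 1) * (s - wa%:Z) = 0.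
      have -> : (p%:Z - 1) * (s - wa%:Z) =
        (wa%:Z + p%:Z * s + wb%:Z) - (p%:Z * wa%:Z + wb%:Z + s) by ring.
      by rewrite wE subrr.
    by move: h => /eqP; rewrite mulf_eq0 => /orP[] /eqP; lia.
  rewrite {}sE in hs ps o1 o2 wE.
  have c1 := tcoefM3_ord ga.1 ps.1 hb'.1.
  have c2 := tcoefM3_ord pa.1 gb.1 hs.1.
  rewrite -E -wE in c2.
  have c3 := ideal_trans PI (ideal_sym PI c1) c2.
  have g1 := tcoef_gam_ord pP Pp ap ha.1.
  have g2 := tcoef_gam_ord pP Pp ap hb'.1.
  have px (x : R) i : P (p%:R * tcoef x i) by apply: (ideal_mulr PI).
  have f1 := tcoef_phi A_complete phi_gam PI bP (px (e (gamM a v0))) wa.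
  have f2 := tcoef_phi A_complete phi_gam PI bP (px (e v0)) wa.
  have c4 := ideal_mulB PI (ideal_mulB PI g1 f1)
    (_ : P (tcoef (e (phiM v0)) wb - tcoef (e (phiM v0)) wb)).
  have c5 := ideal_mulB PI (ideal_mulB PI f2 g2)
    (_ : P (tcoef (e (gamM a v0)) wa - tcoef (e (gamM a v0)) wa)).
  rewrite !subrr in c4 c5.
  have c6 := ideal_trans PI (ideal_sym PI (c4 (ideal0 PI)))
    (ideal_trans PI c3 (c5 (ideal0 PI))).
  apply: natB_in_prime; rewrite !natrX.
  have [_ _ _ _ PM] := pP.
  have : P ((a%:R ^+ wa - a%:R ^+ wb) *
      (tcoef (e v0) wa * tcoef (e (gamM a v0)) wa * tcoef (e (phiM v0)) wb)).
    by move: c6; congr P; ring.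
  case/PM=> // /PM[/PM[]|] h.
  - by case: ha.2.
  - by case: hs.2.
  - by case: hb'.2.
(* The solution of p(tau + wa) = tau + wb. *)
pose tau := - (t + wa%:Z).
have ot := ord_tpow p_pr A_complete pP tau.
exists (fun v => tpow tau * e v); split; first exact: functional_scale.
exists v0, (tau + wa%:Z); split; first exact: oM.
have -> : p%:Z * (tau + wa%:Z) = tau + wb%:Z.
  have -> : wb%:Z = wa%:Z - p.-1%:Z * t by rewrite -ht; ring.
  have -> : p%:Z = p.-1%:Z + 1 by lia.
  by rewrite /tau; ring.
exact: oM.
Qed.

Section Normalized.
Variable e0 : M -> R.
Hypothesis ne : normalized P e0.
Let he := norm_functional ne.

Lemma norm_eq v w : ord_eq (e0 v) w -> ord_eq (e0 (phiM v)) (p%:Z * w).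
Proof.
have [v0 [w0 [h1 h2]]] := norm_point ne; move=> hv.
have E := semilinear_rank_one mf r1 phiM_semilinear v v0 he he.
have o1 := ord_eq_phi pP Pp h1.
have o2 := ord_eq_phi pP Pp hv.
by apply: (ocancel o1); rewrite E addrC; apply: oM.
Qed.

Lemma norm_eq_iter N v w : ord_eq (e0 v) w ->
  ord_eq (e0 (phiMn N v)) ((p ^ N)%N%:Z * w).
Proof.
move=> hv; elim: N => [|N IH]; first by rewrite mul1r.
by rewrite expnS PoszM -mulrA; apply: norm_eq.
Qed.

Lemma norm_point_iter N : exists v0 w0, [/\ ord_eq (e0 v0) w0,
  ord_eq (phin N (e0 v0)) ((p ^ N)%N%:Z * w0) &
  ord_eq (e0 (phiMn N v0)) ((p ^ N)%N%:Z * w0)].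
Proof.
have [v0 [w0 [h1 h2]]] := norm_point ne; exists v0, w0; split=> //.
  exact: (ord_eq_phin pP Pp).
exact: norm_eq_iter.
Qed.

Lemma norm_ge_iter N v w : ord_ge (e0 v) w ->
  ord_ge (e0 (phiMn N v)) ((p ^ N)%N%:Z * w).
Proof.
have [v0 [w0 [h1 h2 h3]]] := norm_point_iter N; move=> hv.
have E := semilinear_rank_one mf r1 (phiMn_semilinear N) v v0 he he.
apply: (gcancel h2); rewrite E addrC; apply: gM h3.1.
exact: (ord_ge_phin pP Pp).
Qed.

End Normalized.
End AtPrime.
(** * A lattice with nilpotent polar parts *)

(** All the primes considered contain p, so the polar bounds modulo p serve for every P. *)
Lemma uniform_order (J : finType) (x : J -> R) : exists C : nat,
  forall P, prime_ideal P -> P p%:R -> forall j, ord_ge P (x j) (- C%:Z).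
Proof.
have [N hN] := choice (fun j => tcoef_bounded A_complete (x j) 1).
exists (\sum_j `|N j|)%N => P pP Pp j i ij.
apply: (pdvd_prime pP Pp); apply: (hN j).
have : (`|N j| <= \sum_j `|N j|)%N by rewrite (bigD1 j) //= leq_addr.
by move: ij; lia.
Qed.

(** The constants bound the poles of phi (C1), of its inverse (C2) and of the Gram matrix (C3) on
    the generators. If mu is the least order of e0 on the m_j, then phi multiplies it by p, so (p-1)
    mu lies between -C1 and C2. The last bound follows from f_k(v) e0(m_j) = e0(v) f_k(m_j). *)
Lemma uniform_bounds : exists B : nat, forall P e0,
    prime_ideal P -> P p%:R -> normalized P e0 ->
  [/\ forall j, ord_ge P (e0 (m j)) (- B%:Z),
      exists j w, ord_eq P (e0 (m j)) w /\ w <= B%:Z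
    & forall k v w, ord_ge P (e0 v) w -> ord_ge P (f k v) (w - B%:Z)].
Proof.
have [r hr] := choice (fun j => etale_span (m j)).
have [C1 hC1] := uniform_order (fun ij : 'I_n * 'I_n => f ij.1 (phiM (m ij.2))).
have [C2 hC2] := uniform_order (fun ij : 'I_n * 'I_n => r ij.1 ij.2).
have [C3 hC3] := uniform_order (fun ij : 'I_n * 'I_n => f ij.1 (m ij.2)).
exists (C1 + C2 + C3 + (C1 + C2 + C3))%N => P e0 pP Pp ne.
set C := (C1 + C2 + C3)%N.
have he := norm_functional ne.
have PI := prime_is_ideal pP.
have RI := coefs_in_ideal A_complete PI (pdvd_prime pP Pp).
have [allP|[j [mu [hmu mmin]]]] := family_order p_pr A_complete pP Pp (fun j => e0 (m j)).
  have [v0 [w0 [[_ h] _]]] := norm_point ne; case: h.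
  rewrite (functional_dual_basis mf v0 he).
  by apply: (ideal_sum RI) => k _; apply: (ideal_mull RI).
have lo : - C%:Z <= mu.
  have h1 := norm_eq pP Pp ne hmu.
  have h2 : ord_ge P (e0 (phiM (m j))) (- C1%:Z + mu).
    rewrite (functional_dual_basis mf _ he); apply: (ord_ge_sum A_complete pP) => i.
    apply: (ord_geM p_pr A_complete pP Pp); last exact: mmin.
    exact: (hC1 P pP Pp (i, j)).
  have h := ord_eq_le h2 h1.
  have : - C1%:Z <= (p%:Z - 1) * mu by rewrite mulrBl mul1r; lia.
  rewrite /C; move=> h'; rewrite leNgt; apply/negP => h3.
  have : (p%:Z - 1) * mu <= 1 * mu by rewrite ler_nM2r; lia.
  by lia.
have hi : mu <= C%:Z.
  have h2 : ord_ge P (e0 (m j)) (- C2%:Z + p%:Z * mu).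
    rewrite (hr j) functional_sum//; apply: (ord_ge_sum A_complete pP) => i.
    apply: (ord_geM p_pr A_complete pP Pp); first exact: (hC2 P pP Pp (j, i)).
    have := norm_ge_iter pP Pp ne (N := 1) (mmin i).
    by rewrite expn1.
  have h := ord_eq_le h2 hmu.
  have : (p%:Z - 1) * mu <= C2%:Z by rewrite mulrBl mul1r; lia.
  rewrite /C; move=> h'; rewrite leNgt; apply/negP => h3.
  have : 1 * mu <= (p%:Z - 1) * mu by rewrite ler_pM2r; lia.
  by lia.
split.
- by move=> i; apply: (ord_ge_le p_pr _ (mmin i)); rewrite /C in lo; lia.
- by exists j, mu; split=> //; rewrite /C in hi; lia.
- move=> k v w hv.
  have E := r1 (m j) v he (mf.1 k).
  apply: (ord_ge_cancel p_pr A_complete pP Pp hmu (w := w - (C + C)%N%:Z)).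
  rewrite E; have h := ord_geM p_pr A_complete pP Pp hv (hC3 P pP Pp (k, j)).
  by apply: (ord_ge_le p_pr _ h); rewrite /C in hi *; lia.
Qed.

Section Spread.
Variables (N B : nat).
Let q := (p ^ N)%N.
Let q0 : (0 < q)%N. Proof. by rewrite expn_gt0 p0. Qed.

(* Modulo p this interleaves the coefficients of the h_i. *)
Definition spread (h : 'I_q -> R) : R :=
  \sum_(i < q) tpow (i%:Z - B%:Z) * phin N (h i).

Lemma tcoef_spread h (i : 'I_q) (e : int) :
  pdvd p 1 (tcoef (spread h) (i%:Z - B%:Z + q%:Z * e) - tcoef (h i) e).
Proof.
have I1 := pdvd_ideal p A 1.
rewrite tcoef_sum// (bigD1 i) //= tcoef_tpowM// addrAC.
apply: (idealD I1).
  have -> : i%:Z - B%:Z + q%:Z * e - (i%:Z - B%:Z) = q%:Z * e by ring.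
  exact: (tcoef_phin).
apply: (ideal_sum I1) => j ji; rewrite tcoef_tpowM//.
apply: (tcoef_phin_ndvd); apply/negP => /dvdzP[d hd].
move/eqP: ji; apply; apply/val_inj; have := ltn_ord i; have := ltn_ord j.
rewrite -/q in hd *; case: (ltgtP (d - e) 0) => hde jq iq.
- have : q%:Z * (d - e) <= q%:Z * (-1) by rewrite ler_pM2l; lia.
  by move: hd; rewrite mulrBr [d * _]mulrC; lia.
- have : q%:Z * 1 <= q%:Z * (d - e) by rewrite ler_pM2l; lia.
  by move: hd; rewrite mulrBr [d * _]mulrC; lia.
- have de : d = e by lia.
  by move: hd; rewrite de [e * _]mulrC /=; lia.
Qed.

Lemma spread_index (k : int) : exists (i : 'I_q) e, k = i%:Z - B%:Z + q%:Z * e.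
Proof.
have qZ : q%:Z != 0 by lia.
have h0 := modz_ge0 (k + B%:Z) qZ.
have h1 : ((k + B%:Z) %% q%:Z)%Z < q%:Z by rewrite ltz_pmod; lia.
have hq : (absz ((k + B%:Z) %% q%:Z)%Z < q)%N by lia.
exists (Ordinal hq), ((k + B%:Z) %/ q%:Z)%Z => /=.
by have := divz_eq (k + B%:Z) q%:Z; rewrite mulrC; lia.
Qed.

Lemma spread_exists (r : R) : exists s, pdvd p 1 (r - spread s).
Proof.
have [L hL] := tcoef_bounded A_complete r 1.
pose c (i : 'I_q) (e : int) :=
  if e < - (`|L| + B + q)%N%:Z then 0 else tcoef r (i%:Z - B%:Z + q%:Z * e).
have cP i : c i \in @bounded_below A.
  by apply/bounded_belowP; exists (- (`|L| + B + q)%N%:Z) => e; rewrite /c => ->.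
pose s i : R := of_laurent p A (Laurent (cP i)).
exists s; apply/(tcoef_pdvd A_complete) => k; have [i [e ->]] := spread_index k.
rewrite tcoefB//; have h := tcoef_spread s i e.
apply: (ideal_trans (pdvd_ideal p A 1) _ (ideal_sym (pdvd_ideal p A 1) h)).
rewrite tcoef_of_laurent//= /c; case: ltP => he; last by rewrite subrr; apply: pdvd0.
rewrite subr0; apply: hL; have := ltn_ord i; rewrite -/q => iq.
have : q%:Z * e <= 1 * e by rewrite ler_nM2r; lia.
by lia.
Qed.

Section AtPrime.
Variable P : set A.
Hypotheses (pP : prime_ideal P) (Pp : P p%:R).
Let PI := prime_is_ideal pP.
Let bP := pdvd_prime pP Pp.

(** For 0 <= i < q the exponent i - B + q e is at least q w - B exactly when e >= w: passing to the
    h_i divides orders by q and absorbs the error B in the offset. *)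
Lemma spread_ord (h : 'I_q -> R) (w : int) : ord_ge P (spread h) (q%:Z * w - B%:Z) ->
  forall i, ord_ge P (h i) w.
Proof.
move=> hs i e ew; apply/(ideal_congr PI (bP (tcoef_spread h i e))); apply: hs.
have := ltn_ord i; rewrite -/q => iq.
have : q%:Z * (e + 1) <= q%:Z * w by rewrite ler_pM2l; lia.
by rewrite mulrDr; lia.
Qed.

Lemma ord_spread (h : 'I_q -> R) (w : int) : (forall i, ord_ge P (h i) w) ->
  ord_ge P (spread h) (q%:Z * w - B%:Z).
Proof.
move=> hs k kw; have [i [e ke]] := spread_index k.
rewrite ke; apply/(ideal_congr PI (bP (tcoef_spread h i e))); apply: hs.
rewrite ltNge; apply/negP => we.
have : q%:Z * w <= q%:Z * e by rewrite ler_pM2l; lia.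
by move: kw; rewrite ke; lia.
Qed.

End AtPrime.
End Spread.

(** The families l and F are the same for all P; only the functional e0 that measures orders
    varies. *)
Record lattice_data (I J : finType) (l : I -> M) (F : J -> M -> R) : Prop := LatticeData {
  lattice_functional : forall b, functional (F b);
  lattice_order : forall P, prime_ideal P -> P p%:R -> exists e0,
    [/\ normalized P e0, forall a, ord_ge P (e0 (l a)) 0,
        exists a b, ord_eq P (e0 (l a)) 0 /\ ord_eq P (F b (l a)) 0
      & forall b v w, ord_ge P (e0 v) w -> ord_ge P (F b v) w]
}.

(** The l are the coordinates of the m_j, and the F those of the f_k composed with phi^N, when
    expanded along phi^N. Orders between -B and B become, after division by q, at least 0 with the
    value 0 attained. *)
Theorem lattice_exists : exists (I J : finType) (l : I -> M) (F : J -> M -> R),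
  lattice_data l F.
Proof.
have [B hB] := uniform_bounds.
(* Used in the form q - B > B for the l and q - B - B > 0 for the F. *)
have [N qB] : exists N, (B + B + B < p ^ N)%N by exists (B + B + B)%N; apply: ltn_expl.
pose q := (p ^ N)%N; rewrite -/q in qB.
have q0 : (0 < q)%N by rewrite expn_gt0 p0.
have [r hr] := choice (fun j => etale_span_iter N (m j)).
have [s hs] := choice (fun jk : 'I_n * 'I_n => spread_exists N B (r jk.1 jk.2)).
have [t ht] := choice (fun kj : 'I_n * 'I_n => spread_exists N B (f kj.1 (phiMn N (m kj.2)))).
pose l (ji : 'I_n * 'I_q) : M := \sum_k s (ji.1, k) ji.2 *: m k.
pose F (ki : 'I_n * 'I_q) (v : M) : R := \sum_j t (ki.1, j) ki.2 * f j v.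
have FL b : functional (F b) by apply: functional_lincomb => j; apply: (mf.1 j).
have Fspread k v : pdvd p 1 (f k (phiMn N v) - spread (N := N) B (fun i => F (k, i) v)).
  have -> : f k (phiMn N v) = \sum_j phin N (f j v) * f k (phiMn N (m j)).
    rewrite {1}(mf.2 v) (semilinear_sum (phiMn_semilinear N)).
    by rewrite functional_sum//; apply: (mf.1 k).
  have -> : spread (N := N) B (fun i => F (k, i) v) =
      \sum_j phin N (f j v) * spread (N := N) B (t (k, j)).
    rewrite /spread; under [RHS]eq_bigr do rewrite mulr_sumr.
    rewrite exchange_big; apply: eq_bigr => i _ /=.
    rewrite rmorph_sum mulr_sumr; apply: eq_bigr => j _.
    by rewrite rmorphM; ring.
  rewrite -sumrB; apply: (ideal_sum (pdvd_ideal p R 1)) => j _.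
  by rewrite -mulrBr; apply: pdvdMl; apply: (ht (k, j)).
exists ('I_n * 'I_q)%type, ('I_n * 'I_q)%type, l, F; split=> // P pP Pp.
have [e0 ne] := exists_normalized pP Pp.
have he := norm_functional ne.
have [b1 b2 b3] := hB P e0 pP Pp ne.
have PI := prime_is_ideal pP; have bP := pdvd_prime pP Pp.
have [v0 [w0 [o1 o2 o3]]] := norm_point_iter pP Pp ne N.
pose X j := spread (N := N) B (fun i => e0 (l (j, i))).
(* By [semilinear_rank_one] the point v0 converts phi^N(e0(l)) into e0(phi^N(l)). Both factors
   involving v0 have order q w0 at P, so e0(m_j) and X j have the same order. *)
have lspread j : pdvd p 1 (phin N (e0 v0) * e0 (m j) - e0 (phiMn N v0) * X j).
  rewrite (hr j) functional_sum//.
  have -> : e0 (phiMn N v0) * X j =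
      phin N (e0 v0) * \sum_k spread (N := N) B (s (j, k)) * e0 (phiMn N (m k)).
    rewrite /X /spread [LHS]mulr_sumr [RHS]mulr_sumr.
    transitivity (\sum_(i < q) \sum_k tpow (i%:Z - B%:Z) * phin N (s (j, k) i) *
        (phin N (e0 v0) * e0 (phiMn N (m k)))).
      apply: eq_bigr => i _.
      rewrite mulrCA [_ * phin N _]mulrC.
      rewrite -(semilinear_rank_one mf r1 (phiMn_semilinear N) (l (j, i)) v0 he he).
      rewrite (semilinear_sum (phiMn_semilinear N)) functional_sum// !mulr_sumr.
      by apply: eq_bigr => k _; rewrite /=; ring.
    rewrite exchange_big; apply: eq_bigr => k _ /=; rewrite /spread mulrCA mulr_suml.
    by apply: eq_bigr => i _; ring.
  rewrite -mulrBr -sumrB; apply: pdvdMl; apply: (ideal_sum (pdvd_ideal p R 1)) => k _.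
  by rewrite -mulrBl; apply: pdvdMr; apply: (hs (j, k)).
have X_of j w : ord_ge P (e0 (m j)) w -> ord_ge P (X j) w.
  move=> h; have h1 := ord_geM p_pr A_complete pP Pp o2.1 h.
  apply: (ord_ge_cancel p_pr A_complete pP Pp o3).
  exact: (ord_ge_pdvd A_complete pP Pp (lspread j)).
have of_X j w : ord_ge P (X j) w -> ord_ge P (e0 (m j)) w.
  move=> h; have h1 := ord_geM p_pr A_complete pP Pp o3.1 h.
  apply: (ord_ge_cancel p_pr A_complete pP Pp o2).
  apply: (ord_ge_pdvd A_complete pP Pp _ h1).
  exact: (ideal_sym (pdvd_ideal p R 1) (lspread j)).
have l0 a : ord_ge P (e0 (l a)) 0.
  case: a => j i; apply: (@spread_ord N B P pP Pp (fun i => e0 (l (j, i)))).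
  by rewrite mulr0 sub0r; apply: X_of.
have Fge b v w : ord_ge P (e0 v) w -> ord_ge P (F b v) w.
  case: b => k i hv; apply: (@spread_ord N B P pP Pp (fun i => F (k, i) v)).
  apply: (ord_ge_pdvd A_complete pP Pp (Fspread k v)); apply: b3.
  exact: (norm_ge_iter pP Pp ne (N := N) hv).
have pos x : ord_ge P x 0 -> ~ ord_eq P x 0 -> ord_ge P x 1.
  move=> hx nx i i1; case: (ltP i 0) => i0; first exact: hx.
  have -> : i = 0 by lia.
  by apply: contrapT => h; apply: nx.
exists e0; split=> //.
have [a la] : exists a, ord_eq P (e0 (l a)) 0.
  apply: contrapT => /forallNP h; have [j [w [hw wB]]] := b2.
  have : ord_ge P (e0 (m j)) (q%:Z * 1 - B%:Z).
    by apply: of_X; apply: ord_spread => // i; apply: pos.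
  by move=> /ord_eq_le /(_ hw); rewrite mulr1; lia.
have [b lb] : exists b, ord_eq P (F b (l a)) 0.
  apply: contrapT => /forallNP h.
  have hf k : ord_ge P (f k (phiMn N (l a))) (q%:Z * 1 - B%:Z).
    have Fs := ideal_sym (pdvd_ideal p R 1) (Fspread k (l a)).
    apply: (ord_ge_pdvd A_complete pP Pp Fs).
    by apply: ord_spread => // i; apply: pos => //; apply: Fge.
  have hl := norm_eq_iter pP Pp ne N la.
  have : ord_ge P (e0 (phiMn N (l a))) (q%:Z * 1 - B%:Z + - B%:Z).
    rewrite (functional_dual_basis mf _ he); apply: (ord_ge_sum A_complete pP) => k.
    exact: (ord_geM p_pr A_complete pP Pp).
  by move=> /ord_eq_le /(_ hl); rewrite mulr1 mulr0; lia.
by exists a, b.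
Qed.

End Normalization.

(** * Lifting idempotents of rank one *)

Section Lifting.
Variables (p : nat) (A : comPzRingType).
Hypothesis A_complete : padically_complete p A.
Let sepA := padically_complete_separated A_complete.
Let limA := padically_complete_limits A_complete.
Variable s : nat.
Implicit Types X Y : 'M[A]_s.

Definition entries_in (K : set A) X := forall i j, K (X i j).

Lemma entries_inM (K K' : set A) X Y : is_ideal K' ->
  (forall a a', K a -> K a' -> K' (a * a')) ->
  entries_in K X -> entries_in K Y -> entries_in K' (X *m Y).
Proof.
by move=> hK' KK hX hY i j; rewrite mxE; apply: (ideal_sum hK') => k _; apply: KK.
Qed.

Lemma entries_in_mulr (K : set A) X Y : is_ideal K -> entries_in K X -> entries_in K (X *m Y).
Proof.
move=> hK hX i j; rewrite mxE; apply: (ideal_sum hK) => k _.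
exact: (ideal_mulr hK).
Qed.

(** This is 3 X^2 - 2 X^3, the Newton iterate for X^2 = X, written through the defect so that it is
    visibly close to X. *)
Definition newton X := X + (X *m X - X) - 2%:R *: (X *m (X *m X - X)).

Lemma newton_defect X : let Y := X *m X - X in
  newton X *m newton X - newton X = (Y *m Y) *m (4%:R *: Y - 3%:R%:M).
Proof.
move=> Y; rewrite /newton -/Y.
have XX : X *m X = X + Y by rewrite /Y addrC subrK.
have YX : Y *m X = X *m Y by rewrite /Y mulmxBl mulmxBr mulmxA.
clearbody Y; have e1 : X *m (X *m Y) = X *m Y + Y *m Y by rewrite mulmxA XX mulmxDl.
have e2 : X *m (Y *m Y) = Y *m (X *m Y) by rewrite !mulmxA YX.
have e3 : (X *m Y) *m X = X *m Y + Y *m Y by rewrite -mulmxA YX e1.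
have e4 : (X *m Y) *m (X *m Y) = X *m (Y *m Y) + Y *m (Y *m Y).
  by rewrite mulmxA e3 mulmxDl -!mulmxA.
have e5 : (X *m Y) *m Y = X *m (Y *m Y) by rewrite -mulmxA.
rewrite !(mulmxBl, mulmxBr, mulmxDl, mulmxDr) -!(scalemxAl, scalemxAr) XX YX.
rewrite e1 e3 e4 e5 -e2 mul_mx_scalar -[(Y *m Y) *m Y]mulmxA.
move: (X *m Y) (Y *m Y) (X *m (Y *m Y)) (Y *m (Y *m Y)) => a b c d.
by apply/matrixP => i j; rewrite !mxE; ring.
Qed.

Lemma newton_step (K K' : set A) X : square_step p K K' ->
  entries_in K (X *m X - X) ->
  entries_in K (newton X - X) /\ entries_in K' (newton X *m newton X - newton X).
Proof.
move=> [hK hK' K'K KK pK _] hY; split.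
  have -> : newton X - X = (X *m X - X) *m (1%:M - 2%:R *: X).
    have YX : (X *m X - X) *m X = X *m (X *m X - X) by rewrite mulmxBl mulmxBr mulmxA.
    rewrite /newton; move: (X *m X - X) YX => Y YX.
    rewrite mulmxBr mulmx1 -scalemxAr YX; move: (X *m Y) => U.
    by apply/matrixP => i j; rewrite !mxE; ring.
  exact: entries_in_mulr.
rewrite newton_defect; apply: entries_in_mulr => //.
exact: (entries_inM hK' KK).
Qed.

Lemma lift_idempotent X : entries_in (@pradical p A) (X *m X - X) ->
  exists W, W *m W = W /\ entries_in (@pradical p A) (W - X).
Proof.
move=> hX; have hI := pradical_ideal p A.
pose gens := [seq (X *m X - X) ij.1 ij.2 | ij <- enum {: 'I_s * 'I_s}].
(* The property carried along the chain also keeps X' congruent to the original X modulo the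
   radical. *)
pose Q (K : set A) := exists X', entries_in (@pradical p A) (X' - X) /\
  entries_in K (X' *m X' - X').
have [X1 [hX1 hX1']] : Q (pdvd p 1).
  apply: (nilpotent_chain (Q := Q) _ (s := gens)).
  - move=> K K' st _ [X' [h1 h2]]; have [h3 h4] := newton_step st h2.
    exists (newton X'); split=> // i j.
    rewrite -(subrK X' (newton X')) -addrA mxE; apply: (idealD hI); last exact: h1.
    by apply: (step_radical st); apply: h3.
  - by move=> _ /mapP[ij _ ->]; apply: hX.
  - exists X; split=> [i j|i j]; first by rewrite subrr mxE; apply: ideal0.
    apply: padic_gen_mem; apply/mapP; exists (i, j) => //.
    by rewrite mem_enum.
pose Z n := iter n newton X1.
have ZP n : entries_in (pdvd p n.+1) (Z n *m Z n - Z n).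
  elim: n => //= n IH; have [_] := newton_step (power_step p A n) IH; exact.
have dZ n : entries_in (pdvd p n.+1) (Z n.+1 - Z n).
  by have [] := newton_step (power_step p A n) (ZP n).
have lim i j : exists w, forall n, pdvd p n (w - Z n i j).
  apply: limA => n; have := dZ n i j; rewrite !mxE; exact: pdvd_le.
have [w hw] := choice (fun ij : 'I_s * 'I_s => lim ij.1 ij.2).
pose W : 'M[A]_s := \matrix_(i, j) w (i, j).
have WZ n : entries_in (pdvd p n) (W - Z n).
  by move=> i j; rewrite !mxE; apply: (hw (i, j)).
exists W; split.
  apply/matrixP => i j; apply/eqP; rewrite -subr_eq0; apply/eqP; apply: sepA => n.
  (* The transpose puts Z_n (W - Z_n) into the shape of [entries_in_mulr], where the small factor is
     on the left. *)
  have -> : (W *m W) i j - W i j = ((W - Z n) *m W) i j + ((W - Z n)^T *m (Z n)^T) j i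
     + (Z n *m Z n - Z n) i j - (W - Z n) i j.
    rewrite -trmx_mul [_^T j i]mxE mulmxBl mulmxBr.
    have subE (U V : 'M[A]_s) : (U - V) i j = U i j - V i j :> A by rewrite !mxE.
    by rewrite !subE; ring.
  have In := pdvd_ideal p A n.
  apply: (idealB In) (WZ n i j); apply: (idealD In).
    apply: (idealD In); apply: entries_in_mulr => //.
    by move=> a b; rewrite mxE; apply: WZ.
  by apply: pdvd_le (ZP n i j).
move=> i j; rewrite -(subrK X1 W) -addrA mxE; apply: (idealD hI); last exact: hX1.
have h1 := WZ 1%N i j; have h0 := dZ 0%N i j.
have -> : (W - X1) i j = (W - Z 1%N) i j + (Z 1%N - Z 0%N) i j by rewrite !mxE; ring.
by apply: pdvd_pradical; apply: pdvdD.
Qed.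

Definition minor X i k j l := X i j * X k l - X i l * X k j.

(* The second exterior power of an idempotent is idempotent, so that its entries,
   once nilpotent, vanish; summing over [a < b] avoids a division by 2. *)
Lemma idempotent_minor W i k j l : W *m W = W ->
  minor W i k j l = \sum_(a < s) \sum_(b < s | (a < b)%N) minor W i k a b * minor W a b j l.
Proof.
move=> WW; have WE u v : W u v = \sum_a W u a * W a v by rewrite -{1}WW mxE.
pose G (a b : 'I_s) := W i a * W k b * minor W a b j l.
have -> : minor W i k j l = \sum_a \sum_b G a b.
  rewrite /minor (WE i j) (WE k l) (WE i l) (WE k j) !mulr_suml -sumrB.
  apply: eq_bigr => a _; rewrite !mulr_sumr -sumrB.
  by apply: eq_bigr => b _; rewrite /G /minor; ring.
have Gaa a : G a a = 0 by rewrite /G /minor; ring.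
have split3 a : \sum_b G a b = \sum_(b < s | (a < b)%N) G a b + \sum_(b < s | (b < a)%N) G a b.
  rewrite (bigID (fun b : 'I_s => (a < b)%N)) /=; congr (_ + _).
  rewrite (bigD1 a) ?ltnn//= Gaa add0r; apply: eq_bigl => b.
  by rewrite -leqNgt ltn_neqAle andbC.
under eq_bigr do rewrite split3.
rewrite big_split /=.
have -> : \sum_(a < s) \sum_(b < s | (b < a)%N) G a b = \sum_(a < s) \sum_(b < s | (a < b)%N) G b a.
  by rewrite (exchange_big_dep predT).
rewrite -big_split; apply: eq_bigr => a _ /=; rewrite -big_split.
by apply: eq_bigr => b _ /=; rewrite /G /minor; ring.
Qed.

Lemma idempotent_rank_one W : W *m W = W ->
    (forall i k j l, pradical p (minor W i k j l)) -> forall i k j l, minor W i k j l = 0.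
Proof.
move=> WW hW.
pose Q (K : set A) := forall i k j l, K (minor W i k j l).
have step K K' : square_step p K K' -> Q K -> Q K'.
  move=> [hK hK' _ KK _ _] hQ i k j l; rewrite (idempotent_minor _ _ _ _ WW).
  by do 2!apply: (ideal_sum hK') => ? _; apply: KK; apply: hQ.
pose gens := [seq minor W x.1.1 x.1.2 x.2.1 x.2.2 |
  x <- enum {: ('I_s * 'I_s) * ('I_s * 'I_s)}].
have Q1 : Q (pdvd p 1).
  apply: (nilpotent_chain (Q := Q) _ (s := gens)).
  - by move=> K K' st _; apply: step.
  - by move=> _ /mapP[x _ ->]; apply: hW.
  - move=> i k j l; apply: padic_gen_mem; apply/mapP; exists ((i, k), (j, l)) => //.
    by rewrite mem_enum.
have Qn n : Q (pdvd p n.+1).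
  by elim: n => // n IH; apply: (step _ _ (power_step p A n)).
by move=> i k j l; apply: sepA => n; apply: pdvd_le (Qn n i k j l).
Qed.

End Lifting.

(** * A basis on which Frobenius and Gamma act through constants *)

Section ConstantEigen.
Variables (S : comPzRingType) (V : lmodType S) (n : nat).
Variables (eps : 'I_n -> V) (sig : 'I_n -> V -> S).
Hypotheses (dual : dual_basis eps sig) (r1 : rank_one V).

(** The linear map h' that sends v to the sum of the sig_k(v) h(eps_k) agrees with h on the eps_j,
    because sg fixes the Gram matrix; and a linear endomorphism of V is a scalar. *)
Lemma semilinear_eigen (sg : {rmorphism S -> S}) (h : V -> V) :
    (forall a v w, h (a *: v + w) = sg a *: h v + h w) ->
    (forall j k, sg (sig k (eps j)) = sig k (eps j)) ->
  forall j, h (eps j) = (\sum_i sig i (h (eps i))) *: eps j.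
Proof.
move=> hL fixed; pose h' v := \sum_k sig k v *: h (eps k).
have h'L a v w : h' (a *: v + w) = a *: h' v + h' w.
  rewrite scaler_sumr -big_split; apply: eq_bigr => k _ /=.
  by rewrite (dual.1 k) scalerDl scalerA.
have h'E j : h' (eps j) = h (eps j).
  rewrite {2}(dual.2 (eps j)) (semilinear_sum hL).
  by apply: eq_bigr => k _; rewrite fixed.
move=> j; rewrite -h'E (rank_one_scalar dual r1 h'L).
by congr (_ *: _); apply: eq_bigr => i _; rewrite h'E.
Qed.

Lemma scalar_unique r r' : \sum_j sig j (eps j) = 1 ->
  (forall k, r *: eps k = r' *: eps k) -> r = r'.
Proof.
move=> tr h; rewrite -[r]mulr1 -[r']mulr1 -tr !mulr_sumr.
by apply: eq_bigr => k _; rewrite -!(functionalZ (dual.1 k)) h.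
Qed.

End ConstantEigen.

Section ConstantBasis.
Variables (p : nat) (p_pr : prime p) (A : comPzRingType).
Variable sA : {rmorphism Zpadic p_pr -> A}.
Hypothesis A_complete : padically_complete p A.
Local Notation R := (AQp p A).
Local Notation cst := (aconst p A).
Variables (phi : {rmorphism R -> R}) (gam : Zpadic p_pr -> {rmorphism R -> R}).
Hypothesis phi_gam : phiGamma_ring sA phi gam.
Variable M : phiGamma_data p_pr A.
Hypothesis M_etale : etale_phiGamma_module phi gam M.
Hypothesis M_rank1 : constant_rank M 1.

Local Notation normalized := (@normalized p p_pr A M).
Let sepA := padically_complete_separated A_complete.
Let limA := padically_complete_limits A_complete.
Let r1 : rank_one M := constant_rank_one M_rank1.
Let nI := pradical_ideal p A.

Lemma tcoef0_mul_radical (x y : R) : (forall i, i < 0 -> pradical p (tcoef x i)) ->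
  (forall i, i < 0 -> pradical p (tcoef y i)) ->
  pradical p (tcoef (x * y) 0 - tcoef x 0 * tcoef y 0).
Proof.
move=> hx hy; have pn : (pdvd p 1 `<=` @pradical p A)%classic by move=> a; apply: pdvd_pradical.
have := tcoefM_lead A_complete (x := x) (y := y) (v := 0) (w := 0) nI pn.
rewrite addr0; apply=> i j ij /eqP i0; case: (ltP i 0) => hi.
  by apply: (ideal_mulr nI); apply: hx.
by apply: (ideal_mull nI); apply: hy; lia.
Qed.

Definition integral_order (x : R) :=
  forall P, prime_ideal P -> P p%:R -> ord_ge P x 0.

Lemma integral_order_radical x : integral_order x ->
  forall i, i < 0 -> pradical p (tcoef x i).
Proof.
move=> hx i i0; apply: contrapT => /pradicalP[P [pP Pp hP]].
by apply: hP; apply: (hx P).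
Qed.

Lemma integral_order_sum (J : finType) (F : J -> R) :
  (forall j, integral_order (F j)) -> integral_order (\sum_j F j).
Proof. by move=> h P pP Pp; apply: (ord_ge_sum A_complete pP) => j; apply: h. Qed.

Lemma integral_order_cst a : integral_order (cst a).
Proof.
move=> P pP Pp i i0; rewrite tcoef_aconst//.
by rewrite (_ : (i == 0) = false); [apply: (ideal0 (prime_is_ideal pP)) | lia].
Qed.

Lemma integral_orderM x y : integral_order x -> integral_order y -> integral_order (x * y).
Proof.
by move=> hx hy P pP Pp; have := ord_geM p_pr A_complete pP Pp (hx P pP Pp) (hy P pP Pp).
Qed.

Lemma integral_unit x : integral_order x -> is_unit (tcoef x 0) ->
  exists y, x * y = 1 /\ integral_order y.
Proof.
move=> hx x0; have [y xy] := unit_of_coefs A_complete (integral_order_radical hx) x0.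
exists y; split=> // P pP Pp.
have ox : ord_eq P x 0 by split; [apply: hx | apply: unit_notin_prime].
apply: (ord_ge_cancel p_pr A_complete pP Pp ox); rewrite xy addr0.
exact: (ord_eq1 p_pr A_complete pP).1.
Qed.

(** Every P above p misses some constant term of F_b(l_a), so these constant terms and p generate
    the unit ideal; completeness then removes p. *)
Lemma constants_generate (I J : finType) (l : I -> M) (F : J -> M -> R) :
    lattice_data l F ->
  exists c : J -> I -> A, \sum_b \sum_a c b a * tcoef (F b (l a)) 0 = 1.
Proof.
move=> [hF hl]; pose S (c : J -> I -> A) := \sum_b \sum_a c b a * tcoef (F b (l a)) 0.
pose G : set A := fun x => exists c, pdvd p 1 (x - S c).
have pI := pdvd_ideal p A 1.
have S0 : S (fun _ _ => 0) = 0.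
  by rewrite /S big1// => b _; rewrite big1// => a _; rewrite mul0r.
have hG : is_ideal G.
  split; first by exists (fun _ _ => 0); rewrite S0 subrr; apply: pdvd0.
  - move=> x y [c hc] [d hd]; exists (fun b a => c b a + d b a).
    have -> : S (fun b a => c b a + d b a) = S c + S d.
      rewrite /S -big_split; apply: eq_bigr => b _; rewrite -big_split.
      by apply: eq_bigr => a _ /=; rewrite mulrDl.
    by rewrite opprD addrACA; apply: pdvdD.
  - move=> z x [c hc]; exists (fun b a => z * c b a).
    have -> : S (fun b a => z * c b a) = z * S c.
      rewrite /S mulr_sumr; apply: eq_bigr => b _; rewrite mulr_sumr.
      by apply: eq_bigr => a _; rewrite mulrA.
    by rewrite -mulrBr; apply: pdvdMl.
have [c hc] : G 1.
  apply: (ideal_whole hG) => P pP GP.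
  have Pp : P p%:R.
    apply: GP; exists (fun _ _ => 0); rewrite S0 subr0 -[X in pdvd _ _ X]expr1.
    exact: pdvd_exp.
  have [e0 [_ _ [a [b [_ [_ hab]]]] _]] := hl P pP Pp.
  apply: hab; apply: GP; exists (fun b' a' => ((b' == b) && (a' == a))%:R).
  rewrite /S (bigD1 b) //= (bigD1 a) //= !eqxx mul1r.
  rewrite big1 => [|a' /negPf ->]; last by rewrite mul0r.
  rewrite big1 => [|b' /negPf ->]; last by rewrite big1// => a' _; rewrite mul0r.
  by rewrite !addr0 subrr; apply: pdvd0.
have [d hd] : is_unit (S c).
  apply: (unit_modp sepA limA (y := 1)); rewrite mulr1 -opprB; exact: pdvdN.
exists (fun b a => d * c b a); rewrite -hd mulrC /S mulr_sumr; apply: eq_bigr => b _.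
by rewrite mulr_sumr; apply: eq_bigr => a _; rewrite mulrA.
Qed.

(** A combination [om] of the F_b(l_a) with constant term 1 is a unit with inverse of order >= 0.
    Dividing by it gives functionals of trace 1 on the l_a, and in rank one trace 1 already implies
    the dual basis identity. *)
Lemma integral_dual_basis : exists s (l : 'I_s -> M) (lam : 'I_s -> M -> R),
  [/\ dual_basis l lam, \sum_a lam a (l a) = 1
    & forall P, prime_ideal P -> P p%:R -> exists e0,
      [/\ normalized P e0, forall a, ord_ge P (e0 (l a)) 0,
        exists a, ord_eq P (e0 (l a)) 0
      & forall a v w, ord_ge P (e0 v) w -> ord_ge P (lam a v) w]].
Proof.
have [n [m [f mf]]] := finite_projective_dual_basis (pg_projective M_etale).
have tr1 := trace_one mf r1 M_rank1.
have [I [J [l [F lF]]]] := lattice_exists A_complete phi_gam M_etale mf r1 tr1.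
have [hF hl] := lF; have [c hc] := constants_generate lF.
have intF b a : integral_order (F b (l a)).
  by move=> P pP Pp; have [e0 [_ h _ h']] := hl P pP Pp; apply: h'.
pose om := \sum_a \sum_b cst (c b a) * F b (l a).
have int_om : integral_order om.
  apply: integral_order_sum => a; apply: integral_order_sum => b.
  by apply: integral_orderM => //; apply: integral_order_cst.
have om0 : tcoef om 0 = 1.
  rewrite /om tcoef_sum//; under eq_bigr do rewrite tcoef_sum//.
  rewrite exchange_big /= -hc; apply: eq_bigr => b _; apply: eq_bigr => a _.
  by rewrite tcoef_aconstM.
have [om' [omom' int_om']] : exists y, om * y = 1 /\ integral_order y.
  by apply: integral_unit => //; rewrite om0; apply: is_unit1.
pose lam a v := om' * \sum_b cst (c b a) * F b v.
have lamL a : functional (lam a).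
  by apply: functional_scale; apply: functional_lincomb.
have lam1 : \sum_a lam a (l a) = 1 by rewrite -mulr_sumr mulrC omom'.
have lamE v : v = \sum_a lam a v *: l a.
  apply: (functional_separate mf) => k; rewrite functional_sum; last exact: mf.1.
  rewrite -[LHS]mul1r -lam1 mulr_suml; apply: eq_bigr => a _.
  by rewrite (r1 (l a) v (lamL a) (mf.1 k)).
exists #|I|, (fun i => l (enum_val i)), (fun i => lam (enum_val i)); split.
- split=> [i|v]; first exact: lamL.
  by rewrite {1}(lamE v) (reindex _ (onW_bij _ (@enum_val_bij I))).
- by rewrite -lam1 (reindex _ (onW_bij _ (@enum_val_bij I))).
move=> P pP Pp; have [e0 [ne h1 [a [b [h2 _]]] h4]] := hl P pP Pp.
exists e0; split=> //; first by exists (enum_rank a); rewrite enum_rankK.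
move=> i v w hv; rewrite -[w]add0r.
apply: (ord_geM p_pr A_complete pP Pp); first exact: (int_om' P).
apply: (ord_ge_sum A_complete pP) => b'; rewrite -[w]add0r.
apply: (ord_geM p_pr A_complete pP Pp); first exact: integral_order_cst.
exact: h4.
Qed.

(** For W of rank one, W E W = tr(W E) W. So with eps = W l, and with sig obtained from lam and W by
    dividing by T = tr(W E), the Gram matrix is exactly W. The constant term of T is 1 modulo the
    radical, which makes T a unit of order 0. *)
Theorem constant_dual_basis : exists s (W : 'M[A]_s) (eps : 'I_s -> M) (sig : 'I_s -> M -> R),
  [/\ dual_basis eps sig, forall j k, sig k (eps j) = cst (W j k)
    & forall P, prime_ideal P -> P p%:R -> exists e0,
      [/\ normalized P e0, forall k, ord_ge P (e0 (eps k)) 0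
        & exists k, ord_eq P (e0 (eps k)) 0]].
Proof.
have [s [l [lam [ldual ltr hl]]]] := integral_dual_basis.
have [lamL lamE] := ldual.
pose E j k := lam k (l j).
have intE j k : integral_order (E j k).
  by move=> P pP Pp; have [e0 [_ h _ h']] := hl P pP Pp; apply: h'.
have radE j k := integral_order_radical (intE j k).
have EE j k : \sum_i E j i * E i k = E j k.
  by rewrite /E [RHS](functional_dual_basis ldual _ (lamL k)).
pose X : 'M[A]_s := \matrix_(j, k) tcoef (E j k) 0.
have XX : entries_in (@pradical p A) (X *m X - X).
  move=> j k; rewrite !mxE -EE tcoef_sum// -sumrB.
  apply: (ideal_sum nI) => i _; rewrite !mxE -opprB; apply: (idealN nI).
  exact: (tcoef0_mul_radical (radE j i) (radE i k)).
have [W [WW WX]] := lift_idempotent A_complete XX.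
have WXe j k : pradical p (W j k - X j k) by have := WX j k; rewrite !mxE.
have Xminor i k j r : pradical p (minor X i k j r).
  rewrite /minor !mxE.
  have h1 := tcoef0_mul_radical (radE i j) (radE k r).
  have h2 := tcoef0_mul_radical (radE i r) (radE k j).
  have e : E i j * E k r = E i r * E k j.
    by rewrite /E (r1 (l i) (l k) (lamL j) (lamL r)) mulrC.
  rewrite e in h1; have := idealB nI h2 h1; congr pradical; ring.
have Wminor i k j r : W i j * W k r = W i r * W k j.
  have h i' k' j' r' : pradical p (minor W i' k' j' r').
    have := idealD nI (idealB nI (ideal_mulB nI (WXe i' j') (WXe k' r'))
      (ideal_mulB nI (WXe i' r') (WXe k' j'))) (Xminor i' k' j' r').
    by rewrite /minor; congr pradical; ring.
  by apply/eqP; rewrite -subr_eq0; apply/eqP; apply: (idempotent_rank_one A_complete WW h).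
pose T := \sum_j \sum_k cst (W j k) * E k j.
have intT : integral_order T.
  do 2!apply: integral_order_sum => ?.
  by apply: integral_orderM => //; apply: integral_order_cst.
have [T' [TT' intT']] : exists y, T * y = 1 /\ integral_order y.
  apply: integral_unit => //.
  suff h : pradical p (tcoef T 0 - 1).
    by rewrite -(subrK 1 (tcoef T 0)) addrC; apply: (unit_1Dpradical sepA limA).
  have -> : tcoef T 0 - 1 =
      \sum_j (\sum_k (W j k - X j k) * X k j + (X *m X - X) j j).
    have -> : 1 = tcoef (1 : R) 0 by rewrite tcoef1.
    rewrite -ltr !tcoef_sum// -sumrB; apply: eq_bigr => j _.
    rewrite tcoef_sum// !mxE addrA -big_split; congr (_ - _).
    by apply: eq_bigr => k _; rewrite tcoef_aconstM// !mxE /=; ring.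
  apply: (ideal_sum nI) => j _; apply: (idealD nI); last exact: XX.
  by apply: (ideal_sum nI) => k _; apply: (ideal_mulr nI).
have WWe j k : \sum_i W j i * W i k = W j k by rewrite -{3}WW mxE.
have cWW j k : \sum_i cst (W j i) * cst (W i k) = cst (W j k).
  by rewrite -WWe rmorph_sum; apply: eq_bigr => i _; rewrite rmorphM.
pose eps k := \sum_b cst (W k b) *: l b.
pose sig k v := T' * \sum_a cst (W a k) * lam a v.
have sigL k : functional (sig k) by apply: functional_scale; apply: functional_lincomb.
have lamS c k : lam c (eps k) = \sum_b cst (W k b) * lam c (l b).
  by rewrite functional_sum.
have sigeps j k : sig k (eps j) = cst (W j k).
  rewrite /sig; transitivity (T' * (T * cst (W j k))); last by rewrite mulrA [T' * T]mulrC TT' mul1r.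
  congr (_ * _); rewrite /T mulr_suml; apply: eq_bigr => a _.
  rewrite lamS mulr_sumr mulr_suml; apply: eq_bigr => b _.
  have := congr1 cst (Wminor a j k b); rewrite !rmorphM /E => e.
  rewrite mulrA e; move: (lam a (l b)) => z; ring.
have sigE v : v = \sum_k sig k v *: eps k.
  apply: (functional_separate ldual) => c.
  rewrite functional_sum//.
  transitivity (T' * (T * lam c v)); first by rewrite mulrA [T' * T]mulrC TT' mul1r.
  transitivity (T' * \sum_a \sum_b (\sum_j cst (W a j) * cst (W j b)) * (lam a v * lam c (l b))).
    congr (_ * _); rewrite /T mulr_suml; apply: eq_bigr => a _.
    rewrite mulr_suml; apply: eq_bigr => b _; rewrite cWW.
    by rewrite -(r1 (l b) v (lamL a) (lamL c)) /E; ring.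
  under [RHS]eq_bigr do rewrite /sig lamS -mulrA.
  rewrite -mulr_sumr; congr (_ * _).
  under [RHS]eq_bigr => j _ do rewrite mulr_suml.
  rewrite [RHS]exchange_big; apply: eq_bigr => a _ /=.
  under [RHS]eq_bigr => j _ do rewrite mulr_sumr.
  rewrite [RHS]exchange_big; apply: eq_bigr => b _ /=.
  by rewrite mulr_suml; apply: eq_bigr => j _; ring.
exists s, W, eps, sig; split=> //.
move=> P pP Pp; have [e0 [ne h1 [a ha] h3]] := hl P pP Pp.
have he := norm_functional ne.
have heps k : ord_ge P (e0 (eps k)) 0.
  rewrite functional_sum//; apply: (ord_ge_sum A_complete pP) => b.
  rewrite -[0]addr0; apply: (ord_geM p_pr A_complete pP Pp) => //.
  exact: integral_order_cst.
exists e0; split=> //; apply: contrapT => /forallNP hn.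
case: ha => _; apply; rewrite (sigE (l a)) functional_sum//.
suff h : ord_ge P (\sum_k sig k (l a) * e0 (eps k)) 1 by apply: h.
apply: (ord_ge_sum A_complete pP) => k; rewrite -[1]add0r.
apply: (ord_geM p_pr A_complete pP Pp).
  rewrite -[0]addr0; apply: (ord_geM p_pr A_complete pP Pp); first exact: intT'.
  apply: (ord_ge_sum A_complete pP) => b; rewrite -[0]addr0.
  by apply: (ord_geM p_pr A_complete pP Pp); [apply: integral_order_cst | apply: h3].
move=> i i1; case: (ltP i 0) => i0; first exact: heps.
have -> : i = 0 by lia.
by apply: contrapT => h; apply: (hn k).
Qed.
Local Notation phiM := (@pg_phi _ _ _ M).
Local Notation gamM := (@pg_gam _ _ _ M).

Lemma phi_fixed h : phi h = h -> h = cst (tcoef h 0).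
Proof.
move=> hh; apply/eqP; rewrite -subr_eq0; apply/eqP; apply: R_separated => n.
apply/(coefs_in_pdvdE A_complete).
apply: (phi_fixed_const A_complete phi_gam (pdvd_ideal p A n) (fun=> id)).
by apply/(coefs_in_pdvdE A_complete); rewrite hh subrr; apply: pdvd0.
Qed.

Theorem character_basis : exists s (W : 'M[A]_s) (eps : 'I_s -> M) sig c d,
  [/\ dual_basis eps sig, forall j k, sig k (eps j) = cst (W j k),
      is_unit c, forall k, phiM (eps k) = cst c *: eps k
    & forall g, g \is a GRing.unit -> forall k, gamM g (eps k) = cst (d g) *: eps k].
Proof.
have [s [W [eps [sig [dual sigW hP]]]]] := constant_dual_basis.
have tr := trace_one dual r1 M_rank1.
have uniq r r' := @scalar_unique _ _ _ _ _ dual r r' tr.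
have phiL := phiM_semilinear M_etale.
have gamL g (ug : g \is a GRing.unit) a v w := pg_gam_semilinear M_etale ug a v w.
have phi_cst a := endo_aconst (ring_phi_linear phi_gam) a.
have gam_cst g (ug : g \is a GRing.unit) a := endo_aconst (ring_gam_linear phi_gam ug) a.
pose u := \sum_i sig i (phiM (eps i)).
have uE j : phiM (eps j) = u *: eps j.
  by apply: (semilinear_eigen dual r1 phiL) => i k; rewrite sigW phi_cst.
pose G g := \sum_i sig i (gamM g (eps i)).
have GE g (ug : g \is a GRing.unit) j : gamM g (eps j) = G g *: eps j.
  by apply: (semilinear_eigen dual r1 (gamL g ug)) => i k; rewrite sigW gam_cst.
have GM g g' : g \is a GRing.unit -> g' \is a GRing.unit ->
    G (g * g') = gam g (G g') * G g.
  move=> ug ug'; apply: uniq => k; rewrite -GE ?unitrM ?ug//.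
  rewrite ((pg_gam_action M_etale).2 g g' _ ug ug') GE//.
  by rewrite (semilinearZ (gamL g ug)) GE// scalerA.
have G1 : G 1 = 1.
  by apply: uniq => k; rewrite -GE ?unitr1// (pg_gam_action M_etale).1 scale1r.
have GU g : g \is a GRing.unit -> is_unit (G g).
  move=> ug; exists (gam g (G g^-1)); rewrite mulrC -GM ?unitrV//.
  by rewrite divrr.
have rel g : g \is a GRing.unit -> phi (G g) * u = gam g u * G g.
  move=> ug; apply: uniq => k; rewrite -!scalerA -uE -(GE g ug).
  rewrite -(semilinearZ phiL) -(semilinearZ (gamL g ug)) -uE -(GE g ug).
  exact: (pg_phi_gam M_etale).
have ordu P : prime_ideal P -> P p%:R -> ord_eq P u 0.
  move=> pP Pp; have [e0 [ne h0 [k hk]]] := hP P pP Pp.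
  have := norm_eq A_complete phi_gam M_etale dual r1 pP Pp ne hk.
  rewrite mulr0 uE (functionalZ (norm_functional ne)) mulrC => h.
  by apply: (ord_eq_cancel p_pr A_complete pP Pp hk); rewrite addr0.
have uneg i : i < 0 -> pradical p (tcoef u i).
  move=> i0; apply: contrapT => /pradicalP[P [pP Pp]]; apply.
  exact: (ordu P pP Pp).1.
have u0 : is_unit (tcoef u 0).
  apply: (unit_primesP (padically_complete_separated A_complete)
    (padically_complete_limits A_complete)) => P pP Pp.
  exact: (ordu P pP Pp).2.
have tw : twist phi gam u (fun a => G a%:R).
  split=> [|a ap|a ap|a b ap bp]; first exact: (unit_of_coefs A_complete uneg u0).
  - exact/GU/Zpadic_nat_unit.
  - exact/rel/Zpadic_nat_unit.
  - have ua := Zpadic_nat_unit p_pr ap; have ub := Zpadic_nat_unit p_pr bp.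
    by rewrite mulrC [RHS]mulrC -!GM// mulrC.
have [f [c [[f' ff'] uc uf]]] := twist_trivial A_complete phi_gam tw uneg u0.
(* The scalar of gamma_g on the f eps_k. It is fixed by phi because phi commutes with gamma_g and
   acts on f eps_k through the constant c, which gamma_g fixes. *)
pose D g := gam g f * G g * f'.
have DE g : D g * f = gam g f * G g.
  by rewrite /D -mulrA [f' * f]mulrC ff' mulr1.
have Dfix g : g \is a GRing.unit -> phi (D g) = D g.
  move=> ug; have ucf : is_unit (cst c * f).
    by apply: is_unitM; [apply: is_unit_rmorph | exists f'].
  apply: (is_unit_cancel ucf).
  have e1 : gam g u * gam g (phi f) = cst c * gam g f.
    by rewrite -rmorphM uf rmorphM gam_cst.
  have e2 : phi (D g) * phi f = gam g (phi f) * phi (G g).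
    by rewrite -[LHS]rmorphM DE rmorphM (ring_phi_gam phi_gam).
  have e3 := rel g ug; have e4 := DE g.
  transitivity (phi (D g) * phi f * u); first by rewrite -uf; ring.
  rewrite e2; transitivity (gam g (phi f) * (phi (G g) * u)); first by ring.
  rewrite e3; transitivity (gam g u * gam g (phi f) * G g); first by ring.
  by rewrite e1 -mulrA -e4; ring.
exists s, W, (fun k => f *: eps k), (fun k v => f' * sig k v), c,
  (fun g => tcoef (D g) 0); split=> //.
- split=> [k|v]; first exact: functional_scale (dual.1 k) f'.
  rewrite {1}(dual.2 v); apply: eq_bigr => k _.
  by rewrite scalerA mulrAC [f' * f]mulrC ff' mul1r.
- by move=> j k; rewrite (functionalZ (dual.1 k)) mulrA [f' * f]mulrC ff' mul1r sigW.
- by move=> k; rewrite (semilinearZ phiL) uE !scalerA mulrC uf.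
move=> g ug k; rewrite -(phi_fixed (Dfix g ug)).
by rewrite (semilinearZ (gamL g ug)) (GE g ug) !scalerA DE.
Qed.

Section CharacterBasis.
Variables (s : nat) (W : 'M[A]_s) (eps : 'I_s -> M) (sig : 'I_s -> M -> R).
Variable d : Zpadic p_pr -> A.
Hypotheses (dual : dual_basis eps sig) (sigW : forall j k, sig k (eps j) = cst (W j k)).
Hypothesis gam_eps : forall g, g \is a GRing.unit -> forall k,
  gamM g (eps k) = cst (d g) *: eps k.

Let tr := trace_one dual r1 M_rank1.

Lemma trace_constant : \sum_k W k k = 1.
Proof.
apply: (aconst_inj A_complete); rewrite rmorph1 -tr rmorph_sum.
by apply: eq_bigr => k _; rewrite sigW.
Qed.

Lemma constant_scalar_unique a b : (forall k, cst a *: eps k = cst b *: eps k) -> a = b.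
Proof. by move=> h; apply: (aconst_inj A_complete); apply: (scalar_unique dual tr). Qed.

Lemma character_one : d 1 = 1.
Proof.
apply: constant_scalar_unique => k; rewrite -gam_eps ?unitr1//.
by rewrite (pg_gam_action M_etale).1 rmorph1 scale1r.
Qed.

Lemma character_mul g h : g \is a GRing.unit -> h \is a GRing.unit -> d (g * h) = d g * d h.
Proof.
move=> ug uh; apply: constant_scalar_unique => k; rewrite -gam_eps ?unitrM ?ug//.
rewrite ((pg_gam_action M_etale).2 g h _ ug uh) gam_eps//.
rewrite (semilinearZ (pg_gam_semilinear M_etale ug)) gam_eps// scalerA.
by rewrite (endo_aconst (ring_gam_linear phi_gam ug)) mulrC rmorphM.
Qed.

(** The condition that p^a divides the constant terms of all sig_j(v) is open, since the
    sig_j(eps_i) are constants. Continuity of the action at eps_j then gives p^a | (d(h) - d(g))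
    W_jj, and the W_jj sum to 1. *)
Lemma character_continuous a g : g \is a GRing.unit -> exists m, forall h,
  h \is a GRing.unit -> pdvd p m (h - g) -> pdvd p a (d h - d g).
Proof.
move=> ug; pose N : set M := fun v => forall j, pdvd p a (tcoef (sig j v) 0).
have nbhsN : mod_nbhs0 N.
  exists s, eps; split; first by move=> v; exists (fun j => sig j v); apply: dual.2.
  exists a, 1 => c hc j; rewrite (functional_sum (dual.1 j)) tcoef_sum//.
  apply: (ideal_sum (pdvd_ideal p A a)) => i _; rewrite sigW mulrC tcoef_aconstM//.
  by apply: pdvdMl; apply: (aballP A_complete _ _ _).1 (hc i) _ _.
have hj j : exists m, forall h, h \is a GRing.unit -> pdvd p m (h - g) ->
    pdvd p a ((d h - d g) * W j j).
  have [m [N' [[k [e [_ [b [n hN']]]]] hm]]] :=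
    pg_gam_continuous M_etale (eps j) ug nbhsN.
  exists m => h uh hg; have N'0 : N' (eps j - eps j).
    have -> : eps j - eps j = \sum_i (0 : R) *: e i.
      by rewrite subrr big1// => i _; rewrite scale0r.
    apply: hN' => i; apply/(aballP A_complete) => l _.
    by rewrite tcoef0//; apply: pdvd0.
  have := hm h (eps j) uh hg N'0 j.
  rewrite !gam_eps// -scalerBl (functionalZ (dual.1 j)) sigW -rmorphB -rmorphM.
  by rewrite tcoef_aconst//.
have [m hm] := choice hj; exists (\sum_j m j)%N => h uh hg.
rewrite -[d h - d g]mulr1 -trace_constant mulr_sumr.
apply: (ideal_sum (pdvd_ideal p A a)) => j _; apply: hm => //.
by apply: pdvd_le hg; rewrite (bigD1 j)//= leq_addr.
Qed.

End CharacterBasis.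
End ConstantBasis.

(** * Characters of Q_p^* from a value at p and a character of Z_p^* *)

Lemma compl_truncate (p : nat) (S : comPzRingType) n (x : completion p S) :
  pdvd p n (x - to_completion p (repr x n)).
Proof.
apply/repr_pdvd; have h := repr_sub n x (to_completion p (repr x n)).
have h' := cseq_reprP (CoherentSeq (const_coherent p (repr x n))) n.
by have := pdvdD h h'; rewrite subrK.
Qed.

Section PadicUnits.
Variables (p : nat) (p_pr : prime p).
Local Notation Z_p := (Zpadic p_pr).
Implicit Types x y z w : Z_p.

Let sepZ : pseparated p Z_p := completion_separated (S := int) (p := p).

Lemma Zpadic_modp x : exists a : nat, pdvd p 1 (x - a%:R).
Proof.
pose r : int := repr (x : completion p int) 1.
have hx : pdvd p 1 (x - r%:~R).
  have := compl_truncate 1 (x : completion p int).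
  by congr (pdvd p 1 (_ - _)); rewrite -(rmorph_int (@to_completion p int)) intz.
exists `|(r %% p)%Z|%N; set a := `|_|%N.
have rE : r%:~R = (r %/ p)%Z%:~R * p%:R + a%:R :> Z_p.
  have aE : a%:Z = (r %% p)%Z by rewrite /a gez0_abs// modz_ge0//; move: p_pr; case: (p).
  by rewrite {1}(divz_eq r p) -aE rmorphD rmorphM.
have -> : x - a%:R = (x - r%:~R) + (r %/ p)%Z%:~R * p%:R by rewrite rE; ring.
by apply: pdvdD => //; rewrite mulrC; exists (r %/ p)%Z%:~R; rewrite expr1.
Qed.

Lemma Zpadic_p_or_unit x : pdvd p 1 x \/ x \is a GRing.unit.
Proof.
have [a ha] := Zpadic_modp x; have [/dvdnP[k ak]|pa] := boolP (p %| a)%N.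
  rewrite {}ak in ha; left; rewrite -(subrK (k * p)%:R x); apply: pdvdD => //; rewrite natrM.
  by rewrite mulrC; exists k%:R; rewrite expr1.
right; have ca : coprime a p by rewrite coprime_sym prime_coprime.
have [b hb] := (Zpadic_unitP _).2 (Zpadic_nat_unit p_pr ca).
apply/Zpadic_unitP; apply: (@unit_modp p Z_p sepZ (completion_limits (S := int) (p := p)) _ b).
by rewrite -hb -mulrBl; apply: pdvdMr.
Qed.

Lemma p_not_unit w y : p%:R * y = w -> w \isn't a GRing.unit.
Proof.
move=> pw; apply/negP => /Zpadic_unitP[v wv]; have := oner_neq0 Z_p => /eqP; apply.
apply: sepZ => n; exists ((y * v) ^+ n).
by rewrite -exprMn mulrA pw wv expr1n.
Qed.

Lemma Zpadic_factor z : z != 0 -> exists n w, w \is a GRing.unit /\ z = p%:R ^+ n * w.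
Proof.
move=> z0; pose bad n := `[< ~ pdvd p n z >].
have badn : exists n, bad n.
  apply: contrapT => /forallNP h; move/eqP: z0; apply; apply: sepZ => n.
  by apply: contrapT => hn; apply: (h n); apply/asboolP.
case: (ex_minnP badn) => -[|n] /asboolP hn nmin.
  by case: hn; exists z; rewrite mul1r.
have [w zw] : pdvd p n z.
  apply: contrapT => h; have : bad n by apply/asboolP.
  by move/nmin; rewrite ltnn.
exists n, w; split=> //; have [[y wy]|//] := Zpadic_p_or_unit w.
by case: hn; exists y; rewrite zw wy expr1 exprSr mulrA.
Qed.

Lemma p_neq0 : p%:R != 0 :> Z_p.
Proof. exact/zp_natr_neq0/prime_gt0. Qed.

Lemma Zpadic_factor_unique n n' w w' : w \is a GRing.unit -> w' \is a GRing.unit ->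
  p%:R ^+ n * w = p%:R ^+ n' * w' -> n = n' /\ w = w'.
Proof.
wlog nn : n n' w w' / (n <= n')%N => [hw|] uw uw' e.
  case: (leqP n n') => nn; first exact: hw.
  by have [] := hw n' n w' w (ltnW nn) uw' uw (esym e).
move: e; rewrite -(subnKC nn) exprD -mulrA => /mulfI.
move=> /(_ (expf_neq0 _ p_neq0)); case: (n' - n)%N => [|k]; first by rewrite addn0 mul1r.
by rewrite exprS -mulrA => e; move: (p_not_unit (esym e)); rewrite uw.
Qed.

End PadicUnits.

Section Character.
Local Open Scope quotient_scope.
Variables (p : nat) (p_pr : prime p) (A : comPzRingType).
Local Notation Z_p := (Zpadic p_pr).
Local Notation Q_p := (Qpadic p_pr).
Local Notation tofrac := (@FracField.tofrac Z_p).
Variables (c c' : A) (d : Z_p -> A).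
Hypothesis cc' : c * c' = 1.
Hypothesis d1 : d 1 = 1.
Hypothesis dM : forall g h, g \is a GRing.unit -> h \is a GRing.unit -> d (g * h) = d g * d h.
Hypothesis d_cont : forall a g, g \is a GRing.unit -> exists m, forall h,
  h \is a GRing.unit -> pdvd p m (h - g) -> pdvd p a (d h - d g).

(* [x = p^(m - n) * w]. *)
Definition padic_form (x : Q_p) n m (w : Z_p) :=
  w \is a GRing.unit /\ x * tofrac (p%:R ^+ n) = tofrac (p%:R ^+ m * w).

Lemma fraction_cross (D : idomainType) (x : {fraction D}) :
  exists a b, b != 0 /\ x * FracField.tofrac b = FracField.tofrac a.
Proof.
elim/quotW: x => r; exists (frac r).1, (frac r).2; split; first exact: denom_ratioP.
rewrite !piE; apply/eqmodP; rewrite /= FracField.equivfE.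
rewrite /FracField.mulf !numden_Ratio ?oner_neq0 ?mulr1 ?mulf_neq0 ?denom_ratioP//.
by rewrite mulrC.
Qed.

Lemma padic_form_exists x : x != 0 -> exists n m w, padic_form x n m w.
Proof.
move=> x0; have [a [b [b0 xb]]] := fraction_cross x.
have a0 : a != 0 
  by have := mulf_neq0 x0 (_ : FracField.tofrac b != 0); rewrite xb !tofrac_eq0; apply.
have [m [v [uv aE]]] := Zpadic_factor a0; have [n [w [uw bE]]] := Zpadic_factor b0.
exists n, m, (v * w^-1); split; first by rewrite unitrM uv unitrV.
have w0 : tofrac w != 0 by rewrite tofrac_eq0; apply: contraTneq uw => ->; rewrite unitr0.
apply: (mulIf w0); rewrite -mulrA -!rmorphM -bE xb aE.
by rewrite mulrA mulrVK.
Qed.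

Lemma padic_form_value x n m w n' m' w' : padic_form x n m w -> padic_form x n' m' w' ->
  c' ^+ n * c ^+ m * d w = c' ^+ n' * c ^+ m' * d w'.
Proof.
move=> [uw e] [uw' e'].
have h : p%:R ^+ (m + n') * w = p%:R ^+ (m' + n) * w'.
  apply/eqP; rewrite -tofrac_eq; apply/eqP.
  transitivity (x * tofrac (p%:R ^+ n) * tofrac (p%:R ^+ n')).
    by rewrite e -rmorphM; congr tofrac; rewrite exprD; ring.
  by rewrite mulrAC e' -rmorphM; congr tofrac; rewrite exprD; ring.
have [E ->] := Zpadic_factor_unique uw uw' h; congr (_ * _).
have cn k : c ^+ k * c' ^+ k = 1 by rewrite -exprMn cc' expr1n.
transitivity (c' ^+ n * c' ^+ n' * c ^+ (m + n')).
  by rewrite exprD; transitivity (c' ^+ n * c ^+ m * (c ^+ n' * c' ^+ n')); [rewrite cn mulr1 | ring].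
rewrite E exprD; transitivity (c' ^+ n' * c ^+ m' * (c ^+ n * c' ^+ n)); first by ring.
by rewrite cn mulr1.
Qed.

Lemma character_exists : exists delta : Q_p -> A,
  [/\ continuous_character delta, delta p%:R = c
    & forall g, g \is a GRing.unit -> delta (tofrac g) = d g].
Proof.
have value_exists x : exists y, forall n m w, padic_form x n m w ->
    y = c' ^+ n * c ^+ m * d w.
  have [[n [m [w h]]]|h] := pselect (exists n m w, padic_form x n m w).
    by exists (c' ^+ n * c ^+ m * d w) => n' m' w'; apply: padic_form_value.
  by exists 0 => n m w hx; case: h; exists n, m, w.
have [delta hd] := choice value_exists.
have dunit g : g \is a GRing.unit -> delta (tofrac g) = d g.
  move=> ug; rewrite (hd _ 0%N 0%N g) ?expr0 ?mul1r//.
  by split; rewrite // !expr0 mul1r rmorph1 mulr1.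
exists delta; split=> //; last first.
  rewrite (hd _ 0%N 1%N 1) ?expr0 ?expr1 ?mul1r ?d1 ?mulr1//.
  by split; [rewrite unitr1 | rewrite expr0 expr1 rmorph1 !mulr1 rmorph_nat].
split.
- by rewrite -(rmorph1 tofrac) dunit ?unitr1.
- move=> x y /padic_form_exists[n [m [w h]]] /padic_form_exists[n' [m' [w' h']]].
  have hxy : padic_form (x * y) (n + n') (m + m') (w * w').
    case: h h' => uw e [uw' e']; split; first by rewrite unitrM uw.
    rewrite exprD rmorphM mulrACA e e' -rmorphM; congr tofrac; rewrite exprD; ring.
  rewrite (hd _ _ _ _ h) (hd _ _ _ _ h') (hd _ _ _ _ hxy).
  case: h h' => uw _ [uw' _]; rewrite dM// !exprD; ring.
move=> a x /padic_form_exists[n [m [w h]]].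
have [uw e] := h; have [M hM] := d_cont a uw.
(* If y = x + p^(m+M+1) z, then y p^n = p^m w' with w' - w divisible by p^(n+M+1); the extra 1 keeps
   w' a unit. *)
exists (m + M.+1)%N => y y0 [z hz].
pose w' := w + p%:R ^+ (n + M.+1) * z.
have hw' k : (k <= n + M.+1)%N -> pdvd p k (w' - w).
  by move=> kM; rewrite /w' addrC addrA addNr add0r; apply: (pdvd_le kM); exists z.
have uw' : w' \is a GRing.unit.
  have [pw'|//] := Zpadic_p_or_unit w'.
  have [v hv] : pdvd p 1 w.
    by rewrite -(subKr w' w); apply: pdvdB => //; apply: hw'; rewrite addnS.
  by rewrite -[_ \is a _]negbK (@p_not_unit _ _ w v) in uw; rewrite // hv expr1.
have h' : padic_form y n m w'.
  split=> //; rewrite -(subrK x y) hz mulrDl e -!rmorphM -rmorphD; congr tofrac.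
  by rewrite /w' mulrDr !exprD; ring.
rewrite (hd _ _ _ _ h) (hd _ _ _ _ h') -mulrBr; apply: pdvdMl.
by apply: hM => //; apply: hw'; rewrite addnS ltnW// ltnS leq_addl.
Qed.

End Character.

(** * The image of an idempotent matrix of rank one *)

Section FixedRows.
Variables (A : comPzRingType) (s : nat) (W : 'M[A]_s).

(** For idempotent W this is the image of W on row vectors; as a predicate closed under the
    operations it inherits the module structure. *)
Definition fixed_rows : {pred 'rV[A]_s} := fun x => x *m W == x.

Lemma fixed_rows_submod : submod_closed fixed_rows.
Proof.
split=> [|a x y /eqP hx /eqP hy]; first by apply/eqP; rewrite mul0mx.
by apply/eqP; rewrite mulmxDl -scalemxAl hx hy.
Qed.

HB.instance Definition _ :=
  GRing.isSubmodClosed.Build A 'rV[A]_s fixed_rows fixed_rows_submod.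

Record fixed_row := FixedRow { row_val :> 'rV[A]_s; row_valP : row_val \in fixed_rows }.

HB.instance Definition _ := [isSub for row_val].
HB.instance Definition _ := [Choice of fixed_row by <:].
HB.instance Definition _ := [SubChoice_isSubLmodule of fixed_row by <:].

Lemma fixed_rowE (x : fixed_row) : x *m W = x.
Proof. by apply/eqP; apply: (row_valP x). Qed.

Hypothesis WW : W *m W = W.

Lemma mulmx_fixed x : x *m W \in fixed_rows.
Proof. by apply/eqP; rewrite -mulmxA WW. Qed.

Definition row_proj (x : 'rV[A]_s) : fixed_row := FixedRow (mulmx_fixed x).

Lemma row_proj_is_linear : linear row_proj.
Proof. by move=> a x y; apply/val_inj; rewrite /= mulmxDl -scalemxAl. Qed.

HB.instance Definition _ := GRing.isLinear.Build A 'rV[A]_s fixed_row _ row_proj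
  row_proj_is_linear.

Hypothesis Wminor : forall i k j r, W i j * W k r = W i r * W k j.
Hypothesis Wtrace : \sum_k W k k = 1.

Definition fixed_gen k : fixed_row := row_proj (delta_mx 0 k).

Lemma fixed_genE k j : (fixed_gen k : 'rV_s) 0 j = W k j.
Proof. by rewrite /fixed_gen /= -rowE mxE. Qed.

Lemma fixed_row_sum (x : fixed_row) : x = \sum_k (x : 'rV_s) 0 k *: fixed_gen k.
Proof.
transitivity (row_proj x); first by apply/val_inj; rewrite /= fixed_rowE.
rewrite [X in row_proj X]row_sum_delta linear_sum.
by apply: eq_bigr => k _; rewrite linearZ.
Qed.

(** At a prime P some W_kk is outside P, as the trace is 1. The vanishing minors give W_kk v = v_k
    (row k of W), so this row is a local basis. *)
Lemma fixed_rows_invertible : invertible_module fixed_row.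
Proof.
split; first by exists s, (val : {linear fixed_row -> 'rV_s}), row_proj => x;
  apply/val_inj; rewrite /= fixed_rowE.
move=> P pP; have PI := prime_is_ideal pP; have [_ _ _ P1 _] := pP.
have [k Wk] : exists k, ~ P (W k k).
  apply: contrapT => /forallNP h; apply: P1; rewrite -Wtrace.
  by apply: (ideal_sum PI) => k _; apply: contrapT; apply: h.
exists (fun=> fixed_gen k); split.
  move=> v; exists (W k k), (fun=> (v : 'rV_s) 0 k); split=> //; rewrite big_ord1.
  apply/val_inj/rowP => j.
  transitivity (W k k * (v : 'rV_s) 0 j); first by rewrite mxE.
  transitivity ((v : 'rV_s) 0 k * (fixed_gen k : 'rV_s) 0 j); last by rewrite [RHS]mxE.
  rewrite fixed_genE -(fixed_rowE v) ![(_ *m W) _ _]mxE mulr_sumr mulr_suml; apply: eq_bigr => i _.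
  by rewrite mulrCA [W k k * _]mulrC Wminor mulrA.
move=> c; rewrite big_ord1 => h; exists (W k k); split=> // i; rewrite ord1 mulrC.
rewrite -(fixed_genE k k).
by have := congr1 (fun x : fixed_row => (x : 'rV_s) 0 k) h; rewrite [LHS]mxE [RHS]mxE.
Qed.

End FixedRows.

(** * Pure tensors *)

Section PureTensors.
Local Open Scope quotient_scope.
Variables (R S : comPzRingType) (f : {rmorphism R -> S}) (W : lmodType R).
Local Notation SW := (tens f S^o W).

Definition ptens1 (w : W) : SW := ptens f (1 : S^o) w.

Lemma pi_tensZ a (l : seq (S^o * W)) : a *: \pi_SW l = \pi_SW (seq_scale a l).
Proof. by rewrite [RHS]pi_tens_scale. Qed.

Lemma pi_tensD (l l' : seq (S^o * W)) : \pi_SW l + \pi_SW l' = \pi_SW (l ++ l').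
Proof. by rewrite [RHS]pi_tens_add. Qed.

Lemma ptensZ (a : S) (w : W) : ptens f (a : S^o) w = a *: ptens1 w.
Proof. by rewrite /ptens1 /ptens pi_tensZ /= /GRing.scale /= mulr1. Qed.

Lemma pi_tens_sum (l : seq (S^o * W)) : \pi_SW l = \sum_(x <- l) (x.1 : S) *: ptens1 x.2.
Proof.
elim: l => [|[a w] l IH].
  by rewrite big_nil -(addrK (\pi_SW [::]) (\pi_SW [::])) pi_tensD subrr.
by rewrite big_cons -IH -ptensZ /ptens pi_tensD.
Qed.

Lemma ptens1D v v' : ptens1 (v + v') = ptens1 v + ptens1 v'.
Proof. by rewrite /ptens1 /ptens pi_tensD; apply/eqmodP/tens_eqP/tens_addr. Qed.

Lemma ptens1Z r w : ptens1 (r *: w) = f r *: ptens1 w.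
Proof.
rewrite -ptensZ; apply/esym/eqmodP/tens_eqP; have := tens_bal f r (1 : S^o) w.
by rewrite {1}/GRing.scale /= mulr1.
Qed.

Lemma ptens1_0 : ptens1 0 = 0.
Proof. by have := ptens1Z 0 0; rewrite rmorph0 !scale0r. Qed.

Lemma tens_sum (t : SW) : exists l : seq (S^o * W), t = \sum_(x <- l) (x.1 : S) *: ptens1 x.2.
Proof. by exists (repr t); rewrite -pi_tens_sum reprK. Qed.

Section Sum.
Variables (J : Type) (r : seq J) (c : J -> S) (w : J -> W).

Lemma sum_ptens1 : \sum_(j <- r) c j *: ptens1 (w j) = \pi_SW [seq (c j : S^o, w j) | j <- r].
Proof. by rewrite pi_tens_sum big_map. Qed.

Lemma linearization_sum (V : lmodType S) (g : W -> V) : linear_for (f \; *:%R) g ->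
  linearization g (\sum_(j <- r) c j *: ptens1 (w j)) = \sum_(j <- r) c j *: g (w j).
Proof. by move=> gL; rewrite sum_ptens1 linearization_pi// big_map. Qed.

Lemma tens_map_sum (h : S^o -> S^o) :
    {morph h : x y / x + y} -> (forall a v, h (f a *: v) = f a *: h v) ->
  tens_map h (\sum_(j <- r) c j *: ptens1 (w j)) = \sum_(j <- r) (h (c j) : S) *: ptens1 (w j).
Proof.
move=> hD hZ; rewrite sum_ptens1 tens_map_pi// -map_comp.
by rewrite pi_tens_sum big_map.
Qed.

End Sum.
End PureTensors.

(** * The isomorphism *)

Section Isomorphism.
Variables (S A : comPzRingType) (f : {rmorphism A -> S}) (V : lmodType S).
Variables (s : nat) (W : 'M[A]_s) (eps : 'I_s -> V) (sig : 'I_s -> V -> S).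
Hypotheses (dual : dual_basis eps sig) (sigW : forall j k, sig k (eps j) = f (W j k)).
Hypothesis WW : W *m W = W.
Local Notation L := (fixed_row W).
Local Notation SL := (tens f S^o L).
Local Notation gen := (fixed_gen WW).

Definition to_tens (v : V) : SL := \sum_k sig k v *: ptens1 f (gen k).

Lemma to_tens_is_linear : linear to_tens.
Proof.
move=> a v w; rewrite scaler_sumr -big_split; apply: eq_bigr => k _ /=.
by rewrite (dual.1 k) scalerDl scalerA.
Qed.

HB.instance Definition _ := GRing.isLinear.Build S V SL _ to_tens to_tens_is_linear.

Definition to_tens_linear : {linear V -> SL} := to_tens.

(** The A-linear map taking row k of W to eps_k; its linearization is the inverse of [to_tens]. *)
Definition row_comb (x : L) : V := \sum_k f ((x : 'rV_s) 0 k) *: eps k.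

Lemma row_comb_linear : linear_for (f \; *:%R) row_comb.
Proof.
move=> a x y; rewrite /= scaler_sumr -big_split; apply: eq_bigr => k _ /=.
by rewrite !mxE rmorphD rmorphM scalerDl scalerA.
Qed.

Lemma row_comb_gen k : row_comb (gen k) = eps k.
Proof.
rewrite [RHS](dual.2 (eps k)); apply: eq_bigr => j _.
by rewrite fixed_genE sigW.
Qed.

Lemma to_tens_row_comb x : to_tens (row_comb x) = ptens1 f x.
Proof.
rewrite {2}(fixed_row_sum WW x) (big_morph _ (ptens1D f (W := L)) (ptens1_0 _ _)); apply: eq_bigr => k _.
rewrite ptens1Z; congr (_ *: _); rewrite /row_comb (functional_sum (dual.1 k)).
rewrite -{2}(fixed_rowE x) mxE rmorph_sum; apply: eq_bigr => j _.
by rewrite rmorphM sigW.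
Qed.

Lemma to_tens_bijective : bijective to_tens.
Proof.
have gL := row_comb_linear.
exists (linearization row_comb) => [v|t].
  rewrite linearization_sum// [RHS](dual.2 v); apply: eq_bigr => k _.
  by rewrite row_comb_gen.
have [l ->] := tens_sum t; rewrite linearization_sum// linear_sum; apply: eq_bigr => x _.
by rewrite linearZ /= to_tens_row_comb.
Qed.

(** Treats phi and every gamma_g at once: the right-hand side is the action on A'(delta) tensored
    with L for delta-value e. Both sides are semilinear, so it suffices to compare them on the
    eps_k. *)
Lemma to_tens_semilinear (sg : {rmorphism S -> S}) (h : V -> V) (e : A) :
    (forall a v w, h (a *: v + w) = sg a *: h v + h w) ->
    (forall a, sg (f a) = f a) -> (forall k, h (eps k) = f e *: eps k) ->
  forall v, to_tens (h v) = tens_map (fun x : S^o => sg x * f e : S^o) (to_tens v).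
Proof.
move=> hL fixed he v; rewrite tens_map_sum; last 2 first.
- by move=> x y; rewrite rmorphD mulrDl.
- by move=> a x; rewrite /GRing.scale /= rmorphM fixed mulrA.
rewrite {1}(dual.2 v) (semilinear_sum hL) linear_sum; apply: eq_bigr => k _.
rewrite he scalerA linearZ /= -[in LHS](row_comb_gen k).
by rewrite to_tens_row_comb.
Qed.

End Isomorphism.

Theorem theorem1p1 (p : nat) (p_pr : prime p)
    (A : comPzRingType) (sA : {rmorphism Zpadic p_pr -> A})
    (A_complete : padically_complete p A)
    (phi : {rmorphism AQp p A -> AQp p A})
    (gam : Zpadic p_pr -> {rmorphism AQp p A -> AQp p A})
    (phi_gam : phiGamma_ring sA phi gam)
    (M : phiGamma_data p_pr A)
    (M_etale : etale_phiGamma_module phi gam M)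
    (M_rank1 : constant_rank M 1) :
  exists (delta : Qpadic p_pr -> A) (L : lmodType A),
    [/\ continuous_character delta, invertible_module L
      & phiGamma_iso M (pg_tens (pg_char phi gam delta) L)].
Proof.
have [s [W [eps [sig [c [d [dual sigW [c' cc'] phi_eps gam_eps]]]]]]] :=
  character_basis A_complete phi_gam M_etale M_rank1.
have r1 := constant_rank_one M_rank1.
have inj := aconst_inj A_complete.
have WW : W *m W = W.
  apply/matrixP => j k; rewrite mxE; apply: inj; rewrite rmorph_sum -[RHS]sigW.
  rewrite [RHS](functional_dual_basis dual _ (dual.1 k)); apply: eq_bigr => i _.
  by rewrite rmorphM !sigW.
have Wminor i k j r : W i j * W k r = W i r * W k j.
  by apply: inj; rewrite !rmorphM -!sigW (r1 _ _ _ _ (dual.1 j) (dual.1 r)) mulrC.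
have [delta [char_delta delta_p delta_unit]] := character_exists cc'
  (character_one A_complete M_etale M_rank1 dual gam_eps)
  (character_mul A_complete phi_gam M_etale M_rank1 dual gam_eps)
  (character_continuous A_complete M_etale M_rank1 dual sigW gam_eps).
exists delta, (fixed_row W); split=> //.
  exact: (fixed_rows_invertible WW Wminor
    (trace_constant A_complete M_rank1 dual sigW)).
exists (to_tens_linear (aconst p A) dual WW); split.
- exact: (to_tens_bijective dual sigW WW).
- move=> v; rewrite /= delta_p.
  apply: (to_tens_semilinear dual sigW WW (phiM_semilinear M_etale) _ phi_eps) => a.
  exact: endo_aconst (ring_phi_linear phi_gam) a.
move=> g v ug; rewrite /= delta_unit//.
apply: (to_tens_semilinear dual sigW WW (pg_gam_semilinear M_etale ug) _ (gam_eps g ug)) => a.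
exact: endo_aconst (ring_gam_linear phi_gam ug) a.
Qed.
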